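(* Let $P$ be a Markov kernel on a measurable space $(E,\mathcal{E})$. Assume that there exists a non-empty subset $C\in\mathcal{E}$ verifying the following conditions: (a) there exist a measurable function $w:E\to[1,+\infty[$ and constants $r_1>1$, $\eta\ge0$ such that $Pw\le r_1^{-1}(w\,1_{C^c}+\eta\,1_C)$; (b) there exist $b$ with $0<b\le1$, a probability measure $\nu$ on $(E,\mathcal{E})$ and $\alpha\in\mathcal{H}^{(w)}_\nu$ such that $T_{\nu,\alpha}$ is Markov and, for all $x\in E$ and $A\in\mathcal{E}$, $P(x,A)\ge b\,1_C(x)\,T_{\nu,\alpha}(x,A)$. Then $P$ is quasi-compact on $\mathcal{B}_w$ with spectral radius $r^w(P)=1$. Moreover, define the Markov kernel $P_0$ by $$P_0(x,A)=\frac{1}{1-b\,1_C(x)}\Big(P(x,A)-b\,1_C(x)\,T_{\nu,\alpha}(x,A)\Big)\quad\text{if } b<1\text{ or }x\notin C,$$ $$P_0(x,A)=1_A(x)\quad\text{if } b=1\text{ and }x\in C,$$ and set, for $0\le r\le r_1$, $h(r)=\sup_{x\in C}\int P_0(x,dy)\,r\,E_y[r^{\sigma_C}]$. Then: (i) $h(r_1)<+\infty$ and $r_b=\sup\{r:0\le r\le r_1,\ h(r)<\frac{1}{1-b}\}>1$ (where $\frac1{1-b}=+\infty$ if $b=1$); (ii) $r_e^w(P)\le r_b^{-1}$; (iii) if $\chi\in\mathcal{X}$ is such that $\|\chi\|\,r_b^{-1}<r^w(P_\chi)$, the kernel $P_\chi$ is quasi-compact on $\mathcal{B}_w$ and $r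_e^w(P_\chi)\le\|\chi\|\,r_b^{-1}$.
   Context: A Markov kernel on $(E,\mathcal{E})$ is a function $P:E\times\mathcal{E}\to[0,1]$ with $P(\cdot,A)$ measurable for every $A\in\mathcal{E}$ and $P(x,\cdot)$ a probability measure for every $x\in E$; $Pf(x)=\int f(y)P(x,dy)$. $(X_n)_{n\ge0}$ is a Markov chain associated with $P$, $E_x$ is the expectation when the chain starts at $X_0=x$, and $\sigma_C=\inf\{n\ge0:X_n\in C\}$. For measurable $w:E\to[1,+\infty[$, $\mathcal{B}_w$ is the Banach space of complex measurable functions $f$ on $E$ with $\|f\|_w=\sup_E w^{-1}|f|<+\infty$. For a bounded operator $T$ on $\mathcal{B}_w$, $r^w(T)$ and $r_e^w(T)$ are its spectral radius and essential spectral radius on $\mathcal{B}_w$; $T$ is quasi-compact on $\mathcal{B}_w$ if $r_e^w(T)<r^w(T)$. Here the essential spectral radius of a bounded operator $T$ on a Banach space $B$ with spectral radius $r(T)$ is the infimum of $r(T)$ and of the real numbers $\rho\ge0$ such that $B=F_\rho\oplus H_\rho$ where $F_\rho,H_\rho$ are $T$-invariant subspaces, $H_\rho$ is closed, $r(T_{|H_\rho})<\rho$, $\dim F_\rho<+\infty$ and all eigenvalues of $T_{|F_\rho}$ have modulus $\ge\rho$. For a probability measure $\nu$ on $(E,\mathcal{E})$, $\mathcal{H}^{(w)}_\nu$ is the set of nonnegative measurable functions $\alpha$ on $E\times E$ such that the functions $\alpha^{(w)}(x,\cdot)=w(x)^{-1}\alpha(x,\cdot)w(\cdot)$, $x\in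 E$, are uniformly $\nu$-integrable, i.e. $\lim_{m\to+\infty}\sup_{x\in E}\int_{\{y:\alpha^{(w)}(x,y)\ge m\}}\alpha^{(w)}(x,y)\,d\nu(y)=0$; and $T_{\nu,\alpha}(x,A)=\int_A\alpha(x,y)\,d\nu(y)$. $\mathcal{X}$ is the space of bounded measurable complex functions on $E\times E$, with $\|\chi\|=\sup_{E\times E}|\chi|$, and $P_\chi f(x)=\int_E f(y)\chi(x,y)\,P(x,dy)$. *)

(* Defs.v *)
From HB Require Import structures.
From mathcomp Require Import all_boot all_order all_algebra.
From mathcomp Require Import all_classical all_reals all_analysis.
From mathcomp Require Import measurable_realfun.
From mathcomp Require Export complex.

Set Implicit Arguments.
Unset Strict Implicit.
Unset Printing Implicit Defensive.

Import Order.TTheory GRing.Theory Num.Theory.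
Import numFieldNormedType.Exports.
Import Normc.

Local Open Scope classical_set_scope.
Local Open Scope ring_scope.
Local Open Scope complex_scope.

Section spectral_theory.
Context {R : realType} {V : normedModType R[i]}.
Implicit Types (T S : V -> V) (F H : set V) (l : R[i]) (rho : R).

(* The restriction of an operator to an invariant subspace [H] is represented
   by the operator itself together with the set [H]; only the values on [H]
   matter below.  [H := setT] gives the notions for the whole space. *)
Definition bounded_linear_on H S : Prop :=
  [/\ forall u, H u -> H (S u),
      forall a u v, H u -> H v -> S (a *: u + v) = a *: S u + S v
    & exists M : R, forall u, H u -> `|S u| <= M%:C * `|u| ].

Definition resolvent_on T H : set R[i] :=
  [set l | exists S, bounded_linear_on H S /\
     forall u, H u -> S (l *: u - T u) = u /\ l *: S u - T (S u) = u].

Definition spectrum_on T H : set R[i] := ~` resolvent_on T H.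

(* [sup set0 = 0], so the operator on the null space has spectral radius 0. *)
Definition spectral_radius_on T H : R :=
  sup [set normc l | l in spectrum_on T H].

Definition spectral_radius T : R := spectral_radius_on T setT.

Definition is_subspace H : Prop :=
  H 0 /\ forall (a : R[i]) u v, H u -> H v -> H (a *: u + v).

Definition finite_dim_subspace F : Prop :=
  exists (n : nat) (e : 'I_n -> V),
    F = [set u | exists c : 'I_n -> R[i], u = \sum_(i < n) c i *: e i].

Definition direct_sum F H : Prop :=
  F `&` H = [set 0] /\ forall u, exists f h, [/\ F f, H h & u = f + h].

Definition ess_decomposition T rho : Prop :=
  exists F H : set V,
    [/\ is_subspace F, is_subspace H & direct_sum F H] /\
    [/\ forall u, F u -> F (T u), forall u, H u -> H (T u),
        closed H & spectral_radius_on T H < rho] /\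
    [/\ finite_dim_subspace F
      & forall l u, F u -> u != 0 -> T u = l *: u -> rho <= normc l].

Definition ess_spectral_radius T : R :=
  inf ([set spectral_radius T] `|`
       [set rho | 0 <= rho /\ ess_decomposition T rho]).

Definition quasi_compact T : Prop := ess_spectral_radius T < spectral_radius T.

End spectral_theory.

Section complex_functions.
Context {R : realType} {d : measure_display} {E : measurableType d}.

(* Borel measurability for the identification of [R[i]] with the plane. *)
Definition cmeasurable (f : E -> R[i]) : Prop :=
  measurable_fun [set: E] (fun x => complex.Re (f x)) /\
  measurable_fun [set: E] (fun x => complex.Im (f x)).

Definition cintegral (mu : {measure set E -> \bar R}) (f : E -> R[i]) : R[i] :=
  (\int[mu]_y complex.Re (f y)) +i* (\int[mu]_y complex.Im (f y)).

End complex_functions.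

Record weight (R : realType) (d : measure_display) (E : measurableType d) :=
  Weight {
    weight_fun :> E -> R ;
    weight_measurable : measurable_fun [set: E] weight_fun ;
    weight_ge1 : forall x, 1 <= weight_fun x }.

Section Bw.
Context {R : realType} {d : measure_display} {E : measurableType d}.
Variable w : weight R E.

Definition Bw_pred : {pred E -> R[i]} :=
  mem [set f : E -> R[i] | cmeasurable f /\
         exists M : R, forall x, (w x)^-1 * normc (f x) <= M].

Record Bw : Type := MkBw {
  Bw_fun :> E -> R[i] ;
  Bw_funP : Bw_fun \in Bw_pred }.

HB.instance Definition _ := [isSub for Bw_fun].
HB.instance Definition _ := [Choice of Bw by <:].

Lemma weight_gt0 x : 0 < w x.
Proof. exact: lt_le_trans ltr01 (weight_ge1 w x). Qed.

(* The norm of [R[i]] is [R[i]]-valued; [normc] is the real-valued modulus. *)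
Lemma normcE (z : R[i]) : (normc z)%:C = `|z|.
Proof. by case: z. Qed.

Lemma normc_ge0 (z : R[i]) : 0 <= normc z.
Proof. by rewrite -lecR normcE normr_ge0. Qed.

Lemma normcD (y z : R[i]) : normc (y + z) <= normc y + normc z.
Proof. by rewrite -lecR rmorphD/= !normcE ler_normD. Qed.

Lemma Bw_submod_closed : submod_closed Bw_pred.
Proof.
split.
  rewrite inE; split; first by split; exact: measurable_cst.
  by exists 0 => x; rewrite normc0 mulr0.
move=> a u v; rewrite !inE => -[[uR uI] [M uM]] [[vR vI] [N vN]]; split.
  split.
    apply: (eq_measurable_fun (fun x => complex.Re a * complex.Re (u x)
      - complex.Im a * complex.Im (u x) + complex.Re (v x))).
      move=> x _; rewrite /GRing.scale/= /GRing.add/=.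
      by case: a (u x) (v x) => [? ?] [? ?] [? ?].
    apply: measurable_funD => //; apply: measurable_funB;
      by apply: measurable_funM => //; exact: measurable_cst.
  apply: (eq_measurable_fun (fun x => complex.Re a * complex.Im (u x)
      + complex.Im a * complex.Re (u x) + complex.Im (v x))).
    move=> x _; rewrite /GRing.scale/= /GRing.add/=.
    by case: a (u x) (v x) => [? ?] [? ?] [? ?].
  apply: measurable_funD => //; apply: measurable_funD;
    by apply: measurable_funM => //; exact: measurable_cst.
exists (normc a * M + N) => x.
have wx : 0 <= (w x)^-1 by rewrite invr_ge0 ltW// weight_gt0.
apply: (@le_trans _ _ ((w x)^-1 * (normc a * normc (u x) + normc (v x)))).
  apply: ler_wpM2l => //.
  by rewrite -normcM; exact: normcD.
rewrite mulrDr mulrCA lerD//.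
by apply: ler_wpM2l => //; exact: normc_ge0.
Qed.

HB.instance Definition _ :=
  GRing.isSubmodClosed.Build R[i] (E -> R[i]) Bw_pred Bw_submod_closed.
HB.instance Definition _ := [SubChoice_isSubLmodule of Bw by <:].

Definition Bw_norm (f : Bw) : R :=
  sup [set (w x)^-1 * normc (f x) | x in [set: E]].

Let ub (f : Bw) : has_ubound [set (w x)^-1 * normc (f x) | x in [set: E]].
Proof.
have := Bw_funP f; rewrite inE => -[_ [M fM]].
by exists M => _ [x _ <-]; exact: fM.
Qed.

Lemma Bw_norm_ub (f : Bw) x : (w x)^-1 * normc (f x) <= Bw_norm f.
Proof. by apply: ub_le_sup; [exact: ub|exists x]. Qed.

Lemma Bw_norm_ge0 (f : Bw) : 0 <= Bw_norm f.
Proof.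
rewrite /Bw_norm; set A := (X in sup X).
have [->|/set0P[_ [x _ _]]] := eqVneq A set0; first by rewrite sup0.
apply: le_trans (Bw_norm_ub f x).
by rewrite mulr_ge0 ?normc_ge0// invr_ge0 ltW// weight_gt0.
Qed.

Lemma Bw_norm_le (f : Bw) (M : R) : 0 <= M ->
  (forall x, (w x)^-1 * normc (f x) <= M) -> Bw_norm f <= M.
Proof.
move=> M0 fM; rewrite /Bw_norm.
set A := (X in sup X).
have [->|/set0P A0] := eqVneq A set0; first by rewrite sup0.
by apply: ge_sup => // _ [x _ <-]; exact: fM.
Qed.

Let normD (f g : Bw) : (Bw_norm (f + g))%:C <= (Bw_norm f)%:C + (Bw_norm g)%:C.
Proof.
rewrite -rmorphD lecR; apply: Bw_norm_le; first by rewrite addr_ge0 ?Bw_norm_ge0.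
move=> x; apply: (le_trans _ (lerD (Bw_norm_ub f x) (Bw_norm_ub g x))).
rewrite -mulrDr ler_wpM2l ?invr_ge0 ?(ltW (weight_gt0 x))//.
exact: normcD.
Qed.

Let normZ_le (a : R[i]) (f : Bw) : Bw_norm (a *: f) <= normc a * Bw_norm f.
Proof.
apply: Bw_norm_le; first by rewrite mulr_ge0 ?normc_ge0 ?Bw_norm_ge0.
move=> x; have -> : (a *: f) x = a * f x by [].
by rewrite normcM mulrCA ler_wpM2l ?normc_ge0// Bw_norm_ub.
Qed.

Let normZ (a : R[i]) (f : Bw) : (Bw_norm (a *: f))%:C = `|a| * (Bw_norm f)%:C.
Proof.
rewrite -normcE -rmorphM; congr (_%:C); apply/eqP; rewrite eq_le normZ_le/=.
have [->|a0] := eqVneq a 0; first by rewrite normc0 mul0r Bw_norm_ge0.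
have na : 0 < normc a.
  by rewrite lt_neqAle normc_ge0 andbT eq_sym; apply: contra a0 => /eqP/eq0_normc ->.
rewrite -ler_pdivlMl// -normcV; apply: le_trans (normZ_le _ _).
by rewrite scalerA mulVf// scale1r.
Qed.

Let norm0_eq0 (f : Bw) : (Bw_norm f)%:C = 0 -> f = 0.
Proof.
move=> /(congr1 (@complex.Re R)) /= f0; apply: val_inj; apply/funext => x /=.
have := Bw_norm_ub f x; rewrite f0 pmulr_rle0 ?invr_gt0 ?weight_gt0// => fx.
by apply: eq0_normc; apply/eqP; rewrite eq_le fx normc_ge0.
Qed.

HB.instance Definition _ := isPointed.Build Bw 0.
HB.instance Definition _ :=
  Lmodule_isNormed.Build R[i] Bw normD normZ norm0_eq0.

End Bw.

Section kernels.
Context {R : realType} {d : measure_display} {E : measurableType d}.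
Implicit Types (P : R.-pker E ~> E) (C : set E).

Definition kernel_op P (f : E -> R[i]) (x : E) : R[i] := cintegral (P x) f.

Definition bounded_cmeasurable : set (E * E -> R[i]) :=
  [set chi : E * E -> R[i] | cmeasurable chi /\ exists M : R, forall z, normc (chi z) <= M].

Definition supnorm (chi : E * E -> R[i]) : R :=
  sup [set normc (chi z) | z in [set: E * E]].

Definition kernel_op_chi P (chi : E * E -> R[i]) (f : E -> R[i]) (x : E) : R[i] :=
  cintegral (P x) (fun y => f y * chi (x, y)).

(* [T] is the operator induced on [Bw w] by [K], i.e. [K] maps [Bw w] to
   itself and acts there as the bounded operator [T]. *)
Definition bounded_action (w : weight R E) (K : (E -> R[i]) -> E -> R[i])
    (T : {linear Bw w -> Bw w}) : Prop :=
  (forall f x, T f x = K f x) /\ bounded_near T (nbhs (0 : Bw w)).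

Definition conj_weight (w : weight R E) (alpha : E * E -> R) (x y : E) : R :=
  (w x)^-1 * alpha (x, y) * w y.

Definition tail_mass (w : weight R E) (nu : probability E R)
    (alpha : E * E -> R) (m : R) : \bar R :=
  ereal_sup [set (\int[nu]_(y in [set y | (m <= conj_weight w alpha x y)%R])
                    (conj_weight w alpha x y)%:E)%E | x in [set: E]].

Definition Hclass (w : weight R E) (nu : probability E R) : set (E * E -> R) :=
  [set alpha : E * E -> R | [/\ measurable_fun [set: E * E] alpha,
     forall z, 0 <= alpha z &
     tail_mass w nu alpha m @[m --> +oo%R] --> 0%E]].

Definition Tker (nu : probability E R) (alpha : E * E -> R) (x : E) (A : set E)
  : \bar R := (\int[nu]_(y in A) (alpha (x, y))%:E)%E.

Definition represents (K : R.-pker E ~> E) (Q : E -> set E -> \bar R) : Prop :=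
  forall x A, measurable A -> K x A = Q x A.

Definition is_markov (Q : E -> set E -> \bar R) : Prop :=
  exists K : R.-pker E ~> E, represents K Q.

Definition residual P (b : R) C (T : E -> set E -> \bar R)
    (x : E) (A : set E) : \bar R :=
  if `[< b < 1 \/ ~ C x >] then
    (((1 - b * \1_C x)^-1)%:E * (P x A - (b * \1_C x)%:E * T x A))%E
  else (\1_A x)%:E.

End kernels.

Section chains.
Context {R : realType} {d d' : measure_display}.
Context {E : measurableType d} {Omega : measurableType d'}.
Implicit Types (X : nat -> Omega -> E) (C : set E).

Definition history X (n : nat) : set (set Omega) :=
  <<s \bigcup_(k in [set k | (k <= n)%N])
        preimage_set_system [set: Omega] (X k) measurable >>.

(* [Pr x] is the law under which the chain starts at [x].  The last clause is
   the defining property of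
   Pr x (X n.+1 \in A | X 0, ..., X n) = P (X n, A) almost surely. *)
Definition markov_chain (P : R.-pker E ~> E) X (Pr : E -> probability Omega R)
    : Prop :=
  [/\ forall n, measurable_fun [set: Omega] (X n),
      forall x A, measurable A -> Pr x (X 0%N @^-1` A) = \d_x A
    & forall x n A B, measurable A -> history X n B ->
        Pr x (B `&` X n.+1 @^-1` A) = (\int[Pr x]_(o in B) P (X n o) A)%E].

Definition hitting_time X C (o : Omega) : \bar R :=
  ereal_inf [set n%:R%:E | n in [set n : nat | C (X n o)]].

(* [r ^ s] for a time [s] in [0, +oo], with r ^ +oo the limit of r ^ n. *)
Definition expe (r : R) (s : \bar R) : \bar R :=
  match s with
  | s%:E => (r `^ s)%:E
  | +oo%E => if r < 1 then 0%E else if r == 1 then 1%E else +oo%E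
  | -oo%E => 0%E
  end.

Definition hfun (P0 : R.-pker E ~> E) X (Pr : E -> probability Omega R) C (r : R)
  : \bar R :=
  ereal_sup [set (\int[P0 x]_y
     (r%:E * \int[Pr y]_o expe r (hitting_time X C o)))%E | x in C].

End chains.

(* 1 / (1 - b), equal to +oo when b = 1. *)
Definition inv_1subb (R : realType) (b : R) : \bar R :=
  if b == 1 then +oo%E else ((1 - b)^-1)%:E.

Definition rb (R : realType) (h : R -> \bar R) (r1 b : R) : R :=
  sup [set r | 0 <= r <= r1 /\ (h r < inv_1subb b)%E].

(* Main.v *)
(* Since [P = (1 - b 1_C) P0 + b 1_C T], the operator of [chi P] is [S + T'] with [S] coming from
   [(1 - b 1_C) P0] and [T'] from the minorizing kernel.
   - The weight [V = w + A E[r^sigma_C]] satisfies [(1 - b 1_C) P0 V <= V / r] whenever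
     [1 < r <= r1] and [h r < 1 / (1 - b)], so that [|S^n| <= M (|chi| / r)^n].
   - [T'] is a norm limit of kernels bounded in the weighted sense, for which [T' S^j T'] is compact:
     a bounded kernel is approximated through a class of subsets of [E x E] generated by the
     rectangles, the approximation being uniform in the average against [nu] that [T'] performs.
   - Expanding [(S + T')^n] into words in [S] and [T'], a word with two letters [T'] or more is
     compact and those with at most one have total norm [O(n (|chi| / r)^n)].  The image of the unit
     ball by [(S + T')^n] is thus covered by finitely many sets of diameter [d rho^n], for all
     [d > 0] and [rho > |chi| / r].
   - This covering property yields the spectral decomposition at [rho] by Riesz's method, and
     convexity of [r |-> r^n] gives [r_b > 1]. *)

Require Import Defs.
From HB Require Import structures.
From mathcomp Require Import all_boot all_order all_algebra.
From mathcomp Require Import all_classical all_reals all_analysis.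
From mathcomp Require Import measurable_realfun ring lra.

Set Implicit Arguments.
Unset Strict Implicit.
Unset Printing Implicit Defensive.

Import Order.TTheory GRing.Theory Num.Theory.
Import numFieldNormedType.Exports.
Import Normc.

Local Open Scope classical_set_scope.
Local Open Scope ring_scope.
Local Open Scope complex_scope.

(** * Linear maps on complex normed spaces *)

(** A single factor [T'] need not be compact on [Bw]: the norm there is a supremum over all starting
    points, which an approximation in average does not control. In [T' S^j T'] the left factor
    integrates against [nu] and so turns smallness in average into smallness in norm. Hence the
    sorting of words by their number of letters [T']. The covering property concerns one iterate
    [L ^ n], with [n] depending on [d], and not [L] itself. Riesz's arguments for compact operators
    are therefore rerun through two facts: [L ^ n] acts on [u] as [l ^ n] modulo any invariant
    subspace containing [(L - l) u], and [L ^ n - l ^ n] is divisible by [L - l]. Quasi-compactness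
    and the value of the spectral radius are asserted before any chain is given. So [h] is first
    replaced by a generating function built from the kernel killed on [C]; for [r > 1] the
    expectation over a chain agrees with it, because the drift condition makes the chain reach [C]
    almost surely. *)

Section real_norm.
Context {R : realType} {V : normedModType R[i]}.
Implicit Types (u v : V) (a : R[i]).

(** The norm of [V] is [R[i]]-valued; its real part lives in the totally ordered field [R], where
    all estimates are carried out. *)
Definition nrm u : R := complex.Re `|u|.

Lemma nrmE u : (nrm u)%:C = `|u|.
Proof.
have := normr_ge0 u; rewrite /nrm; case: `|u| => x y /=.
by rewrite lecE /= => /andP[/eqP ->].
Qed.

Lemma nrm_ge0 u : 0 <= nrm u.
Proof. by rewrite -lecR nrmE normr_ge0. Qed.

Lemma nrm0 : nrm 0 = 0.
Proof. by rewrite /nrm normr0. Qed.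

Lemma nrmD u v : nrm (u + v) <= nrm u + nrm v.
Proof. by rewrite -lecR rmorphD /= !nrmE ler_normD. Qed.

Lemma nrmZ a u : nrm (a *: u) = normc a * nrm u.
Proof.
have : (nrm (a *: u))%:C = (normc a * nrm u)%:C.
  by rewrite nrmE normrZ rmorphM /= normcE nrmE.
by case.
Qed.

Lemma nrmN u : nrm (- u) = nrm u.
Proof. by rewrite /nrm normrN. Qed.

Lemma nrmB u v : nrm (u - v) = nrm (v - u).
Proof. by rewrite -nrmN opprB. Qed.

Lemma nrm_eq0 u : nrm u = 0 -> u = 0.
Proof. by move=> u0; apply/normr0_eq0; rewrite -nrmE u0. Qed.

Lemma nrm_triangle v u z : nrm (u - z) <= nrm (u - v) + nrm (v - z).
Proof.
have -> : u - z = (u - v) + (v - z) by rewrite addrA subrK.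
exact: nrmD.
Qed.

Lemma ler_nrm_sub u v : nrm u <= nrm (u - v) + nrm v.
Proof. by rewrite -{1}(subrK v u) nrmD. Qed.

Lemma normc_real (r : R) : 0 <= r -> normc r%:C = r.
Proof. by move=> r0; have := normcE r%:C; rewrite ger0_norm ?ler0c// => -[]. Qed.

Lemma normc_gt0 (a : R[i]) : a != 0 -> 0 < normc a.
Proof.
by move=> a0; rewrite lt_neqAle normc_ge0 andbT eq_sym; apply: contra a0 => /eqP/eq0_normc ->.
Qed.

Lemma normc_natX (a : R[i]) n : normc (a ^+ n) = normc a ^+ n.
Proof.
elim: n => [|n IH]; first by rewrite !expr0 normc1.
by rewrite !exprS normcM IH.
Qed.

End real_norm.

Section linear_maps.
Context {R : realType} {V : normedModType R[i]}.
Implicit Types (L f g : V -> V).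

(** Operators are plain functions with a hypothesis [linear], which spares packing each iterate,
    shift or word as a linear map. *)
Lemma linearD_of f : linear f -> forall u v, f (u + v) = f u + f v.
Proof. by move=> lf u v; have := lf 1 u v; rewrite !scale1r. Qed.

Lemma linear0_of f : linear f -> f 0 = 0.
Proof.
move=> lf; have := linearD_of lf 0 0; rewrite addr0 => /(congr1 (fun z => z - f 0)).
by rewrite subrr addrK.
Qed.

Lemma linearZ_of f : linear f -> forall a u, f (a *: u) = a *: f u.
Proof. by move=> lf a u; have := lf a u 0; rewrite (linear0_of lf) !addr0. Qed.

Lemma linearB_of f : linear f -> forall u v, f (u - v) = f u - f v.
Proof.
move=> lf u v; rewrite (linearD_of lf) -scaleN1r (linearZ_of lf).
by rewrite scaleN1r.
Qed.

Lemma linear_iter f n : linear f -> linear (iter n f).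
Proof. by move=> lf; elim: n => [|n IH] a u v //=; rewrite IH lf. Qed.

Definition bounded_map f := exists2 M : R, 0 <= M & forall u, nrm (f u) <= M * nrm u.

Lemma bounded_iter f n : bounded_map f -> bounded_map (iter n f).
Proof.
move=> [M M0 fM]; exists (M ^+ n); first exact: exprn_ge0.
elim: n => [|n IH] u /=; first by rewrite expr0 mul1r.
by rewrite (le_trans (fM _))// exprS -mulrA ler_wpM2l.
Qed.

Definition sub_scal L (l : R[i]) (u : V) : V := L u - l *: u.

Lemma linear_sub_scal L l : linear L -> linear (sub_scal L l).
Proof.
move=> lL a u v; rewrite /sub_scal lL scalerBr !scalerDr !scalerA (mulrC l) opprD.
by rewrite addrACA.
Qed.

Lemma bounded_sub_scal L l : bounded_map L -> bounded_map (sub_scal L l).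
Proof.
move=> [M M0 LM]; exists (M + normc l); first by rewrite addr_ge0 ?normc_ge0.
move=> u; rewrite mulrDl (le_trans (nrmD _ _))// nrmN nrmZ lerD2r.
exact: LM.
Qed.

Lemma sub_scal_comm L l m u : linear L -> sub_scal L l (sub_scal L m u) = sub_scal L m (sub_scal L l u).
Proof.
move=> lL; rewrite /sub_scal !(linearB_of lL) !(linearZ_of lL) !scalerBr !scalerA.
by rewrite (mulrC m) !opprB addrACA [RHS]addrACA; congr (_ + _); rewrite addrC.
Qed.

(** [L ^ n - l ^ n] is a polynomial multiple of [L - l], hence small on approximate eigenvectors.
    Knowledge about one iterate reaches [L - l] through this bound. *)
Lemma iter_sub_scal_bound L l n : linear L -> bounded_map L ->
  exists2 c : R, 0 <= c &
    forall u, nrm (iter n L u - l ^+ n *: u) <= c * nrm (sub_scal L l u).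
Proof.
move=> lL bL; elim: n => [|n [c c0 IH]].
  by exists 0 => // u; rewrite expr0 scale1r subrr nrm0 mul0r.
have [M M0 LM] := bounded_iter n bL.
exists (M + normc l * c); first by rewrite addr_ge0// mulr_ge0 ?normc_ge0.
move=> u; rewrite mulrDl -mulrA.
have -> : iter n.+1 L u - l ^+ n.+1 *: u =
    iter n L (sub_scal L l u) + l *: (iter n L u - l ^+ n *: u).
  rewrite iterSr /sub_scal (linearB_of (linear_iter n lL)).
  by rewrite (linearZ_of (linear_iter n lL)) scalerBr scalerA -exprS subrKA.
apply: le_trans (nrmD _ _) _; rewrite nrmZ lerD//.
by rewrite ler_wpM2l ?normc_ge0.
Qed.

End linear_maps.

(** * Total boundedness expressed by finite labellings *)

Section finite_labels.
Context {R : realType} {V : normedModType R[i]}.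
Implicit Types (f g : V -> V) (e : R).

(* The image of the unit ball by [f] is a finite union of sets of diameter at
   most [e]; the pieces are given by a labelling of the vectors. *)
Definition finitely_covered f e : Prop :=
  exists (I : finType) (phi : V -> I), forall u v,
    nrm u <= 1 -> nrm v <= 1 -> phi u = phi v -> nrm (f u - f v) <= e.

(** Total boundedness of the image of the unit ball, without taking a closure: sums, composites and
    norm limits then reduce to operations on labels. *)
Definition compact_map f : Prop := forall e, 0 < e -> finitely_covered f e.

Lemma finitely_covered_add f g e1 e2 :
  finitely_covered f e1 -> finitely_covered g e2 ->
  finitely_covered (fun u => f u + g u) (e1 + e2).
Proof.
move=> [I [phi fe]] [J [psi ge]]; exists (I * J)%type, (fun u => (phi u, psi u)).
move=> u v u1 v1 [/fe fuv /ge guv].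
rewrite opprD addrACA (le_trans (nrmD _ _))// lerD//; [exact: fuv|exact: guv].
Qed.

Lemma finitely_covered_small f c : (forall u, nrm (f u) <= c * nrm u) -> 0 <= c ->
  finitely_covered f (c + c).
Proof.
move=> fc c0; exists unit, (fun=> tt) => u v u1 v1 _.
apply: le_trans (nrmD _ _) _; rewrite nrmN lerD//.
  by rewrite (le_trans (fc _))// ler_piMr.
by rewrite (le_trans (fc _))// ler_piMr.
Qed.

Lemma finitely_covered_eq f g e : f =1 g -> finitely_covered f e -> finitely_covered g e.
Proof. by move=> /funext ->. Qed.

Lemma compact_map_eq f g : f =1 g -> compact_map f -> compact_map g.
Proof. by move=> /funext ->. Qed.

Lemma compact_map_add f g :
  compact_map f -> compact_map g -> compact_map (fun u => f u + g u).
Proof.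
move=> cf cg e e0; rewrite (splitr e).
by apply: finitely_covered_add; [apply: cf|apply: cg]; rewrite divr_gt0.
Qed.

Lemma compact_map0 : compact_map (fun=> 0).
Proof. by move=> e e0; exists unit, (fun=> tt) => u v _ _ _; rewrite subrr nrm0 ltW. Qed.

Lemma compact_map_compl f g : linear g -> bounded_map g -> compact_map f ->
  compact_map (fun u => g (f u)).
Proof.
move=> lg [M M0 gM] cf e e0.
have [|I [phi fe]] := cf (e / (M + 1)); first by rewrite divr_gt0// ltr_wpDl.
exists I, phi => u v u1 v1 /(fe _ _ u1 v1) fuv.
rewrite -(linearB_of lg) (le_trans (gM _))//.
apply: (@le_trans _ _ (M * (e / (M + 1)))); first exact: ler_wpM2l.
rewrite mulrA ler_pdivrMr ?ltr_wpDl// mulrC ler_wpM2l// ?ltW//.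
by rewrite ltrDl.
Qed.

Lemma compact_map_compr f g : linear f -> linear g -> bounded_map g -> compact_map f ->
  compact_map (fun u => f (g u)).
Proof.
move=> lf lg [M M0 gM] cf e e0.
have M10 : 0 < M + 1 by rewrite ltr_wpDl.
have M1 : (M + 1)%:C != 0 :> R[i] by rewrite fmorph_eq0 gt_eqF.
have [|I [phi fe]] := cf (e / (M + 1)); first by rewrite divr_gt0.
(* The labels of [f] are informative in the unit ball only, so [g u] is scaled into it; [M + 1]
   stays positive when [M = 0]. *)
exists I, (fun u => phi ((M + 1)%:C^-1 *: g u)) => u v u1 v1.
have small t : nrm t <= 1 -> nrm ((M + 1)%:C^-1 *: g t) <= 1.
  move=> t1; rewrite nrmZ normcV normc_real ?(ltW M10)//.
  rewrite ler_pdivrMl// mulr1 (le_trans (gM _))//.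
  by rewrite (@le_trans _ _ M)// ?lerDl// ler_piMr.
move=> /(fe _ _ (small _ u1) (small _ v1)).
rewrite -(linearB_of lf) -scalerBr (linearZ_of lf) nrmZ normcV normc_real ?(ltW M10)//.
by rewrite mulrC ler_pM2r ?invr_gt0// (linearB_of lf).
Qed.

Lemma compact_map_approx f :
  (forall e, 0 < e -> exists g, compact_map g /\
     forall u, nrm (f u - g u) <= e * nrm u) -> compact_map f.
Proof.
move=> fg e e0; have e4 : 0 < e / 4 by rewrite divr_gt0.
have [g [cg ge]] := fg _ e4.
have -> : e = e / 2 + (e / 4 + e / 4) by lra.
apply: (@finitely_covered_eq (fun u => g u + (f u - g u))).
  by move=> u; rewrite addrC subrK.
apply: finitely_covered_add; first by apply: cg; rewrite divr_gt0.
exact: finitely_covered_small (ltW e4).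
Qed.

Lemma finitely_covered_pigeon f e (u : nat -> V) : finitely_covered f e ->
  (forall n, nrm (u n) <= 1) ->
  exists i j, (i < j)%N /\ nrm (f (u i) - f (u j)) <= e.
Proof.
move=> [I [phi fe]] u1.
have [/injectiveP inj|] := boolP (injectiveb (fun k : 'I_#|I|.+1 => phi (u k))).
  by have := leq_card _ inj; rewrite card_ord ltnn.
move=> /injectivePn[i [j ij eqij]].
wlog lt_ij : i j ij eqij / (i < j)%N.
  move=> W; have [lt|lt|eq] := ltngtP i j; first exact: W lt.
    by apply: (W j i) => //; rewrite eq_sym.
  by move: ij; rewrite (ord_inj eq) eqxx.
by exists i, j; split => //; exact: fe.
Qed.

(** The finitely many classes of a labelling cover [V], so an ultrafilter contains one of them. This
    singles out one piece of a covering, as passing to a subsequence would. *)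
Lemma ultra_label (I : finType) (U : set_system V) (phi : V -> I) : UltraFilter U ->
  exists i, U [set u | phi u = i].
Proof.
move=> UU; apply: contrapT => /forallNP nU.
have UC i : U [set u | phi u <> i].
  by have [/(nU i)|] := in_ultra_setVsetC [set u | phi u = i] UU.
have /filter_ex[u] := filter_forall (ultra_proper (UltraFilter := UU)) UC.
by move=> /(_ (phi u)); exact.
Qed.

End finite_labels.

(** * Closed subspaces and Riesz's lemma *)

Section closed_subspaces.
Context {R : realType} {V : normedModType R[i]}.
Implicit Types (G H F : set V).

(** Closedness in the form that estimates produce; [nrm_closedP] gives the topological closedness
    required by [ess_decomposition]. *)
Definition nrm_closed G : Prop :=
  forall p, (forall e : R, 0 < e -> exists2 v, G v & nrm (p - v) < e) -> G p.

Definition closed_subspace G : Prop := is_subspace G /\ nrm_closed G.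

Lemma subspaceD G u v : is_subspace G -> G u -> G v -> G (u + v).
Proof. by move=> [_ GL] Gu Gv; have := GL 1 u v Gu Gv; rewrite scale1r. Qed.

Lemma subspaceZ G a u : is_subspace G -> G u -> G (a *: u).
Proof. by move=> [G0 GL] Gu; have := GL a u 0 Gu G0; rewrite addr0. Qed.

Lemma subspaceB G u v : is_subspace G -> G u -> G v -> G (u - v).
Proof.
by move=> sG Gu Gv; apply: subspaceD => //; rewrite -scaleN1r; exact: subspaceZ.
Qed.

Lemma nrm_closedP G : nrm_closed G -> closed G.
Proof.
move=> cG p clp; apply: cG => e e0.
have [|v [Gv]] := clp (ball p e%:C).
  by apply: nbhsx_ballx; rewrite ltcR.
by rewrite -ball_normE /= -nrmE ltcR => pv; exists v.
Qed.

Lemma closed_subspace0 : closed_subspace [set 0 : V].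
Proof.
split; first by split => // a u v -> ->; rewrite scaler0 addr0.
move=> p pG; apply: nrm_eq0; apply/eqP; rewrite eq_le nrm_ge0 andbT.
apply/ler_addgt0Pl => e e0; rewrite addr0; have [v ->] := pG _ e0.
by rewrite subr0 => /ltW.
Qed.

(** Riesz's lemma. The vector is kept as [t *: (u0 - g)] with the modulus of [t] because operators
    are applied to it later and the outcome is read back on [u0]. *)
Lemma riesz G u0 : closed_subspace G -> ~ G u0 ->
  exists (t : R[i]) (g : V), [/\ G g, t != 0, nrm (t *: (u0 - g)) = 1,
    normc t = (nrm (u0 - g))^-1 &
    forall v, G v -> 1 / 2 <= nrm (t *: (u0 - g) - v)].
Proof.
move=> [sG cG] nGu0.
pose D := [set nrm (u0 - g) | g in G].
have D0 : has_inf D.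
  split; first by exists (nrm (u0 - 0)), 0 => //; case: sG.
  by exists 0 => _ [g _ <-]; exact: nrm_ge0.
have d_gt0 : 0 < inf D.
  rewrite lt_neqAle; apply/andP; split; last first.
    by apply: lb_le_inf; [case: D0|move=> _ [g _ <-]; exact: nrm_ge0].
  apply/eqP => d0; apply: nGu0; apply: cG => e e0.
  have [_ [g Gg <-]] := inf_adherent e0 D0.
  by rewrite -d0 add0r => ?; exists g.
(* With [inf D] itself as margin, [nrm (u0 - g)] is below twice the distance to [G], whence the 1 /
   2. *)
have [_ [g Gg <-] glt] := inf_adherent d_gt0 D0.
have Dle v : G v -> inf D <= nrm (u0 - v).
  by move=> Gv; apply: ge_inf; [case: D0|exists v].
have N0 : 0 < nrm (u0 - g) by apply: lt_le_trans (Dle _ Gg).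
have nt : normc ((nrm (u0 - g))%:C^-1) = (nrm (u0 - g))^-1.
  by rewrite normcV normc_real// ltW.
exists ((nrm (u0 - g))%:C^-1), g; split => //.
- by rewrite invr_eq0 fmorph_eq0 gt_eqF.
- by rewrite nrmZ nt mulVf// gt_eqF.
move=> v Gv.
have -> : (nrm (u0 - g))%:C^-1 *: (u0 - g) - v =
    (nrm (u0 - g))%:C^-1 *: (u0 - (g + (nrm (u0 - g))%:C *: v)).
  rewrite opprD addrA [in RHS]scalerBr scalerA mulVf ?scale1r//.
  by rewrite fmorph_eq0 gt_eqF.
rewrite nrmZ nt ler_pdivlMl//.
apply: (@le_trans _ _ (inf D)); first lra.
by apply: Dle; apply: subspaceD => //; exact: subspaceZ.
Qed.

Lemma closed_subspace_image G (L : V -> V) : linear L -> is_subspace G ->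
  is_subspace (L @` G).
Proof.
move=> lL [G0 GL]; split; first by exists 0 => //; exact: linear0_of.
by move=> a _ _ [u Gu <-] [v Gv <-]; exists (a *: u + v); [exact: GL|rewrite lL].
Qed.

End closed_subspaces.

(** * Chains of invariant subspaces under the covering property *)

Section chains_of_subspaces.
Context {R : realType} {V : normedModType R[i]}.
Variables (L : V -> V) (rho : R).
Hypotheses (lL : linear L) (rho0 : 0 < rho).
Hypothesis cov : forall d : R, 0 < d -> exists n,
  finitely_covered (iter n L) (d * rho ^+ n).

Lemma iter_invariant (G : set V) n u : (forall u, G u -> G (L u)) -> G u -> G (iter n L u).
Proof. by move=> GL Gu; elim: n => //= n IH; exact: GL. Qed.

Lemma iter_sub_scal_mem (G : set V) l n u : is_subspace G ->
  (forall u, G u -> G (L u)) -> G (sub_scal L l u) ->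
  G (iter n L u - l ^+ n *: u).
Proof.
move=> sG GL Gu; elim: n => [|n IH].
  by rewrite expr0 scale1r subrr; case: sG.
have -> : iter n.+1 L u - l ^+ n.+1 *: u =
    iter n L (sub_scal L l u) + l *: (iter n L u - l ^+ n *: u).
  rewrite iterSr /sub_scal (linearB_of (linear_iter n lL)).
  by rewrite (linearZ_of (linear_iter n lL)) scalerBr scalerA -exprS subrKA.
by apply: subspaceD => //; [exact: iter_invariant|exact: subspaceZ].
Qed.

(** Modulo [G], [iter n L] acts on [u] as multiplication by [l ^+ n], so the distance from [u] to
    [G] is scaled by at least [rho ^+ n]. *)
Lemma far_from_subspace (G : set V) l n u z : is_subspace G ->
  (forall u, G u -> G (L u)) -> G (sub_scal L l u) -> rho <= normc l ->
  (forall v, G v -> 1 / 2 <= nrm (u - v)) -> G z ->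
  1 / 2 * rho ^+ n <= nrm (iter n L u - z).
Proof.
move=> sG GL Gu lr far Gz.
have l0 : 0 < normc l by exact: lt_le_trans lr.
have ln0 : l ^+ n != 0.
  by rewrite expf_neq0//; apply: contraTneq l0 => ->; rewrite normc0 ltxx.
have -> : iter n L u - z = l ^+ n *:
    (u - (l ^+ n)^-1 *: (z - (iter n L u - l ^+ n *: u))).
  rewrite scalerBr scalerA divff// scale1r opprB addrA.
  by rewrite [_ + (iter _ _ _ - _)]addrC subrK.
rewrite nrmZ mulrC normc_natX; apply: ler_pM => //.
- exact/exprn_ge0/ltW.
- by rewrite lerXn2r// nnegrE ltW.
- apply: far; apply: subspaceZ => //; apply: subspaceB => //.
  exact: iter_sub_scal_mem.
Qed.

(** Separation is required for all [n] because [cov] decides which iterate is covered. A piece of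
    diameter [rho ^+ n / 4] cannot hold two of the images, against the pigeonhole principle. *)
Lemma no_separated_sequence (u : nat -> V) :
  (forall n, nrm (u n) <= 1) ->
  (forall i j n, (i < j)%N -> 1 / 2 * rho ^+ n <= nrm (iter n L (u i) - iter n L (u j))) ->
  False.
Proof.
move=> u1 usep; have [|n cn] := cov (d := 1 / 4); first by lra.
have [i [j [ij]]] := finitely_covered_pigeon cn u1.
rewrite leNgt => /negP; apply; apply: lt_le_trans (usep i j n ij).
by rewrite ltr_pM2r ?exprn_gt0//; lra.
Qed.

(** Riesz's lemma gives [u n] in [F n.+1] far from [F n]; for [i < j] the images of [u i] stay in
    [F j], from which those of [u j] are far. The scalars [l n] may vary, so that all large
    eigenvalues are bounded in number at once, with their multiplicities. *)
Lemma no_ascending_chain (F : nat -> set V) (l : nat -> R[i]) :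
  (forall n, closed_subspace (F n)) ->
  (forall n u, F n u -> F n (L u)) ->
  (forall n, F n `<=` F n.+1) ->
  (forall n, exists2 u, F n.+1 u & ~ F n u) ->
  (forall n u, F n.+1 u -> F n (sub_scal L (l n) u)) ->
  (forall n, rho <= normc (l n)) -> False.
Proof.
move=> cF FL Fs Fstrict Fl lr.
have mono m n : (m <= n)%N -> F m `<=` F n.
  move=> /subnKC <-; elim: (n - m)%N => [|k IH]; first by rewrite addn0.
  by rewrite addnS; apply: subset_trans (Fs _).
have : forall n, exists u, [/\ nrm u <= 1, F n.+1 u &
    forall v, F n v -> 1 / 2 <= nrm (u - v)].
  move=> n; have [u Fu nFu] := Fstrict n.
  have [t [g [Fg _ tg _ far]]] := riesz (cF n) nFu.
  exists (t *: (u - g)); split => //; first by rewrite tg.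
  have [sF _] := cF n.+1; apply: subspaceZ => //; apply: subspaceB => //.
  exact: Fs.
move=> /choice[u uP]; apply: (@no_separated_sequence u).
  by move=> n; have [] := uP n.
move=> i j n ij; rewrite nrmB.
have [_ Fuj far] := uP j; have [_ Fui _] := uP i.
apply: (@far_from_subspace (F j) (l j)) => //.
- by case: (cF j).
- exact: FL.
- exact: Fl.
- by apply: iter_invariant; [exact: FL|exact: (mono _ _ ij)].
Qed.

(** The mirror argument: [u i] in [F i] is far from [F i.+1], which contains the images of all later
    vectors. *)
Lemma no_descending_chain (F : nat -> set V) (l : R[i]) :
  (forall n, closed_subspace (F n)) ->
  (forall n u, F n u -> F n (L u)) ->
  (forall n, F n.+1 `<=` F n) ->
  (forall n, exists2 u, F n u & ~ F n.+1 u) ->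
  (forall n u, F n u -> F n.+1 (sub_scal L l u)) ->
  rho <= normc l -> False.
Proof.
move=> cF FL Fs Fstrict Fl lr.
have mono m n : (m <= n)%N -> F n `<=` F m.
  move=> /subnKC <-; elim: (n - m)%N => [|k IH]; first by rewrite addn0.
  by rewrite addnS; apply: subset_trans IH; exact: Fs.
have : forall n, exists u, [/\ nrm u <= 1, F n u &
    forall v, F n.+1 v -> 1 / 2 <= nrm (u - v)].
  move=> n; have [u Fu nFu] := Fstrict n.
  have [t [g [Fg _ tg _ far]]] := riesz (cF n.+1) nFu.
  exists (t *: (u - g)); split => //; first by rewrite tg.
  have [sF _] := cF n; apply: subspaceZ => //; apply: subspaceB => //.
  exact: Fs.
move=> /choice[u uP]; apply: (@no_separated_sequence u).
  by move=> n; have [] := uP n.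
move=> i j n ij.
have [_ Fuj _] := uP j; have [_ Fui far] := uP i.
apply: (@far_from_subspace (F i.+1) l) => //.
- by case: (cF i.+1).
- exact: FL.
- exact: Fl.
- by apply: iter_invariant; [exact: FL|exact: (mono _ _ ij)].
Qed.

End chains_of_subspaces.

Section complex_sequences.
Context {R : realType}.

Lemma ler_Re_normc (z : R[i]) : `|complex.Re z| <= normc z.
Proof. by rewrite -lecR normcE; exact: normc_ge_Re. Qed.

Lemma ler_Im_normc (z : R[i]) : `|complex.Im z| <= normc z.
Proof.
by case: z => x y /=; rewrite -[leLHS]sqrtr_sqr ler_wsqrtr// lerDr sqr_ge0.
Qed.

Lemma normc_le_ReIm (z : R[i]) : normc z <= `|complex.Re z| + `|complex.Im z|.
Proof.
case: z => x y /=; rewrite -[leRHS]ger0_norm ?addr_ge0//.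
rewrite -[leRHS]sqrtr_sqr ler_wsqrtr// sqrrD !real_normK ?num_real//.
rewrite [leRHS]addrAC lerDl; by rewrite mulrn_wge0// mulr_ge0.
Qed.

Lemma real_cauchy_lim (x : nat -> R) :
  (forall e : R, 0 < e -> exists N, forall i j, (N <= i)%N -> (N <= j)%N -> `|x i - x j| < e) ->
  x @ \oo --> lim (x @ \oo).
Proof.
move=> xC; apply/cauchy_cvgP/cauchy_ballP => e e0.
have [N NP] := xC _ e0.
exists (x @` [set i | (N <= i)%N], x @` [set i | (N <= i)%N]) => /=.
  by split; exists N => // i /= Ni; exists i.
by move=> [_ _] /= [[i iN <-] [j jN <-]]; rewrite -ball_normE /=; exact: NP.
Qed.

(** The limit is explicit in its two coordinates because [Bw_complete] has to prove that a pointwise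
    limit is measurable. *)
Lemma complex_cauchy_lim (z : nat -> R[i]) :
  (forall e : R, 0 < e -> exists N, forall i j, (N <= i)%N -> (N <= j)%N ->
     normc (z i - z j) < e) ->
  forall e : R, 0 < e -> exists N, forall i, (N <= i)%N ->
    normc (z i - (lim ((fun k => complex.Re (z k)) @ \oo)
                  +i* lim ((fun k => complex.Im (z k)) @ \oo))) < e.
Proof.
move=> zC e e0.
have subRe (a b : R[i]) : complex.Re a - complex.Re b = complex.Re (a - b).
  by case: a b => [? ?] [? ?].
have subIm (a b : R[i]) : complex.Im a - complex.Im b = complex.Im (a - b).
  by case: a b => [? ?] [? ?].
have /real_cauchy_lim/cvgrPdist_lt : forall e : R, 0 < e -> exists N, forall i j, (N <= i)%N -> (N <= j)%N ->
    `|complex.Re (z i) - complex.Re (z j)| < e.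
  move=> e' /zC[N NP]; exists N => i j iN jN; rewrite subRe.
  exact: le_lt_trans (ler_Re_normc _) (NP _ _ iN jN).
move=> /(_ (e / 2)); rewrite divr_gt0// => /(_ isT)[N1 _ N1P].
have /real_cauchy_lim/cvgrPdist_lt : forall e : R, 0 < e -> exists N, forall i j, (N <= i)%N -> (N <= j)%N ->
    `|complex.Im (z i) - complex.Im (z j)| < e.
  move=> e' /zC[N NP]; exists N => i j iN jN; rewrite subIm.
  exact: le_lt_trans (ler_Im_normc _) (NP _ _ iN jN).
move=> /(_ (e / 2)); rewrite divr_gt0// => /(_ isT)[N2 _ N2P].
exists (maxn N1 N2) => i; rewrite geq_max => /andP[iN1 iN2].
rewrite (splitr e) (le_lt_trans (normc_le_ReIm _))// -subRe -subIm ltrD//= distrC.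
- exact: N1P.
- exact: N2P.
Qed.

End complex_sequences.

(** * Maps that are proper on bounded sets *)

Section proper_maps.
Context {R : realType} {V : normedModType R[i]}.
Implicit Types (D : V -> V) (U : set_system V).

Definition nrm_complete : Prop := forall u : nat -> V,
  (forall e : R, 0 < e -> exists N, forall i j, (N <= i)%N -> (N <= j)%N -> nrm (u i - u j) < e) ->
  exists p, forall e : R, 0 < e -> exists N, forall i, (N <= i)%N -> nrm (u i - p) < e.

Definition tends_to U (x : V -> V) p := forall e : R, 0 < e -> U [set i | nrm (x i - p) < e].

(** Properness on bounded sets: a bounded family whose image converges must converge. Ultrafilters
    replace subsequences, and leaving the family [x] arbitrary makes the notion stable under
    composition. *)
Definition proper_map D : Prop := forall U (x : V -> V) (M : R) z, UltraFilter U ->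
  U [set i | nrm (x i) <= M] -> tends_to U (D \o x) z -> exists p, tends_to U x p.

Lemma ultra_cauchy_tends_to U (x : V -> V) : nrm_complete -> UltraFilter U ->
  (forall e : R, 0 < e -> exists A, U A /\ forall i j, A i -> A j -> nrm (x i - x j) < e) ->
  exists p, tends_to U x p.
Proof.
move=> VC UU UC.
have UP : ProperFilter U by exact: ultra_proper.
pose e_ k : R := k.+1%:R^-1.
have /choice[A AP] : forall k, exists A, U A /\ forall i j, A i -> A j -> nrm (x i - x j) < e_ k.
  by move=> k; apply: UC; rewrite invr_gt0.
(* Intersections make the choice nested: all later points of [c] lie in [A k], so [c] is Cauchy. *)
pose B k := \bigcap_(i < k.+1) A i.
have UB k : U (B k).
  elim: k => [|k IH]; rewrite /B.
    by rewrite bigcap_mkord big_ord_recl big_ord0 setIT; case: (AP 0).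
  rewrite bigcap_mkord big_ord_recr /= -bigcap_mkord; apply: filterI => //.
  by case: (AP k.+1).
have /choice[c cB] : forall k, exists c, B k c by move=> k; exact: (filter_ex (UB k)).
have cA k n : (k <= n)%N -> A k (c n) by move=> kn; apply: cB.
have small (e : R) : 0 < e -> exists N, e_ N < e.
  move=> e0; exists (Num.truncn e^-1).
  by rewrite /e_ invf_plt ?posrE// truncnS_gt.
have [|p pP] := VC (x \o c).
  move=> e e0; have [N Ne] := small _ e0.
  exists N => i j iN jN; apply: lt_trans Ne.
  by have [_] := AP N; apply; exact: cA.
exists p => e e0; have [N Ne] := small (e / 2) (divr_gt0 e0 (ltr0Sn _ _)).
have [N' N'P] := pP (e / 2) (divr_gt0 e0 (ltr0Sn _ _)).
have [UA Asmall] := AP N; apply: filterS UA => i Ai /=.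
rewrite (le_lt_trans (nrm_triangle (x (c (maxn N N'))) _ _))// (splitr e) ltrD//.
  by apply: lt_trans Ne; apply: Asmall => //; apply: cA; exact: leq_maxl.
by apply: N'P; exact: leq_maxr.
Qed.

Lemma proper_map_comp D1 D2 : linear D2 -> bounded_map D2 ->
  proper_map D1 -> proper_map D2 -> proper_map (D1 \o D2).
Proof.
move=> lD [M M0 DM] p1 p2 U x m z UU Um Uz.
have [|p pP] := p1 U (D2 \o x) (M * m) z UU _ Uz.
  have UP : ProperFilter U by exact: ultra_proper.
  by apply: filterS Um => i /= im; rewrite (le_trans (DM _))// ler_wpM2l.
exact: (p2 U x m p UU Um pP).
Qed.

Lemma tends_to_mem (G : set V) U x p : ProperFilter U -> nrm_closed G ->
  U [set i | G (x i)] -> tends_to U x p -> G p.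
Proof.
move=> UP cG UG Ux; apply: cG => e e0.
have [i [/= Gi ie]] := filter_ex (filterI UG (Ux e e0)).
by exists (x i) => //; rewrite nrmB.
Qed.

Lemma tends_to_unique U (x : V -> V) p q : ProperFilter U ->
  tends_to U x p -> tends_to U x q -> p = q.
Proof.
move=> UP Up Uq; apply/eqP; rewrite -subr_eq0; apply/eqP/nrm_eq0.
apply/eqP; rewrite eq_le nrm_ge0 andbT; apply/ler_addgt0Pl => e e0.
rewrite addr0; have e2 : 0 < e / 2 by rewrite divr_gt0.
have [i [/= ip iq]] := filter_ex (filterI (Up _ e2) (Uq _ e2)).
rewrite (le_trans (nrm_triangle (x i) _ _))// (splitr e) lerD ?ltW//.
by rewrite nrmB.
Qed.

Lemma tends_to_map D U x p : ProperFilter U -> linear D -> bounded_map D ->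
  tends_to U x p -> tends_to U (D \o x) (D p).
Proof.
move=> UP lD [M M0 DM] Ux e e0.
have e' : 0 < e / (M + 1) by rewrite divr_gt0// ltr_wpDl.
apply: filterS (Ux _ e') => i /= ie; rewrite -(linearB_of lD).
rewrite (le_lt_trans (DM _))//.
apply: (@le_lt_trans _ _ ((M + 1) * nrm (x i - p))).
  by rewrite ler_wpM2r ?nrm_ge0// lerDl.
by rewrite mulrC -ltr_pdivlMr// ltr_wpDl.
Qed.

(** Takes the place of choosing a sequence with errors tending to 0 and extracting a subsequence. *)
Lemma ultra_of_nested (S : R -> set V) :
  (forall e, 0 < e -> S e !=set0) -> (forall e1 e2, e1 <= e2 -> S e1 `<=` S e2) ->
  exists U, UltraFilter U /\ forall e, 0 < e -> U (S e).
Proof.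
move=> S0 Smono.
have FF : ProperFilter (filter_from [set e : R | 0 < e] S).
  apply: filter_from_proper => //.
  apply: filter_from_filter; first by exists 1 => /=.
  move=> a b /= a0 b0; exists (Num.min a b); first by rewrite /= lt_min a0.
  by move=> v Sv; split; apply: Smono Sv; rewrite ge_min lexx ?orbT.
have [U [UU FU]] := ultraFilterLemma FF.
by exists U; split => // e e0; apply: FU; exists e.
Qed.

(** If no constant works, Riesz's lemma relative to the kernel [K] gives vectors of norm at most 1,
    with small images, at distance at least 1 / 2 from [K]. Properness gives them a limit, which
    lies in [K]. *)
Lemma proper_map_bounded_below D (H : set V) : linear D -> bounded_map D ->
  proper_map D -> closed_subspace H ->
  exists2 c : R, 0 <= c & forall u, H u ->
    exists2 k, H k /\ D k = 0 & nrm (u - k) <= c * nrm (D u).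
Proof.
move=> lD bD pD [sH cH].
pose K := [set k | H k /\ D k = 0].
have clK : closed_subspace K.
  split.
    split; first by split; [case: sH|exact: linear0_of].
    move=> a u v [Hu Du] [Hv Dv]; split; first by case: sH => _; apply.
    by rewrite lD Du Dv scaler0 addr0.
  move=> p pK; split.
    by apply: cH => e /pK[v [Hv _] ve]; exists v.
  apply: nrm_eq0; apply/eqP; rewrite eq_le nrm_ge0 andbT; apply/ler_addgt0Pl => e e0.
  have [M M0 DM] := bD.
  have [v [Hv Dv] ve] := pK (e / (M + 1)) (divr_gt0 e0 (ltr_wpDl M0 ltr01)).
  rewrite addr0 -(subr0 (D p)) -Dv -(linearB_of lD) (le_trans (DM _))//.
  apply: (@le_trans _ _ (M * (e / (M + 1)))); first by rewrite ler_wpM2l// ltW.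
  rewrite mulrA ler_pdivrMr ?ltr_wpDl// mulrC ler_wpM2l ?ltW//.
  by rewrite ltrDl.
apply: contrapT => nb.
pose S (e : R) := [set u | [/\ H u, nrm u <= 1, nrm (D u - 0) < e &
  forall k, K k -> 1 / 2 <= nrm (u - k)]].
have [|e1 e2 e12 u|U [UU US]] := @ultra_of_nested S.
(* If [S e] were empty, [e^-1] would be a valid constant: the Riesz vector of [u] has an image
   smaller than [e] unless [g] itself satisfies the bound. *)
- move=> e e0; apply: contrapT => Se; apply: nb; exists (e^-1); first by rewrite invr_ge0 ltW.
  move=> u Hu; apply: contrapT => nk.
  have nKu : ~ K u.
    move=> [_ Du]; apply: nk; exists u => //.
    by rewrite subrr nrm0 mulr_ge0 ?nrm_ge0// invr_ge0 ltW.
  have [t [g [Kg t0 tg tE far]]] := riesz clK nKu.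
  apply: Se; exists (t *: (u - g)); split => //.
  + by apply: subspaceZ => //; apply: subspaceB => //; case: Kg.
  + by rewrite tg.
  rewrite subr0 (linearZ_of lD) (linearB_of lD) nrmZ tE; have [_ ->] := Kg.
  have g0 : 0 < nrm (u - g).
    rewrite lt_neqAle nrm_ge0 andbT eq_sym; apply/eqP => /nrm_eq0/eqP.
    by rewrite subr_eq0 => /eqP ug; apply: nKu; rewrite ug.
  rewrite subr0 ltr_pdivrMl// ltNge; apply/negP => le; apply: nk.
  by exists g => //; rewrite mulrC ler_pdivlMr.
- move=> [Hu u1 Du far]; split => //; exact: lt_le_trans e12.
have UP : ProperFilter U by exact: ultra_proper.
have [||p pP] := pD U id 1 0 UU.
- by apply: filterS (US 1 ltr01) => u [].
- by move=> e e0; apply: filterS (US e e0) => u [].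
have Kp : K p.
  split.
    apply: (tends_to_mem UP cH _ pP).
    by apply: filterS (US 1 ltr01) => u [].
  apply: (tends_to_unique UP (tends_to_map UP lD bD pP)).
  by move=> e e0; apply: filterS (US e e0) => u [].
have h0 : 0 < 1 / 2 :> R by lra.
have [u [/= up [_ _ _ far]]] := filter_ex (filterI (pP _ h0) (US 1 ltr01)).
by have := far p Kp; rewrite leNgt up.
Qed.

(** Approximate preimages of [z] are corrected by elements of the kernel so as to stay bounded;
    their limit along an ultrafilter is a preimage. *)
Lemma proper_map_closed_range D (H : set V) : linear D -> bounded_map D ->
  proper_map D -> closed_subspace H -> closed_subspace (D @` H).
Proof.
move=> lD bD pD clH; have [sH cH] := clH; split; first exact: closed_subspace_image.
have [c c0 cP] := proper_map_bounded_below lD bD pD clH.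
move=> z zD.
(* The cap 1 keeps [nrm (D u)] below [nrm z + 1], hence the bound on [u] independent of [e]. *)
pose S (e : R) := [set u | [/\ H u, nrm u <= c * (nrm z + 1) & nrm (D u - z) < Num.min e 1]].
have [|e1 e2 e12 u|U [UU US]] := @ultra_of_nested S.
- move=> e e0; have e1 : 0 < Num.min e 1 by rewrite lt_min e0 ltr01.
  have [_ [u Hu <-] uz] := zD _ e1.
  have [k [Hk Dk] ku] := cP u Hu.
  exists (u - k); split; first exact: subspaceB.
    rewrite (le_trans ku)// ler_wpM2l// (le_trans (ler_nrm_sub _ z))// addrC lerD2l.
    by rewrite nrmB ltW// (lt_le_trans uz)// ge_min lexx orbT.
  by rewrite (linearB_of lD) Dk subr0 nrmB.
- by move=> [Hu u1 Du]; split => //; rewrite (lt_le_trans Du)// le_min !ge_min e12 lexx orbT.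
have UP : ProperFilter U by exact: ultra_proper.
have Dz : tends_to U (D \o id) z.
  move=> e e0; apply: filterS (US e e0) => u [_ _ ue] /=.
  by rewrite (lt_le_trans ue)// ge_min lexx.
have [|p pP] := pD U id (c * (nrm z + 1)) z UU _ Dz.
  by apply: filterS (US 1 ltr01) => u [].
exists p.
  apply: (tends_to_mem UP cH _ pP).
  by apply: filterS (US 1 ltr01) => u [].
exact: (tends_to_unique UP (tends_to_map UP lD bD pP)).
Qed.

End proper_maps.

(** * Spectral decomposition *)

Section riesz_decomposition.
Context {R : realType} {V : normedModType R[i]}.
Variables (L : V -> V) (rho : R).
Hypotheses (lL : linear L) (bL : bounded_map L) (rho0 : 0 < rho).
Hypothesis cov : forall d : R, 0 < d -> exists n,
  finitely_covered (iter n L) (d * rho ^+ n).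
Hypothesis VC : @nrm_complete R V.

(** The ultrafilter picks one piece of the covering of [iter n L]. Two vectors labelled there have
    close images under [iter n L] and under [L - l], hence close multiples by [l ^+ n]; dividing by
    [rho ^+ n] makes the family Cauchy. *)
Lemma proper_sub_scal l : rho <= normc l -> proper_map (sub_scal L l).
Proof.
move=> lr U x M z UU Um Uz.
have UP : ProperFilter U by exact: ultra_proper.
have l0 : 0 < normc l by exact: lt_le_trans lr.
pose m := Num.max M 1.
have m0 : 0 < m by rewrite lt_max ltr01 orbT.
have mC : m%:C != 0 :> R[i] by rewrite fmorph_eq0 gt_eqF.
apply: ultra_cauchy_tends_to => // e e0.
have [|n [I [phi cn]]] := cov (d := e / 4 / m); first by rewrite !divr_gt0.
have [c c0 cP] := iter_sub_scal_bound l n lL bL.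
have [i Ui] := ultra_label (fun u => phi (m%:C^-1 *: x u)) UU.
have rn : 0 < rho ^+ n by rewrite exprn_gt0.
(* Chosen so that [(c + 1) * (d + d)] is [e / 4 * rho ^+ n], the error already granted to
   [iter n L]. *)
pose d := e / 8 * rho ^+ n / (c + 1).
have d0 : 0 < d by rewrite !divr_gt0// ?mulr_gt0 ?divr_gt0// ltr_wpDl.
exists [set u | [/\ phi (m%:C^-1 *: x u) = i, nrm (x u) <= m &
   nrm (sub_scal L l (x u) - z) < d]]; split.
  apply: filterS (filterI Ui (filterI Um (Uz d d0))) => u [/= ui [um uz]].
  by split => //; rewrite le_max um.
move=> u v [ui um uz] [vi vm vz].
have small (w : V) : nrm w <= m -> nrm (m%:C^-1 *: w) <= 1.
  by move=> wm; rewrite nrmZ normcV normc_real ?(ltW m0)// ler_pdivrMl// mulr1.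
have := cn _ _ (small _ um) (small _ vm); rewrite ui vi => /(_ erefl).
rewrite -(linearB_of (linear_iter n lL)) -scalerBr (linearZ_of (linear_iter n lL)).
rewrite nrmZ normcV normc_real ?(ltW m0)// ler_pdivrMl// => Lxy.
have {}Lxy : nrm (iter n L (x u - x v)) <= e / 4 * rho ^+ n.
  rewrite (le_trans Lxy)//.
  by rewrite mulrA [m * _]mulrC mulfVK// gt_eqF.
have shxy : nrm (sub_scal L l (x u - x v)) <= d + d.
  rewrite (linearB_of (linear_sub_scal l lL)).
  rewrite (le_trans (nrm_triangle z _ _))// lerD ?ltW//.
  by rewrite nrmB.
have key : nrm (l ^+ n *: (x u - x v)) <= e / 2 * rho ^+ n.
  have -> : l ^+ n *: (x u - x v) = iter n L (x u - x v) -
     (iter n L (x u - x v) - l ^+ n *: (x u - x v)) by rewrite subKr.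
  rewrite (le_trans (nrmD _ _))// nrmN.
  apply: (le_trans (lerD Lxy (cP _))).
  apply: (@le_trans _ _ (e / 4 * rho ^+ n + (c + 1) * (d + d))).
    by rewrite lerD2l ler_pM// ?nrm_ge0// lerDl.
  rewrite /d; have c1 : c + 1 != 0 by rewrite gt_eqF// ltr_wpDl.
  have -> : (c + 1) * (e / 8 * rho ^+ n / (c + 1) + e / 8 * rho ^+ n / (c + 1))
    = e / 4 * rho ^+ n by field.
  by rewrite -mulrDl ler_pM2r//; lra.
have : rho ^+ n * nrm (x u - x v) <= e / 2 * rho ^+ n.
  apply: le_trans key; rewrite nrmZ normc_natX ler_wpM2r ?nrm_ge0//.
  by rewrite lerXn2r// nnegrE ltW.
by rewrite mulrC ler_pM2r// => /le_lt_trans; apply; lra.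
Qed.

Lemma proper_iter_sub_scal l n : rho <= normc l -> proper_map (iter n (sub_scal L l)).
Proof.
move=> lr; elim: n => [|n IH]; first by move=> U x M z UU _ Uz; exists z.
have := proper_map_comp (linear_iter n (linear_sub_scal l lL))
  (bounded_iter n (bounded_sub_scal l bL)) (proper_sub_scal lr) IH.
by [].
Qed.

Lemma sub_scal_invariant (H : set V) l u : is_subspace H ->
  (forall u, H u -> H (L u)) -> H u -> H (sub_scal L l u).
Proof.
move=> sH HL Hu; apply: subspaceB => //; first exact: HL.
exact: subspaceZ.
Qed.

Lemma iter_sub_scal_invariant (H : set V) l n u : is_subspace H ->
  (forall u, H u -> H (L u)) -> H u -> H (iter n (sub_scal L l) u).
Proof. by move=> sH HL Hu; elim: n => //= n IH; exact: sub_scal_invariant. Qed.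

Lemma iter_sub_scalC l n u : L (iter n (sub_scal L l) u) = iter n (sub_scal L l) (L u).
Proof.
elim: n => //= n <-; rewrite /sub_scal (linearB_of lL) (linearZ_of lL).
by [].
Qed.

Lemma iter_sub_scal_comm l l' n u : sub_scal L l' (iter n (sub_scal L l) u) =
  iter n (sub_scal L l) (sub_scal L l' u).
Proof. by elim: n => //= n <-; rewrite (sub_scal_comm _ _ _ lL). Qed.

Lemma closed_iter_range (H : set V) l n : rho <= normc l -> closed_subspace H ->
  closed_subspace (iter n (sub_scal L l) @` H).
Proof.
move=> lr cH; apply: proper_map_closed_range => //.
- exact/linear_iter/linear_sub_scal.
- exact/bounded_iter/bounded_sub_scal.
- exact: proper_iter_sub_scal.
Qed.

Lemma range_stabilizes (H : set V) l : closed_subspace H ->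
  (forall u, H u -> H (L u)) -> rho <= normc l ->
  exists m, forall u, H u -> exists2 v, H v &
    iter m (sub_scal L l) u = iter m.+1 (sub_scal L l) v.
Proof.
move=> cH HL lr; apply: contrapT => /forallNP nstab; have [sH _] := cH.
apply: (@no_descending_chain _ _ L rho lL rho0 cov
  (fun n => iter n (sub_scal L l) @` H) l) => //.
- by move=> n; exact: closed_iter_range.
- by move=> n _ [u Hu <-]; exists (L u); [exact: HL|rewrite iter_sub_scalC].
- move=> n _ [u Hu <-]; exists (sub_scal L l u); first exact: sub_scal_invariant.
  by rewrite -iterSr.
- move=> n; have /existsNP[u /not_implyP[Hu nu]] := nstab n.
  exists (iter n (sub_scal L l) u); first by exists u.
  by move=> [v Hv vu]; apply: nu; exists v.
- by move=> n _ [u Hu <-]; exists u.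
Qed.

(** The Fredholm alternative: the ranges of the powers stabilise at some [m], and the [m]-th power
    is injective, so it cancels. *)
Lemma sub_scal_surjective_on (H : set V) l : closed_subspace H ->
  (forall u, H u -> H (L u)) -> rho <= normc l ->
  (forall u, H u -> sub_scal L l u = 0 -> u = 0) ->
  forall u, H u -> exists2 v, H v & sub_scal L l v = u.
Proof.
move=> cH HL lr inj; have [sH _] := cH.
have injn n u : H u -> iter n (sub_scal L l) u = 0 -> u = 0.
  elim: n u => //= n IH u Hu eq0; apply: IH => //; apply: inj => //.
  exact: iter_sub_scal_invariant.
have [m mP] := range_stabilizes cH HL lr.
move=> u Hu; have [v Hv uv] := mP u Hu; exists v => //.
apply/esym/eqP; rewrite -subr_eq0; apply/eqP/(injn m).
  by apply: subspaceB => //; exact: sub_scal_invariant.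
rewrite (linearB_of (linear_iter m (linear_sub_scal l lL))) uv iterSr.
by rewrite subrr.
Qed.

(** Injectivity gives surjectivity on [H], and [proper_map_bounded_below] with a null kernel bounds
    the inverse. Hence the spectrum outside the disc of radius [rho] consists of eigenvalues. *)
Lemma resolvent_on_injective (H : set V) l : closed_subspace H ->
  (forall u, H u -> H (L u)) -> rho <= normc l ->
  (forall u, H u -> L u = l *: u -> u = 0) -> resolvent_on L H l.
Proof.
move=> cH HL lr inj; have [sH _] := cH.
have {}inj u : H u -> sub_scal L l u = 0 -> u = 0.
  by move=> Hu /eqP; rewrite subr_eq0 => /eqP; exact: inj.
have surj := sub_scal_surjective_on cH HL lr inj.
have [c c0 cP] := proper_map_bounded_below (linear_sub_scal l lL)
  (bounded_sub_scal l bL) (proper_sub_scal lr) cH.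
(* The sign appears because the resolvent inverts [l - L]. *)
have /choice[S SP] : forall u, exists v, H u -> H v /\ sub_scal L l v = - u.
  move=> u; have [Hu|nHu] := pselect (H u); last by exists 0.
  have Hnu : H (- u) by rewrite -scaleN1r; exact: subspaceZ.
  by have [v Hv vu] := surj _ Hnu; exists v.
have uniq u v : H u -> H v -> sub_scal L l u = sub_scal L l v -> u = v.
  move=> Hu Hv uv; apply/eqP; rewrite -subr_eq0; apply/eqP/inj.
    exact: subspaceB.
  by rewrite (linearB_of (linear_sub_scal l lL)) uv subrr.
exists S; split; first split.
- by move=> u /SP[].
- move=> a u v Hu Hv; have Huv : H (a *: u + v) by case: sH => _; exact.
  have [HS SE] := SP _ Huv; have [HSu SuE] := SP _ Hu; have [HSv SvE] := SP _ Hv.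
  apply: uniq => //; first by case: sH => _; exact.
  by rewrite (linear_sub_scal l lL) SE SuE SvE scalerN opprD.
- exists c => u Hu; have [HS SE] := SP _ Hu.
  have [k [Hk Dk]] := cP _ HS; have -> := inj k Hk Dk.
  by rewrite subr0 SE nrmN -!nrmE -rmorphM lecR.
move=> u Hu; split.
  have Hlu : H (l *: u - L u).
    by apply: subspaceB => //; [exact: subspaceZ|exact: HL].
  have [HS SE] := SP _ Hlu; apply: uniq => //.
  by rewrite SE /sub_scal opprB.
have [HS SE] := SP _ Hu.
by rewrite -opprB -[LHS]/(- sub_scal L l (S u)) SE opprK.
Qed.

Definition shifts (s : seq R[i]) (u : V) : V := foldl (fun v l => sub_scal L l v) u s.

Lemma shifts_cat s1 s2 u : shifts (s1 ++ s2) u = shifts s2 (shifts s1 u).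
Proof. by rewrite /shifts foldl_cat. Qed.

Lemma shifts_nseq n l u : shifts (nseq n l) u = iter n (sub_scal L l) u.
Proof. by elim: n u => //= n IH u; rewrite IH -iterSr. Qed.

Lemma linear_shifts s : linear (shifts s).
Proof. by elim: s => [//|l s IH] a u v /=; rewrite (linear_sub_scal l lL) IH. Qed.

(** Each new factor is stabilised inside the range already reached; the other factors remain
    surjective there because all the [L - l] commute. *)
Lemma stable_range (s : seq R[i]) : (forall l, l \in s -> rho <= normc l) ->
  exists s', [/\ {subset s' <= s}, closed_subspace (range (shifts s')),
    forall u, range (shifts s') u -> range (shifts s') (L u) &
    forall l, l \in s -> forall u, range (shifts s') u ->
      exists2 v, range (shifts s') v & sub_scal L l v = u].
Proof.
elim: s => [_|l s IH sr].
  exists [::]; split => //.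
    by rewrite (_ : range _ = setT)//; apply/seteqP; split => // u _; exists u.
have [t tr|s' [ss' cH HL surj]] := IH; first by rewrite sr// inE tr orbT.
have lr : rho <= normc l by rewrite sr// mem_head.
have [m mP] := range_stabilizes cH HL lr.
have sE : range (shifts (s' ++ nseq m l)) = iter m (sub_scal L l) @` range (shifts s').
  apply/seteqP; split=> [_ [u _ <-]|_ [_ [u _ <-] <-]].
    by exists (shifts s' u); [exists u|rewrite shifts_cat shifts_nseq].
  by exists u => //; rewrite shifts_cat shifts_nseq.
exists (s' ++ nseq m l); split.
- move=> t; rewrite mem_cat inE => /orP[/ss' ->|]; first by rewrite orbT.
  by rewrite mem_nseq => /andP[_ ->].
- by rewrite sE; exact: closed_iter_range.
- rewrite sE => _ [u Hu <-]; exists (L u); first exact: HL.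
  by rewrite iter_sub_scalC.
rewrite sE => t; rewrite inE => /orP[/eqP ->|ts] _ [u Hu <-].
  have [v Hv ->] := mP u Hu; exists (iter m (sub_scal L l) v) => //.
have [v Hv <-] := surj t ts u Hu.
by exists (iter m (sub_scal L l) v); [exists v|rewrite iter_sub_scal_comm].
Qed.

(** [L] is triangular on [F] with diagonal [s]. Adding one vector at a time treats all large
    eigenvalues and their multiplicities together, without generalised eigenspaces. *)
Inductive eigenflag : set V -> seq R[i] -> Prop :=
| eigenflag0 : eigenflag [set 0] [::]
| eigenflagS F s l v : eigenflag F s -> rho < normc l -> ~ F v -> F (sub_scal L l v) ->
    eigenflag [set u | exists c f, F f /\ u = f + c *: v] (l :: s).

(** The coefficient of [v] is controlled by the distance from [v] to [F], read off the Riesz vector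
    [t *: (v - g)]. *)
Lemma add_line_bound (F : set V) v : closed_subspace F -> ~ F v ->
  exists2 d : R, 0 < d & forall c f, F f -> d * normc c <= nrm (f + c *: v).
Proof.
move=> cF nFv; have [sF _] := cF.
have [t [g [Fg t0 _ _ far]]] := riesz cF nFv.
have nt := normc_gt0 t0.
exists (1 / 2 / normc t); first by rewrite !divr_gt0.
move=> c f Ff; have [->|c0] := eqVneq c 0.
  by rewrite normc0 mulr0 nrm_ge0.
have nc := normc_gt0 c0.
have -> : f + c *: v = (c / t) *: (t *: (v - g) - (- (t / c) *: f - t *: g)).
  rewrite scaleNr opprB opprK scalerBr addrA subrK addrC scalerDr !scalerA.
  by rewrite mulfVK// mulrA mulfVK// divff// scale1r.
have -> : 1 / 2 / normc t * normc c = 1 / 2 * (normc c / normc t) by ring.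
rewrite nrmZ normcM normcV [leRHS]mulrC.
rewrite ler_wpM2r//; first by rewrite mulr_ge0 ?normc_ge0// invr_ge0 normc_ge0.
apply: far; apply: subspaceB; [by []| |exact: subspaceZ].
exact: subspaceZ.
Qed.

(** By [add_line_bound] the coefficients of the approximating vectors form a Cauchy sequence; with
    [c] their limit, [p - c *: v] is approximated from [F]. *)
Lemma closed_add_line (F : set V) v : closed_subspace F -> ~ F v ->
  closed_subspace [set u | exists c f, F f /\ u = f + c *: v].
Proof.
move=> cF nFv; have [sF FC] := cF; split.
  split; first by exists 0, 0; split; [case: sF|rewrite scale0r addr0].
  move=> a _ _ [c [f [Ff ->]]] [c' [f' [Ff' ->]]].
  exists (a * c + c'), (a *: f + f'); split; first by case: sF => _; exact.
  by rewrite scalerDr scalerA scalerDl addrACA.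
have [d d0 dP] := add_line_bound cF nFv.
move=> p pP; pose e_ (k : nat) : R := k.+1%:R^-1.
have e_gt0 k : 0 < e_ k by rewrite invr_gt0.
have /choice[cf cfP] : forall k, exists cf : R[i] * V, F cf.2 /\
    nrm (p - (cf.2 + cf.1 *: v)) < e_ k.
  by move=> k; have [_ [c [f [Ff ->]]] pe] := pP _ (e_gt0 k); exists (c, f).
have small (e : R) : 0 < e -> exists N, forall i, (N <= i)%N -> e_ i < e.
  move=> e0; exists (Num.truncn e^-1) => i Ni.
  rewrite /e_ invf_plt ?posrE//.
  by rewrite (lt_le_trans (truncnS_gt _))// ler_nat ltnS.
have [c cP] : exists c, forall e : R, 0 < e -> exists N, forall i, (N <= i)%N ->
    normc ((cf i).1 - c) < e.
  eexists; apply: (@complex_cauchy_lim R (fun k => (cf k).1)) => e e0.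
  have [N NP] := small (e * d / 2) (divr_gt0 (mulr_gt0 e0 d0) (ltr0Sn _ _)).
  exists N => i j iN jN; rewrite -(ltr_pM2r d0) mulrC.
  have [Fi ie] := cfP i; have [Fj je] := cfP j.
  apply: le_lt_trans (dP _ ((cf i).2 - (cf j).2) _) _; first exact: subspaceB.
  have -> : (cf i).2 - (cf j).2 + ((cf i).1 - (cf j).1) *: v =
     ((cf i).2 + (cf i).1 *: v) - ((cf j).2 + (cf j).1 *: v).
    by rewrite scalerBl opprD addrACA.
  rewrite (le_lt_trans (nrm_triangle p _ _))// nrmB (splitr (e * d)) ltrD//.
    exact: lt_trans (NP _ iN).
  exact: lt_trans (NP _ jN).
exists c, (p - c *: v); split; last by rewrite subrK.
apply: FC => e e0.
have v1 : 0 < nrm v + 1 by rewrite ltr_wpDl// nrm_ge0.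
have [N1 N1P] := cP (e / 2 / (nrm v + 1)) (divr_gt0 (divr_gt0 e0 (ltr0Sn _ _)) v1).
have [N2 N2P] := small (e / 2) (divr_gt0 e0 (ltr0Sn _ _)).
pose N := maxn N1 N2; have [FN Ne] := cfP N.
exists (cf N).2 => //.
have -> : p - c *: v - (cf N).2 =
   p - ((cf N).2 + (cf N).1 *: v) + ((cf N).1 - c) *: v.
  by rewrite scalerBl opprD !addrA subrK addrAC.
rewrite (le_lt_trans (nrmD _ _))// (splitr e) ltr_leD//.
  by rewrite (lt_trans Ne)// N2P// leq_maxr.
rewrite nrmZ.
apply: (@le_trans _ _ (e / 2 / (nrm v + 1) * (nrm v + 1))); last by rewrite mulfVK// gt_eqF.
rewrite ler_pM ?normc_ge0 ?nrm_ge0//; last by rewrite lerDl.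
by rewrite ltW// N1P// leq_maxl.
Qed.

Lemma eigenflag_closed F s : eigenflag F s -> closed_subspace F.
Proof.
elim=> [|{}F {}s l v _ cF _ nFv _]; first exact: closed_subspace0.
exact: closed_add_line.
Qed.

Lemma eigenflag_sub_scal F s l v : eigenflag F s -> (forall u, F u -> F (L u)) ->
  F (sub_scal L l v) ->
  forall c f, F f -> F (sub_scal L l (f + c *: v)).
Proof.
move=> /eigenflag_closed[sF _] FL Fv c f Ff.
rewrite (linearD_of (linear_sub_scal l lL)) (linearZ_of (linear_sub_scal l lL)).
apply: subspaceD => //; last exact: subspaceZ.
exact: sub_scal_invariant.
Qed.

Lemma eigenflag_invariant F s : eigenflag F s -> forall u, F u -> F (L u).
Proof.
elim=> [u ->|{}F {}s l v flF IH _ nFv Fv _ [c [f [Ff ->]]]].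
  exact: linear0_of.
have [sF _] := eigenflag_closed flF.
exists (l * c), (sub_scal L l (f + c *: v) + l *: f); split.
  apply: subspaceD => //; last exact: subspaceZ.
  exact: (eigenflag_sub_scal flF).
by rewrite -addrA -scalerA -scalerDr subrK.
Qed.

Lemma eigenflag_shifts F s : eigenflag F s -> forall u, F u -> shifts s u = 0.
Proof.
elim=> [u -> //|{}F {}s l v flF IH _ nFv Fv _ [c [f [Ff ->]]]] /=.
apply: IH; apply: (eigenflag_sub_scal flF) => //.
exact: eigenflag_invariant flF.
Qed.

Lemma eigenflag_moduli F s : eigenflag F s -> forall l, l \in s -> rho < normc l.
Proof.
by elim=> [//|{}F {}s l v _ IH lr _ _ t]; rewrite inE => /orP[/eqP ->|/IH].
Qed.

Lemma eigenflag_finite_dim F s : eigenflag F s -> finite_dim_subspace F.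
Proof.
elim=> [|{}F {}s l v flF [n [e ->]] _ _ _].
  exists 0%N, (fun=> 0); apply/seteqP; split=> [u ->|u [c ->]].
    by exists (fun=> 0); rewrite big_ord0.
  by rewrite big_ord0.
exists n.+1, (fun i => if unlift ord0 i is Some j then e j else v).
apply/seteqP; split=> [_ [c [_ [[a ->] ->]]]|_ [c ->]].
  exists (fun i => if unlift ord0 i is Some j then a j else c).
  rewrite big_ord_recl unlift_none addrC; congr (_ + _).
  by apply: eq_bigr => i _; rewrite liftK.
exists (c ord0), (\sum_(i < n) c (lift ord0 i) *: e i); split.
  by exists (fun i => c (lift ord0 i)).
rewrite big_ord_recl unlift_none addrC; congr (_ + _).
by apply: eq_bigr => i _; rewrite liftK.
Qed.

(** For an eigenvector [u] outside the smaller [F], the vector [(l - t) *: u] lies in [F], which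
    forces [l = t]. *)
Lemma eigenflag_eigenvalue F s : eigenflag F s ->
  forall l u, F u -> u != 0 -> L u = l *: u -> l \in s.
Proof.
elim=> [l u -> /eqP//|{}F {}s t v flF IH _ nFv Fv l u].
have [sF _] := eigenflag_closed flF.
have [Fu _ u0 Lu|nFu [c [f [Ff uE]]] u0 Lu] := pselect (F u).
  by rewrite inE (IH l u) ?orbT.
have Ftu : F (sub_scal L t u).
  by rewrite uE; apply: (eigenflag_sub_scal flF) => //; exact: eigenflag_invariant flF.
rewrite inE; apply/orP; left; apply/eqP.
apply/eqP/negPn/negP => lt; apply: nFu.
have -> : u = (l - t)^-1 *: sub_scal L t u.
  by rewrite /sub_scal Lu -scalerBl scalerA mulVf ?scale1r// subr_eq0.
exact: subspaceZ.
Qed.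

(** Otherwise flags could be extended forever, giving an ascending chain excluded by
    [no_ascending_chain]. The sigma type carries the proof that each stage is a flag. *)
Lemma maximal_eigenflag : exists F s, eigenflag F s /\
  forall l v, rho < normc l -> F (sub_scal L l v) -> F v.
Proof.
apply: contrapT => nmax.
have ext F s : eigenflag F s -> exists lv : R[i] * V, [/\ rho < normc lv.1, ~ F lv.2
    & F (sub_scal L lv.1 lv.2)].
  move=> flF; apply: contrapT => next; apply: nmax; exists F, s; split => // l v lr Fv.
  by apply: contrapT => nFv; apply: next; exists (l, v).
pose T := {Fs : set V * seq R[i] | eigenflag Fs.1 Fs.2}.
have /choice[nx nxP] : forall x : T, exists lv : R[i] * V,
    [/\ rho < normc lv.1, ~ (sval x).1 lv.2 & (sval x).1 (sub_scal L lv.1 lv.2)].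
  by move=> [[F s] /= flF]; exact: ext flF.
pose step (x : T) : T := exist _ ([set u | exists c f, (sval x).1 f /\ u = f + c *: (nx x).2],
    (nx x).1 :: (sval x).2)
  (let: And3 a b c := nxP x in eigenflagS (svalP x) a b c).
pose st n := iter n step (exist (fun Fs => eigenflag Fs.1 Fs.2) (_, _) eigenflag0 : T).
apply: (@no_ascending_chain _ _ L rho lL rho0 cov
  (fun n => (sval (st n)).1) (fun n => (nx (st n)).1)).
- by move=> n; exact: eigenflag_closed (svalP (st n)).
- by move=> n; exact: eigenflag_invariant (svalP (st n)).
- by move=> n u Fu /=; exists 0, u; rewrite scale0r addr0.
- move=> n; have [_ nF _] := nxP (st n); exists (nx (st n)).2 => //=.
  exists 1, 0; rewrite scale1r add0r; split => //.
  by have [[]] := eigenflag_closed (svalP (st n)).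
- move=> n _ [c [f [Ff ->]]]; have [_ _ Fv] := nxP (st n).
  apply: (eigenflag_sub_scal (svalP (st n))) => //.
  exact: eigenflag_invariant (svalP (st n)).
- by move=> n; have [/ltW] := nxP (st n).
Qed.

(** [F] is a maximal flag and [H] the range of a product of factors [L - l] with [l] taken among its
    roots. Maximality leaves no eigenvalue above [rho] modulo [F], and both the trivial intersection
    and the sum come from it. *)
Theorem riesz_decomposition (B : R) : rho < B ->
  exists2 r, rho < r <= B & ess_decomposition L r.
Proof.
move=> rB; have [F [s [flF Fmax]]] := maximal_eigenflag.
have [sF _] := eigenflag_closed flF.
(* Maximality of [F] removes the factors of [shifts t] one at a time. *)
have peel t : (forall l, l \in t -> rho < normc l) -> forall v, F (shifts t v) -> F v.
  elim: t => [//|l t IH tr v /=] /IH Fv; apply: (Fmax l); first by rewrite tr// mem_head.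
  by apply: Fv => m mt; rewrite tr// inE mt orbT.
have sr := eigenflag_moduli flF.
have [|s' [ss' cH HL surj]] := @stable_range s.
  by move=> l /sr/ltW.
set H := range (shifts s') in cH HL surj.
have [sH _] := cH.
have s'r l : l \in s' -> rho < normc l by move=> /ss'/sr.
have surjs t : {subset t <= s} -> forall u, H u -> exists2 v, H v & shifts t v = u.
  elim: t => [_ u Hu|l t IH ts u Hu]; first by exists u.
  have [v Hv <-] := IH (fun m mt => ts m (mem_behead (s := l :: t) mt)) u Hu.
  have [v' Hv' <-] := surj l (ts l (mem_head _ _)) v Hv.
  by exists v'.
(* [u] is [shifts s y] with [y] in [H]; peeling puts [y] in [F], where [shifts s] vanishes. *)
have FH u : F u -> H u -> u = 0.
  move=> Fu Hu; have [y Hy yu] := surjs s (fun=> id) u Hu.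
  have Fy : F y by apply: (peel s sr); rewrite yu.
  by rewrite -yu (eigenflag_shifts flF).
(* [r] is the least of [B] and the finitely many moduli of [s]: strictly above [rho], which bounds
   the spectral radius on [H], and at most every eigenvalue modulus on [F]. *)
have [r rB' rmin] : exists2 r, rho < r <= B & forall l, l \in s -> r <= normc l.
  elim: s sr {flF ss' surj surjs} => [_|l s IH sr].
    by exists B => //; rewrite rB lexx.
  have [m ms|r /andP[rr rB'] rP] := IH; first by rewrite sr// inE ms orbT.
  exists (Num.min r (normc l)); first by rewrite lt_min rr sr ?mem_head// ge_min rB'.
  move=> m; rewrite inE => /orP[/eqP ->|/rP rm]; first by rewrite ge_min lexx orbT.
  by rewrite ge_min rm.
exists r => //; exists F, H; split; [split=> //|split; [split|split]].
- split; first by apply/seteqP; split=> [u [Fu Hu]|u ->]; [exact: FH|split; [case: sF|case: sH]].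
  (* Some [h] in [H] has the same image as [u] under [shifts s']; peeling puts [u - h] in [F]. *)
  move=> u; have Hsu : H (shifts s' u) by exists u.
  have [h Hh hu] := surjs s' ss' _ Hsu.
  exists (u - h), h; split => //; last by rewrite subrK.
  apply: (peel s' s'r); rewrite (linearB_of (linear_shifts s')) hu subrr.
  by case: sF.
- exact: eigenflag_invariant flF.
- exact: HL.
- by apply: nrm_closedP; case: cH.
- case/andP: rB' => rr _; apply: le_lt_trans rr.
  rewrite /spectral_radius_on; set A := (X in sup X).
  have [->|/set0P A0] := eqVneq A set0; first by rewrite sup0 ltW.
  apply: ge_sup => // _ [l lsp <-]; rewrite leNgt; apply/negP => lr; apply: lsp.
  apply: resolvent_on_injective => //; first exact: ltW.
  move=> u Hu Lu; apply: FH => //; apply: (Fmax l) => //.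
  by rewrite /sub_scal Lu subrr; case: sF.
- exact: eigenflag_finite_dim flF.
- by move=> l u Fu u0 /(eigenflag_eigenvalue flF Fu u0)/rmin.
Qed.

End riesz_decomposition.

(** * Iterates of a perturbed operator *)

Section perturbation.
Context {R : realType} {V : normedModType R[i]}.

(** Write [q = y / (1 + h)] with [q < y < 1]: by Bernoulli's inequality [(1 + h) ^+ n] absorbs the
    affine factor, and [y ^+ n] tends to 0. *)
Lemma affine_geometric_small (a b q d : R) : 0 <= a -> 0 <= b -> 0 < q -> q < 1 -> 0 < d ->
  exists n : nat, (a + b * n%:R) * q ^+ n <= d.
Proof.
move=> a0 b0 q0 q1 d0; pose y := (1 + q) / 2.
have [y0 y1 qy] : [/\ 0 < y, y < 1 & q < y] by rewrite /y; split; lra.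
pose h := y / q - 1.
have h0 : 0 < h by rewrite subr_gt0 ltr_pdivlMr// mul1r.
have bern n : 1 + n%:R * h <= (1 + h) ^+ n.
  elim: n => [|n IH]; first by rewrite mul0r addr0 expr0.
  rewrite exprS; apply: (@le_trans _ _ ((1 + h) * (1 + n%:R * h))); last first.
    by rewrite ler_wpM2l// addr_ge0 ?ltW.
  have nh : 0 <= n%:R * h * h by rewrite mulr_ge0 ?(ltW h0)// mulr_ge0 ?(ltW h0).
  by rewrite -natr1; nra.
have qE : q = y / (1 + h).
  by rewrite /h addrCA subrr addr0 invf_div mulrCA divff ?mulr1// gt_eqF.
have ab0 : 0 < a + b / h + 1 by rewrite ltr_wpDl// addr_ge0// divr_ge0// ltW.
have /cvgrPdist_lt/(_ (d / (a + b / h + 1)) (divr_gt0 d0 ab0))[N _ NP] :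
    y ^+ n @[n --> \oo] --> (0 : R).
  by apply: cvg_expr; rewrite ger0_norm ?ltW.
exists N; have := NP N (leqnn _); rewrite /= sub0r normrN ger0_norm ?exprn_ge0 ?(ltW y0)// => yN.
rewrite qE expr_div_n mulrCA mulrC.
have hN : 0 < (1 + h) ^+ N by rewrite exprn_gt0// ltr_wpDr// ltW.
apply: (@le_trans _ _ ((a + b / h + 1) * y ^+ N)); last first.
  by rewrite mulrC -ler_pdivlMr// ltW.
rewrite ler_wpM2r ?exprn_ge0 ?(ltW y0)// ler_pdivrMr//.
apply: (@le_trans _ _ ((a + b / h) * (1 + N%:R * h))); last first.
  have bh0 : 0 <= a + b / h by rewrite addr_ge0// divr_ge0// ltW.
  have Nh0 : 0 <= 1 + N%:R * h by rewrite addr_ge0// mulr_ge0// ltW.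
  by apply: ler_pM; rewrite ?lerDl.
have bh : b / h * (N%:R * h) = b * N%:R by field; rewrite gt_eqF.
have : 0 <= b / h by rewrite divr_ge0// ltW.
have : 0 <= a * (N%:R * h) by rewrite !mulr_ge0// ltW.
have -> : (a + b / h) * (1 + N%:R * h) = a + a * (N%:R * h) + b / h + b * N%:R.
  by rewrite -bh; ring.
by move=> ? ?; lra.
Qed.

Variables (L S T : V -> V) (M t r0 : R).
Hypotheses (lL : linear L) (lS : linear S) (lT : linear T).
Hypotheses (bL : bounded_map L) (bS : bounded_map S).
Hypotheses (t0 : 0 <= t) (Tt : forall u, nrm (T u) <= t * nrm u).
Hypothesis LST : forall u, L u = S u + T u.
Hypotheses (M0 : 0 <= M) (r0_gt0 : 0 < r0).
Hypothesis Sn : forall n u, nrm (iter n S u) <= M * r0 ^+ n * nrm u.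
Hypothesis TST : forall j, compact_map (fun u => T (iter j S (T u))).

(* The part of (S + T)^n made of the words with exactly one letter T. *)
Fixpoint one_letter n (u : V) : V :=
  if n is m.+1 then iter m S (T u) + one_letter m (S u) else 0.

Lemma linear_one_letter n : linear (one_letter n).
Proof.
elim: n => [|n IH] a u v /=; first by rewrite scaler0 addr0.
by rewrite lT (linear_iter n lS) lS IH scalerDr addrACA.
Qed.

(** A word with [n - 1] letters [S] and one [T] has total power [r0 ^ (n - 1)]; multiplying by [r0]
    restores the exponent [n]. The recursion feeds [S u] to shorter words, and [j] counts these
    letters. *)
Lemma one_letter_bound n j u :
  nrm (one_letter n (iter j S u)) * r0 <= n%:R * (M * t * M) * r0 ^+ (n + j) * nrm u.
Proof.
elim: n j u => [|n IH] j u /=; first by rewrite nrm0 !mul0r.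
rewrite (le_trans (ler_wpM2r (ltW r0_gt0) (nrmD _ _)))// mulrDl.
have -> : n.+1%:R * (M * t * M) * r0 ^+ (n.+1 + j) * nrm u =
    (M * r0 ^+ n * (t * (M * r0 ^+ j * nrm u))) * r0
    + n%:R * (M * t * M) * r0 ^+ (n + j.+1) * nrm u.
  by rewrite addSn addnS !exprS exprD -natr1; ring.
rewrite lerD//; last exact: (IH j.+1).
rewrite ler_wpM2r ?(ltW r0_gt0)// (le_trans (Sn _ _))// ler_wpM2l//.
  by rewrite mulr_ge0// exprn_ge0// ltW.
by rewrite (le_trans (Tt _))// ler_wpM2l.
Qed.

Lemma compact_one_letter n j : compact_map (fun u => one_letter n (iter j S (T u))).
Proof.
elim: n j => [|n IH] j /=; first exact: compact_map0.
apply: compact_map_add; last exact: (IH j.+1).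
by apply: compact_map_compl (TST j); [exact: linear_iter|exact: bounded_iter].
Qed.

Definition more_letters n u := iter n L u - (iter n S u + one_letter n u).

Lemma linear_more_letters n : linear (more_letters n).
Proof.
move=> a u v; rewrite /more_letters (linear_iter n lL) (linear_iter n lS) linear_one_letter.
by rewrite scalerBr scalerDr [in RHS]addrACA -opprD [in RHS]addrACA.
Qed.

(** A word of length [n.+1] with two letters [T] or more either has two before its rightmost letter,
    or has exactly one there and ends with [T]. In the second case [TST] applies. *)
Lemma compact_more_letters n : compact_map (more_letters n).
Proof.
elim: n => [|n IH].
  by apply: compact_map_eq compact_map0 => u; rewrite /more_letters /= addr0 subrr.
apply: (@compact_map_eq _ _ (fun u => more_letters n (L u) + one_letter n (iter 0 S (T u)))).
  move=> u; rewrite /more_letters.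
  have -> : iter n S (L u) = iter n S (S u) + iter n S (T u).
    by rewrite LST (linearD_of (linear_iter n lS)).
  have -> : one_letter n (L u) = one_letter n (S u) + one_letter n (T u).
    by rewrite LST (linearD_of (linear_one_letter n)).
  rewrite -!iterSr /= -addrA; congr (_ + _).
  rewrite -iterS iterSr addrA opprD subrK; congr (- _).
  by rewrite addrA.
apply: compact_map_add; last exact: compact_one_letter.
by apply: compact_map_compr => //; exact: linear_more_letters.
Qed.

Lemma perturbed_iterates_covered rho : r0 < rho ->
  forall d : R, 0 < d -> exists n, finitely_covered (iter n L) (d * rho ^+ n).
Proof.
move=> rr d d0; have rho0 : 0 < rho by exact: lt_trans rr.
have q0 : 0 < r0 / rho by rewrite divr_gt0.
have q1 : r0 / rho < 1 by rewrite ltr_pdivrMr// mul1r.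
have b0 : 0 <= M * t * M / r0 by rewrite divr_ge0 ?(ltW r0_gt0)// !mulr_ge0.
have [n nP] := affine_geometric_small M0 b0 q0 q1 (divr_gt0 d0 (ltr0Sn _ 3)).
exists n; have rn : 0 < rho ^+ n by rewrite exprn_gt0.
have -> : d * rho ^+ n = d / 2 * rho ^+ n + (d / 4 * rho ^+ n + d / 4 * rho ^+ n) by field.
apply: (@finitely_covered_eq _ _ (fun u => more_letters n u + (iter n S u + one_letter n u))).
  by move=> u; rewrite subrK.
apply: finitely_covered_add.
  by apply: compact_more_letters; rewrite mulr_gt0// divr_gt0.
apply: finitely_covered_small; last by rewrite mulr_ge0// ?ltW// divr_gt0.
move=> u; rewrite (le_trans (nrmD _ _))//.
have Dn : nrm (one_letter n u) <= n%:R * (M * t * M / r0) * r0 ^+ n * nrm u.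
  rewrite -(ler_pM2r r0_gt0); have := one_letter_bound n 0 u; rewrite addn0 /= => /le_trans; apply.
  by rewrite le_eqVlt; apply/orP; left; apply/eqP; field; rewrite gt_eqF.
rewrite (le_trans (lerD (Sn n u) Dn))//.
rewrite -mulrDl ler_wpM2r ?nrm_ge0//.
move: nP; rewrite expr_div_n [leLHS]mulrA ler_pdivrMr// => nP.
by rewrite -mulrDl (mulrC n%:R).
Qed.

End perturbation.

Section essential_spectral_radius.
Context {R : realType} {V : normedModType R[i]}.

Lemma spectral_radius_on_ge0 (L : V -> V) (H : set V) : 0 <= spectral_radius_on L H.
Proof.
rewrite /spectral_radius_on; set A := (X in sup X).
have [hs|/sup_out -> //] := pselect (has_sup A).
have [[_ [l ll _]] ub] := hs.
by apply: le_trans (normc_ge0 l) _; apply: ub_le_sup => //; exists l.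
Qed.

Lemma ess_spectral_radius_le (L : V -> V) (r : R) :
  (forall B, r < B -> exists2 s, 0 <= s <= B & ess_decomposition L s) ->
  ess_spectral_radius L <= r.
Proof.
move=> dec; apply/ler_addgt0Pl => e e0.
have [|s /andP[s0 sB] sL] := dec (e + r); first by rewrite ltrDr.
apply: le_trans sB; apply: ge_inf; last by right.
by exists 0 => _ [->|[]//]; exact: spectral_radius_on_ge0.
Qed.

Lemma ess_spectral_radius_covered (L : V -> V) (r : R) :
  @nrm_complete R V -> linear L -> bounded_map L -> 0 <= r ->
  (forall B, r < B -> exists2 rho, 0 < rho < B &
    forall e : R, 0 < e -> exists n, finitely_covered (iter n L) (e * rho ^+ n)) ->
  ess_spectral_radius L <= r.
Proof.
move=> VC lL bL r0 cov; apply: ess_spectral_radius_le => B /cov[rho /andP[rho0 rhoB] rhoP].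
have [s /andP[rs sB] sL] := riesz_decomposition lL bL rho0 rhoP VC rhoB.
by exists s => //; rewrite sB andbT ltW// (lt_trans rho0).
Qed.

Theorem ess_spectral_radius_perturbation (L S T : V -> V) (M t r0 : R) :
  @nrm_complete R V -> linear S -> linear T -> bounded_map S ->
  0 <= t -> (forall u, nrm (T u) <= t * nrm u) ->
  (forall u, L u = S u + T u) -> 0 <= M -> 0 <= r0 ->
  (forall n u, nrm (iter n S u) <= M * r0 ^+ n * nrm u) ->
  (forall j, compact_map (fun u => T (iter j S (T u)))) ->
  forall B, r0 < B -> exists2 rho, 0 < rho < B & forall d : R, 0 < d ->
    exists n, finitely_covered (iter n L) (d * rho ^+ n).
Proof.
move=> VC lS lT bS t0 Tt LST M0 r0_ge0 Sn TST B r0B.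
(* [r0] may vanish, so it is replaced by a positive growth rate [r1], and the covering rate [r2]
   fits in between: [r0 < r1 < r2 < B]. *)
pose r1 := (r0 + r0 + B) / 3; pose r2 := (r0 + B + B) / 3.
have r1_gt0 : 0 < r1 by rewrite /r1; lra.
have r12 : r1 < r2 by rewrite /r1 /r2; lra.
exists r2; first by apply/andP; split; rewrite /r2; lra.
have lL : linear L by move=> a u v; rewrite !LST lS lT scalerDr addrACA.
have bL : bounded_map L.
  have [m m0 mP] := bS; exists (m + t); first exact: addr_ge0.
  by move=> u; rewrite LST mulrDl (le_trans (nrmD _ _))// lerD.
apply: (@perturbed_iterates_covered _ _ L S T M t r1) => // n u.
rewrite (le_trans (Sn n u))// ler_wpM2r ?nrm_ge0// ler_wpM2l//.
by rewrite lerXn2r// ?nnegrE ?(ltW r1_gt0)// /r1; lra.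
Qed.

End essential_spectral_radius.

(** * Kernel operators on weighted spaces *)

Section complex_measurability.
Context {R : realType} {d : measure_display} {E : measurableType d}.
Implicit Types (f g : E -> R[i]).

Lemma cmeasurableM f g : cmeasurable f -> cmeasurable g -> cmeasurable (fun x => f x * g x).
Proof.
move=> [fr fi] [gr gi]; split.
  apply: (eq_measurable_fun (fun x => complex.Re (f x) * complex.Re (g x)
      - complex.Im (f x) * complex.Im (g x))).
    by move=> x _; case: (f x) (g x) => [? ?] [? ?].
  by apply: measurable_funB; exact: measurable_funM.
apply: (eq_measurable_fun (fun x => complex.Re (f x) * complex.Im (g x)
    + complex.Im (f x) * complex.Re (g x))).
  by move=> x _; case: (f x) (g x) => [? ?] [? ?].
by apply: measurable_funD; exact: measurable_funM.
Qed.

Lemma cmeasurable_real (f : E -> R) : measurable_fun setT f -> cmeasurable (fun x => (f x)%:C).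
Proof. by move=> mf; split => //; exact: measurable_cst. Qed.

Lemma cmeasurable_cst (c : R[i]) : cmeasurable (fun _ : E => c).
Proof. by split; exact: measurable_cst. Qed.

Lemma measurable_normc f : cmeasurable f -> measurable_fun setT (fun x => normc (f x)).
Proof.
move=> [fr fi].
apply: (eq_measurable_fun (Num.sqrt \o (fun x => complex.Re (f x) ^+ 2 + complex.Im (f x) ^+ 2))).
  by move=> x _ /=; case: (f x).
apply: measurableT_comp.
  by apply: continuous_measurable_fun; exact: sqrt_continuous.
by apply: measurable_funD; exact: measurable_funX.
Qed.

End complex_measurability.

Section complex_integral.
Context {R : realType} {d : measure_display} {E : measurableType d}.
Variable mu : {measure set E -> \bar R}.
Implicit Types (f g : E -> R[i]).

Definition cintegrable f : Prop :=
  cmeasurable f /\ (\int[mu]_x (normc (f x))%:E < +oo)%E.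

Lemma cintegrable_Re f : cintegrable f -> mu.-integrable setT (EFin \o (fun x => complex.Re (f x))).
Proof.
move=> [mf foo]; apply/integrableP; split; first by apply/measurable_EFinP; case: mf.
apply: le_lt_trans foo; apply: ge0_le_integral => //=.
- by apply/measurable_EFinP/measurableT_comp => //; case: mf.
- by apply/measurable_EFinP; exact: measurable_normc.
- by move=> x _; rewrite lee_fin ler_Re_normc.
Qed.

Lemma cintegrable_Im f : cintegrable f -> mu.-integrable setT (EFin \o (fun x => complex.Im (f x))).
Proof.
move=> [mf foo]; apply/integrableP; split; first by apply/measurable_EFinP; case: mf.
apply: le_lt_trans foo; apply: ge0_le_integral => //=.
- by apply/measurable_EFinP/measurableT_comp => //; case: mf.
- by apply/measurable_EFinP; exact: measurable_normc.
- by move=> x _; rewrite lee_fin ler_Im_normc.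
Qed.

Lemma cintegral_linear (a : R[i]) f g : cintegrable f -> cintegrable g ->
  cintegral mu (fun x => a * f x + g x) = a * cintegral mu f + cintegral mu g.
Proof.
move=> intf intg.
have fr := cintegrable_Re intf; have fi := cintegrable_Im intf.
have gr := cintegrable_Re intg; have gi := cintegrable_Im intg.
have Z (h : E -> R) k : mu.-integrable setT (EFin \o h) ->
    mu.-integrable setT (EFin \o (fun x => k * h x)).
  by move=> ih; have := integrableZl measurableT k ih.
have D (h k : E -> R) : mu.-integrable setT (EFin \o h) -> mu.-integrable setT (EFin \o k) ->
    mu.-integrable setT (EFin \o (fun x => h x + k x)).
  by move=> ih ik; have := integrableD measurableT ih ik.
have B (h k : E -> R) : mu.-integrable setT (EFin \o h) -> mu.-integrable setT (EFin \o k) ->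
    mu.-integrable setT (EFin \o (fun x => h x - k x)).
  by move=> ih ik; have := integrableB measurableT ih ik.
rewrite /cintegral; case: a => ar ai.
rewrite [RHS](_ : _ =
  (ar * (\int[mu]_y complex.Re (f y)) - ai * (\int[mu]_y complex.Im (f y)) + \int[mu]_y complex.Re (g y))
  +i* (ar * (\int[mu]_y complex.Im (f y)) + ai * (\int[mu]_y complex.Re (f y)) + \int[mu]_y complex.Im (g y)))//.
congr (_ +i* _).
  rewrite -!RintegralZl// -RintegralB//; [|exact: Z|exact: Z].
  rewrite -RintegralD//; last by apply: B; exact: Z.
  apply: eq_Rintegral => x _.
  by case: (f x) (g x) => [? ?] [? ?].
rewrite -!RintegralZl// -RintegralD//; [|exact: Z|exact: Z].
rewrite -RintegralD//; last by apply: D; exact: Z.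
apply: eq_Rintegral => x _.
by case: (f x) (g x) => [? ?] [? ?].
Qed.

(** With [a], [b] the coordinates of the integral and [t] its modulus, integrate the Cauchy-Schwarz
    inequality [a * Re f + b * Im f <= t * normc f]: the left side gives [t ^ 2]. *)
Lemma normc_cintegral_le f : cintegrable f ->
  ((normc (cintegral mu f))%:E <= \int[mu]_x (normc (f x))%:E)%E.
Proof.
move=> intf; have [mf foo] := intf.
have fr := cintegrable_Re intf; have fi := cintegrable_Im intf.
have Z (h : E -> R) k : mu.-integrable setT (EFin \o h) ->
    mu.-integrable setT (EFin \o (fun x => k * h x)).
  by move=> ih; have := integrableZl measurableT k ih.
have nf : mu.-integrable setT (EFin \o (fun x => normc (f x))).
  apply/integrableP; split; first by apply/measurable_EFinP; exact: measurable_normc.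
  apply: le_lt_trans foo; apply: ge0_le_integral => //=.
  - by apply/measurable_EFinP/measurableT_comp => //; exact: measurable_normc.
  - by apply/measurable_EFinP; exact: measurable_normc.
  - by move=> x _; rewrite ger0_norm ?normc_ge0.
rewrite -[leRHS]fineK; last by exact: integrable_fin_num nf.
rewrite lee_fin -/(Rintegral mu setT (fun x => normc (f x))).
pose t := normc (cintegral mu f).
have t0 : 0 <= t by exact: normc_ge0.
rewrite -/t; have [->|tn0] := eqVneq t 0.
  by apply: Rintegral_ge0 => x _; exact: normc_ge0.
have {tn0}t_gt0 : 0 < t by rewrite lt_neqAle eq_sym tn0.
rewrite -(ler_pM2l t_gt0) -RintegralZl//.
pose a := \int[mu]_y complex.Re (f y); pose b := \int[mu]_y complex.Im (f y).
have tE : t * t = a * a + b * b.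
  by rewrite -!expr2 /t /cintegral /= sqr_sqrtr// addr_ge0 ?sqr_ge0.
rewrite tE -!RintegralZl// -RintegralD//; [|exact: Z|exact: Z].
apply: le_Rintegral => //.
- by have := integrableD measurableT (Z _ a fr) (Z _ b fi).
- exact: Z.
move=> x _; set u := complex.Re (f x); set v := complex.Im (f x).
have nE : normc (f x) ^+ 2 = u ^+ 2 + v ^+ 2.
  by rewrite /u /v; case: (f x) => p q /=; rewrite sqr_sqrtr// addr_ge0 ?sqr_ge0.
have n0 := normc_ge0 (f x).
apply: (le_trans (ler_norm _)); rewrite -(@ler_pXn2r _ 2)// ?nnegrE ?mulr_ge0//.
rewrite real_normK ?num_real// exprMn nE [t ^+ 2]expr2 tE.
have := sqr_ge0 (a * v - b * u); nra.
Qed.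

End complex_integral.

Section kernel_operators.
Context {R : realType} {d : measure_display} {E : measurableType d}.
Variable w : weight R E.
Implicit Types (Q : R.-pker E ~> E).

Lemma nrm_Bw (f : Bw w) : nrm f = Bw_norm f.
Proof. by []. Qed.

Lemma Bw_cmeasurable (f : Bw w) : cmeasurable f.
Proof. by have := Bw_funP f; rewrite inE => -[]. Qed.

Lemma Bw_pointwise (f : Bw w) x : normc (f x) <= Bw_norm f * w x.
Proof.
by have := Bw_norm_ub f x; rewrite ler_pdivrMl ?weight_gt0// mulrC.
Qed.

Lemma measurable_Rintegral_kernel Q (g : E * E -> R) : measurable_fun setT g ->
  measurable_fun setT (fun x => \int[Q x]_y g (x, y)).
Proof.
move=> mg; apply: measurableT_comp => //.
under eq_fun do rewrite integralE.
have mg' : measurable_fun setT (EFin \o g) by exact/measurable_EFinP.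
apply: emeasurable_funB.
- apply: (eq_measurable_fun (fun x => (\int[Q x]_y ((EFin \o g)^\+ (x, y)))%E)).
    by move=> x _; apply: eq_integral => y _; rewrite unlock.
  apply: measurable_fun_integral_sfinite_kernel => //.
  exact: measurable_funepos.
- apply: (eq_measurable_fun (fun x => (\int[Q x]_y ((EFin \o g)^\- (x, y)))%E)).
    by move=> x _; apply: eq_integral => y _; rewrite unlock.
  apply: measurable_fun_integral_sfinite_kernel => //.
  exact: measurable_funeneg.
Qed.

Lemma cmeasurable_section (beta : E * E -> R[i]) x : cmeasurable beta ->
  cmeasurable (fun y => beta (x, y)).
Proof.
by move=> [br bi]; split; [apply: (measurableT_comp br)|apply: (measurableT_comp bi)].
Qed.

(** Bounds by [c] the norm on [Bw] of the operator with kernel [Q] and multiplier [beta]. *)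
Definition kernel_bound Q (beta : E * E -> R[i]) (c : R) : Prop :=
  forall x, (\int[Q x]_y (w y * normc (beta (x, y)))%:E <= (c * w x)%:E)%E.

(** The majorant [V] is general in order to serve both for [w] and for the Lyapunov function of
    [residual_iterates]. *)
Lemma kernel_integral_le Q beta c (f : E -> R[i]) (V : E -> R) t x :
  cmeasurable beta -> cmeasurable f -> measurable_fun setT V -> 0 <= t ->
  (forall y, normc (f y) <= t * V y) ->
  (\int[Q x]_y (V y * normc (beta (x, y)))%:E <= c%:E)%E ->
  (\int[Q x]_y (normc (f y * beta (x, y)))%:E <= (t * c)%:E)%E.
Proof.
move=> mb mf mV t0 ft Vc; have mbx := cmeasurable_section x mb.
have mVb : measurable_fun setT (fun y => (V y * normc (beta (x, y)))%:E).
  by apply/measurable_EFinP/measurable_funM => //; exact: measurable_normc.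
rewrite EFinM; apply: (@le_trans _ _ (t%:E * \int[Q x]_y (V y * normc (beta (x, y)))%:E)%E).
  (* Nonnegativity of [V] comes from [ft], hence only for [t > 0]. *)
  have [t00|t_gt0] := eqVneq t 0.
    rewrite t00 mul0e (eq_integral (cst 0%E)) ?integral0// => y _ /=.
    have := ft y; rewrite t00 mul0r normcM => fy0.
    by have /eqP -> : normc (f y) == 0; rewrite ?mul0r// eq_le fy0 normc_ge0.
  have V0 y : 0 <= V y.
    by have := le_trans (normc_ge0 _) (ft y); rewrite pmulr_rge0// lt_neqAle eq_sym t_gt0.
  rewrite -ge0_integralZl//; last first.
    by move=> y _; rewrite lee_fin mulr_ge0 ?normc_ge0.
  apply: ge0_le_integral => //.
  - by move=> y _; rewrite lee_fin normc_ge0.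
  - by apply/measurable_EFinP/measurable_normc/cmeasurableM.
  - exact: measurable_funeM.
  - by move=> y _; rewrite -EFinM lee_fin normcM mulrA ler_wpM2r ?normc_ge0.
by apply: lee_wpmul2l => //; rewrite lee_fin.
Qed.

Lemma Bw_cintegrable Q beta c (f : Bw w) x : cmeasurable beta -> kernel_bound Q beta c ->
  cintegrable (Q x) (fun y => f y * beta (x, y)).
Proof.
move=> mb bc; have mf := Bw_cmeasurable f; split.
  by apply: cmeasurableM => //; exact: cmeasurable_section.
apply: le_lt_trans (ltry _).
exact: (kernel_integral_le mb mf (@weight_measurable _ _ _ w) (Bw_norm_ge0 f) (Bw_pointwise f) (bc x)).
Qed.

Lemma normc_kernel_op_le Q beta c (f : Bw w) (V : E -> R) t x k :
  cmeasurable beta -> kernel_bound Q beta c -> measurable_fun setT V -> 0 <= t ->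
  (forall y, normc (f y) <= t * V y) ->
  (\int[Q x]_y (V y * normc (beta (x, y)))%:E <= k%:E)%E ->
  normc (kernel_op_chi Q beta f x) <= t * k.
Proof.
move=> mb bc mV t0 ft Vk; rewrite -lee_fin.
apply: le_trans (normc_cintegral_le (Bw_cintegrable f x mb bc)) _.
exact: kernel_integral_le (Bw_cmeasurable f) mV t0 ft Vk.
Qed.

Lemma kernel_op_exists Q beta c : cmeasurable beta -> 0 <= c -> kernel_bound Q beta c ->
  exists T : {linear Bw w -> Bw w}, (forall f x, T f x = kernel_op_chi Q beta f x) /\
    forall f, nrm (T f) <= c * nrm f.
Proof.
move=> mb c0 bc.
have bnd (f : Bw w) x : (w x)^-1 * normc (kernel_op_chi Q beta f x) <= c * Bw_norm f.
  rewrite ler_pdivrMl ?weight_gt0// mulrC -mulrA mulrC -mulrA.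
  rewrite mulrC -mulrA.
  apply: le_trans (normc_kernel_op_le mb bc (@weight_measurable _ _ _ w) (Bw_norm_ge0 f)
    (Bw_pointwise f) (bc x)) _.
  by rewrite le_eqVlt; apply/orP; left; apply/eqP; ring.
have BwT (f : Bw w) : kernel_op_chi Q beta f \in Bw_pred w.
  rewrite inE; split; last by exists (c * Bw_norm f) => x; exact: bnd.
  have mfb : cmeasurable (fun z : E * E => f z.2 * beta z).
    have [fr fi] := Bw_cmeasurable f.
    by apply: cmeasurableM => //; split; [apply: (measurableT_comp fr)|apply: (measurableT_comp fi)].
  have [Mr Mi] := mfb.
  split.
    exact: (measurable_Rintegral_kernel Q Mr).
  exact: (measurable_Rintegral_kernel Q Mi).
pose T0 (f : Bw w) : Bw w := MkBw (BwT f).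
have lT : linear T0.
  move=> a f g; apply: val_inj; apply/funext => x /=.
  transitivity (a * kernel_op_chi Q beta f x + kernel_op_chi Q beta g x) => //.
  rewrite /kernel_op_chi -cintegral_linear; [|exact: Bw_cintegrable|exact: Bw_cintegrable].
  by congr cintegral; apply/funext => y; rewrite mulrA -mulrDl.
pose T : {linear Bw w -> Bw w} := HB.pack T0 (GRing.isLinear.Build _ _ _ _ T0 lT).
exists T; split => // f; rewrite !nrm_Bw; apply: Bw_norm_le.
  by rewrite mulr_ge0// Bw_norm_ge0.
exact: bnd.
Qed.

Lemma Bw_complete : @nrm_complete R (Bw w).
Proof.
move=> u uC.
have wle x (e : R) i j : nrm (u i - u j) < e -> normc (u i x - u j x) < e * w x.
  move=> ue; apply: le_lt_trans (Bw_pointwise (u i - u j) x) _.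
  by rewrite ltr_pM2r ?weight_gt0.
pose p x : R[i] := lim ((fun k => complex.Re (u k x)) @ \oo)
   +i* lim ((fun k => complex.Im (u k x)) @ \oo).
have uCx x : forall e : R, 0 < e -> exists N, forall i j, (N <= i)%N -> (N <= j)%N ->
     normc (u i x - u j x) < e.
  move=> e e0; have [N NP] := uC (e / w x) (divr_gt0 e0 (weight_gt0 w x)).
  exists N => i j iN jN; have := wle x _ _ _ (NP i j iN jN).
  by rewrite mulfVK// gt_eqF// weight_gt0.
have up x : forall e : R, 0 < e -> exists N, forall i, (N <= i)%N -> normc (u i x - p x) < e.
  exact: (@complex_cauchy_lim R (fun k => u k x) (uCx x)).
have unif (e : R) N : (forall i j, (N <= i)%N -> (N <= j)%N -> nrm (u i - u j) < e) ->
    forall i x, (N <= i)%N -> normc (u i x - p x) <= e * w x.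
  move=> NP i x iN; apply/ler_addgt0Pr => e' e0.
  have [M MP] := up x e' e0.
  have -> : u i x - p x = (u i x - u (maxn N M) x) + (u (maxn N M) x - p x).
    by rewrite addrA subrK.
  apply: (le_trans (normcD _ _)); rewrite lerD//.
    by apply/ltW/wle/NP => //; exact: leq_maxl.
  by apply/ltW/MP; exact: leq_maxr.
have mp : cmeasurable p.
  split.
    apply: (@measurable_fun_cvg _ _ R setT (fun k x => complex.Re (u k x)) _) => //.
      by move=> k; case: (Bw_cmeasurable (u k)).
    move=> x _; apply: real_cauchy_lim => e /(uCx x)[N NP]; exists N => i j iN jN.
    by apply: le_lt_trans (NP _ _ iN jN); case: (u i x) (u j x) => [? ?] [? ?]; exact: (ler_Re_normc (Complex _ _)).
  apply: (@measurable_fun_cvg _ _ R setT (fun k x => complex.Im (u k x)) _) => //.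
    by move=> k; case: (Bw_cmeasurable (u k)).
  move=> x _; apply: real_cauchy_lim => e /(uCx x)[N NP]; exists N => i j iN jN.
  by apply: le_lt_trans (NP _ _ iN jN); case: (u i x) (u j x) => [? ?] [? ?]; exact: (ler_Im_normc (Complex _ _)).
have pB : p \in Bw_pred w.
  rewrite inE; split => //.
  have [N NP] := uC 1 ltr01; exists (1 + Bw_norm (u N)) => x.
  rewrite ler_pdivrMl ?weight_gt0// mulrC mulrDl.
  have -> : p x = - (u N x - p x) + u N x by rewrite opprB subrK.
  by rewrite (le_trans (normcD _ _))// normcN lerD ?Bw_pointwise// (unif _ _ NP).
exists (MkBw pB) => e e0.
have [N NP] := uC (e / 2) (divr_gt0 e0 (ltr0Sn _ _)).
exists N => i iN; apply: (@le_lt_trans _ _ (e / 2)); last by lra.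
apply: Bw_norm_le; first by rewrite divr_ge0// ltW.
move=> x; rewrite ler_pdivrMl ?weight_gt0// mulrC.
exact: unif iN.
Qed.

End kernel_operators.

(** * Positive operators on nonnegative functions *)

Section positive_operators.
Context {R : realType} {d : measure_display} {E : measurableType d}.
Local Open Scope ereal_scope.
Implicit Types (g h : E -> \bar R) (Psi : (E -> \bar R) -> E -> \bar R).

Definition nonneg_measurable g : Prop := measurable_fun [set: E] g /\ forall x, 0 <= g x.

(** Kernels seen through their action on nonnegative functions. The class is closed under
    composition and multiplication by a function, so composed kernels need not be built as
    measures. *)
Record positive_operator Psi : Prop := PositiveOperator {
  posop_measurable : forall g, nonneg_measurable g -> nonneg_measurable (Psi g) ;
  posop_le : forall g h, nonneg_measurable g -> nonneg_measurable h ->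
    (forall x, g x <= h x) -> forall x, Psi g x <= Psi h x ;
  posopD : forall g h, nonneg_measurable g -> nonneg_measurable h ->
    Psi (fun x => g x + h x) = fun x => Psi g x + Psi h x ;
  posopZ : forall (c : R) g, (0 <= c)%R -> nonneg_measurable g ->
    Psi (fun x => c%:E * g x) = fun x => c%:E * Psi g x ;
  posop_series : forall g : nat -> E -> \bar R, (forall n, nonneg_measurable (g n)) ->
    Psi (fun x => \sum_(n <oo) g n x) = fun x => \sum_(n <oo) Psi (g n) x }.

Lemma nonneg_measurableD g h : nonneg_measurable g -> nonneg_measurable h ->
  nonneg_measurable (fun x => g x + h x).
Proof. by move=> [mg g0] [mh h0]; split=> [|x]; [exact: emeasurable_funD|exact: adde_ge0]. Qed.

Lemma nonneg_measurableZ (a : E -> R) g : measurable_fun [set: E] a -> (forall x, 0 <= a x)%R ->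
  nonneg_measurable g -> nonneg_measurable (fun x => (a x)%:E * g x).
Proof.
move=> ma a0 [mg g0]; split=> [|x]; last by rewrite mule_ge0// lee_fin.
by apply: emeasurable_funM => //; exact/measurable_EFinP.
Qed.

Lemma nonneg_measurable_series (g : nat -> E -> \bar R) :
  (forall n, nonneg_measurable (g n)) -> nonneg_measurable (fun x => \sum_(n <oo) g n x).
Proof.
move=> mg; split=> [|x]; last by apply: nneseries_ge0 => n _ _; case: (mg n).
by apply: ge0_emeasurable_sum => // n; case: (mg n).
Qed.

Lemma positive_operator_id : positive_operator id.
Proof. by []. Qed.

Lemma positive_operator_comp Psi1 Psi2 : positive_operator Psi1 -> positive_operator Psi2 ->
  positive_operator (Psi1 \o Psi2).
Proof.
move=> p1 p2; split=> /=.
- by move=> g mg; apply/(posop_measurable p1)/(posop_measurable p2).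
- move=> g h mg mh gh; apply: (posop_le p1); [exact: posop_measurable|exact: posop_measurable|].
  exact: posop_le.
- by move=> g h mg mh; rewrite (posopD p2)// (posopD p1)//; exact: posop_measurable.
- by move=> c g c0 mg; rewrite (posopZ p2)// (posopZ p1)//; exact: posop_measurable.
- by move=> g mg; rewrite (posop_series p2)// (posop_series p1)// => n; exact: posop_measurable.
Qed.

Lemma positive_operator_iter Psi n : positive_operator Psi -> positive_operator (iter n Psi).
Proof.
move=> p; elim: n => [|n IH]; first exact: positive_operator_id.
exact: (positive_operator_comp p IH).
Qed.

Lemma positive_operator_mul (a : E -> R) : measurable_fun [set: E] a -> (forall x, 0 <= a x)%R ->
  positive_operator (fun g x => (a x)%:E * g x).
Proof.
move=> ma a0; split.
- by move=> g mg; exact: nonneg_measurableZ.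
- by move=> g h _ _ gh x; rewrite lee_wpmul2l// lee_fin.
- by move=> g h [_ g0] [_ h0]; apply/funext => x; rewrite ge0_muleDr.
- by move=> c g c0 [_ g0]; apply/funext => x; rewrite muleCA.
- by move=> g mg; apply/funext => x; rewrite nneseriesZl// => n _; case: (mg n).
Qed.

Lemma positive_operator_kernel (Q : R.-pker E ~> E) :
  positive_operator (fun g x => \int[Q x]_y g y).
Proof.
split.
- move=> g [mg g0]; split=> [|x]; last exact: integral_ge0.
  by apply: measurable_fun_integral_kernel => // U mU; exact: measurable_kernel.
- by move=> g h [mg g0] [mh h0] gh x; exact: ge0_le_integral.
- by move=> g h [mg g0] [mh h0]; apply/funext => x; rewrite ge0_integralD.
- by move=> c g c0 [mg g0]; apply/funext => x; rewrite ge0_integralZl_EFin.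
- move=> g mg; apply/funext => x; rewrite integral_nneseries//.
  + by move=> n; case: (mg n).
  + by move=> n y _; case: (mg n).
Qed.

(** Turns integration against [nu] into a kernel operator whose multiplier is the density, so that
    the lemmas on kernels apply to the minorizing part. *)
Definition constant_kernel (nu : probability E R) : E -> {measure set E -> \bar R} := fun=> nu.

Lemma measurable_constant_kernel (nu : probability E R) U : measurable U ->
  measurable_fun [set: E] (constant_kernel nu ^~ U).
Proof. by move=> mU; exact: measurable_cst. Qed.

HB.instance Definition _ (nu : probability E R) :=
  isKernel.Build _ _ _ _ _ (constant_kernel nu) (@measurable_constant_kernel nu).

Lemma constant_kernel_setT (nu : probability E R) x : constant_kernel nu x [set: E] = 1.
Proof. exact: (probability_setT nu). Qed.

HB.instance Definition _ (nu : probability E R) :=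
  Kernel_isProbability.Build _ _ _ _ _ (constant_kernel nu) (@constant_kernel_setT nu).

End positive_operators.

Section labels.
Context {R : realType}.

Lemma interval_labels (M e : R) : 0 <= M -> 0 < e ->
  exists (I : finType) (phi : R -> I), forall s t, `|s| <= M -> `|t| <= M ->
    phi s = phi t -> `|s - t| <= e.
Proof.
move=> M0 e0; pose n0 := Num.truncn ((M + M) / e).
exists 'I_n0.+1, (fun t => inord (Num.truncn ((t + M) / e))) => s t sM tM.
have bnd u : `|u| <= M -> 0 <= (u + M) / e /\ (Num.truncn ((u + M) / e) <= n0)%N.
  rewrite ler_norml => /andP[Mu uM]; split.
    by rewrite divr_ge0 ?(ltW e0)//; lra.
  by apply: Num.Theory.le_truncn; rewrite ler_pM2r ?invr_gt0// lerD2r.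
have [s0 sn] := bnd s sM; have [t0 tn] := bnd t tM.
move=> /(congr1 val); rewrite /= !inordK ?ltnS// => st.
have /andP[s1 s2] := Num.Theory.truncn_itv s0.
have /andP[t1 t2] := Num.Theory.truncn_itv t0.
rewrite -st in t1 t2; rewrite -natr1 in s2 t2.
have : `|(s + M) / e - (t + M) / e| <= 1 by rewrite ler_norml; apply/andP; split; lra.
have -> : (s + M) / e - (t + M) / e = (s - t) / e by rewrite -mulrBl; congr (_ / _); ring.
by rewrite normrM [X in _ * X]gtr0_norm ?invr_gt0// ler_pdivrMr// mul1r.
Qed.

End labels.

(** * Compactness of products of kernel operators *)

Section function_labels.
Context {R : realType} {d : measure_display} {E : measurableType d}.
Variables (w : weight R E) (nu : probability E R).
Variables (Psi : (E -> \bar R) -> E -> \bar R) (x0 : E) (K : R).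
Hypothesis posPsi : positive_operator Psi.
Hypotheses (K0 : 0 <= K) (PsiK : (Psi (EFin \o w) x0 <= K%:E)%E).

Definition unit_function (f : E -> R) : Prop :=
  measurable_fun setT f /\ forall x, `|f x| <= 1.

Definition bounded_measurable (g : E * E -> R) : Prop :=
  measurable_fun setT g /\ exists2 M : R, 0 <= M & forall z, `|g z| <= M.

Definition kernel_gap (g : E * E -> R) (h : E -> R) (x : E) : \bar R :=
  (w x * `|\int[nu]_z (g (x, z) * h z)|)%:E.

(** Up to [e], the integral operator with kernel [g] sends the unit ball of bounded functions to a
    finite set, in the weighted L1 norm carried by [Psi] at [x0]. Such an average at one point is
    all that the outer factor of a product sees. *)
Definition label_small (g : E * E -> R) (e : R) : Prop :=
  exists (I : finType) (phi : (E -> R) -> I), forall f f',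
    unit_function f -> unit_function f' -> phi f = phi f' ->
    (Psi (kernel_gap g (fun z => f z - f' z)%R) x0 <= e%:E)%E.

Lemma bounded_integrable (h : E -> R) M : measurable_fun setT h -> (forall x, `|h x| <= M) ->
  nu.-integrable setT (EFin \o h).
Proof.
move=> mh hM; apply/integrableP; split; first exact/measurable_EFinP.
apply: (@le_lt_trans _ _ (\int[nu]_x (cst M%:E x))%E).
  apply: ge0_le_integral => //=.
  - by apply/measurable_EFinP; exact: measurableT_comp.
  - by move=> x _; rewrite lee_fin.
by rewrite integral_cst// [X in (_ * X)%E](probability_setT nu) mule1 ltry.
Qed.

Lemma bounded_measurable_section g x (h : E -> R) (M : R) : bounded_measurable g -> measurable_fun setT h ->
  (forall z, `|h z| <= M) -> nu.-integrable setT (EFin \o (fun z => g (x, z) * h z)).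
Proof.
move=> [mg [Mg Mg0 gM]] mh hM; apply: (@bounded_integrable _ (Mg * M)).
  by apply: measurable_funM => //; apply: (measurableT_comp mg).
by move=> z; rewrite normrM ler_pM.
Qed.

Lemma gap_function f f' : unit_function f -> unit_function f' ->
  measurable_fun setT (fun z => f z - f' z)%R /\ forall z, `|f z - f' z| <= 2.
Proof.
move=> [mf f1] [mf' f1']; split; first exact: measurable_funB.
by move=> z; rewrite (le_trans (ler_normB _ _))// -[leRHS]/(1 + 1) lerD.
Qed.

Lemma nonneg_measurable_weight : nonneg_measurable (EFin \o w).
Proof.
split; first by apply/measurable_EFinP; exact: weight_measurable.
by move=> x; rewrite lee_fin ltW// weight_gt0.
Qed.

Lemma nonneg_measurable_gap g h : bounded_measurable g -> measurable_fun setT h ->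
  nonneg_measurable (kernel_gap g h).
Proof.
move=> [mg _] mh; split; last first.
  by move=> x; rewrite lee_fin mulr_ge0// ltW// weight_gt0.
apply/measurable_EFinP/measurable_funM; first exact: weight_measurable.
apply: measurableT_comp => //.
apply: (@measurable_Rintegral_kernel _ _ _ (constant_kernel nu) (fun z => g z * h z.2)).
by apply: measurable_funM => //; apply: (measurableT_comp mh).
Qed.

Lemma bounded_measurableD g1 g2 : bounded_measurable g1 -> bounded_measurable g2 ->
  bounded_measurable (fun z => g1 z + g2 z).
Proof.
move=> [m1 [M1 M10 g1M]] [m2 [M2 M20 g2M]]; split; first exact: measurable_funD.
exists (M1 + M2); first exact: addr_ge0.
by move=> z; rewrite (le_trans (ler_normD _ _))// lerD.
Qed.

Lemma bounded_measurableZ c g : bounded_measurable g -> bounded_measurable (fun z => c * g z).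
Proof.
move=> [m1 [M1 M10 g1M]]; split; first by apply: measurable_funM => //; exact: measurable_cst.
exists (`|c| * M1); first exact: mulr_ge0.
by move=> z; rewrite normrM ler_wpM2l.
Qed.

Lemma bounded_measurable_indic (S : set (E * E)) : measurable S ->
  bounded_measurable (\1_S : E * E -> R).
Proof.
move=> mS; split; first exact: measurable_indic.
by exists 1 => // z; rewrite indicE ger0_norm ?ler0n// lern1 leq_b1.
Qed.

Lemma label_smallD g1 g2 e1 e2 : bounded_measurable g1 -> bounded_measurable g2 ->
  label_small g1 e1 -> label_small g2 e2 -> label_small (fun z => g1 z + g2 z) (e1 + e2).
Proof.
move=> b1 b2 [I [phi ph]] [J [psi ps]].
exists (I * J)%type, (fun f => (phi f, psi f)) => f f' uf uf' [/(ph _ _ uf uf') H1 /(ps _ _ uf uf') H2].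
have [mh h2] := gap_function uf uf'.
have n1 := nonneg_measurable_gap b1 mh; have n2 := nonneg_measurable_gap b2 mh.
rewrite EFinD; apply: le_trans (leeD H1 H2).
rewrite -[leRHS](congr1 (fun F => F x0) (posopD posPsi n1 n2)).
apply: (posop_le posPsi).
- by apply: nonneg_measurable_gap => //; exact: bounded_measurableD.
- exact: nonneg_measurableD.
move=> x; rewrite /kernel_gap -EFinD lee_fin -mulrDr ler_wpM2l ?(ltW (weight_gt0 w x))//.
under eq_Rintegral do rewrite mulrDl.
rewrite RintegralD//; first exact: ler_normD.
- exact: (bounded_measurable_section x b1 mh h2).
- exact: (bounded_measurable_section x b2 mh h2).
Qed.

Lemma label_smallZ c g e : bounded_measurable g -> label_small g e ->
  label_small (fun z => c * g z) (`|c| * e).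
Proof.
move=> bg [I [phi ph]]; exists I, phi => f f' uf uf' /(ph _ _ uf uf') H.
have [mh h2] := gap_function uf uf'.
have n1 := nonneg_measurable_gap bg mh.
rewrite EFinM; apply: (@le_trans _ _ (`|c|%:E * Psi (kernel_gap g (fun z => f z - f' z)%R) x0)%E); last first.
  by rewrite lee_wpmul2l// lee_fin.
rewrite -[leRHS](congr1 (fun F => F x0) (posopZ posPsi (normr_ge0 c) n1)).
rewrite le_eqVlt; apply/orP; left; apply/eqP; congr (Psi _ x0); apply/funext => x.
rewrite /kernel_gap -EFinM mulrCA -normrM; congr (_ * `|_|)%:E.
rewrite -RintegralZl//; last exact: (bounded_measurable_section x bg mh h2).
by apply: eq_Rintegral => z _; rewrite mulrA.
Qed.

Lemma label_small_trivial g (M : R) : bounded_measurable g -> 0 <= M ->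
  (forall z, `|g z| <= M) -> label_small g (M * 2 * K).
Proof.
move=> bg M0 gM; exists unit, (fun=> tt) => f f' uf uf' _.
have [mh h2] := gap_function uf uf'.
rewrite EFinM; apply: (@le_trans _ _ ((M * 2)%:E * Psi (EFin \o w) x0)%E); last first.
  by rewrite lee_wpmul2l// lee_fin mulr_ge0.
have nw := nonneg_measurable_weight.
have M20 : 0 <= M * 2 by rewrite mulr_ge0.
rewrite -[leRHS](congr1 (fun F => F x0) (posopZ posPsi M20 nw)).
apply: (posop_le posPsi).
- exact: nonneg_measurable_gap.
- apply: (nonneg_measurableZ _ _ nw) => //; exact: measurable_cst.
move=> x; rewrite /kernel_gap -EFinM lee_fin [leRHS]mulrC ler_wpM2l ?(ltW (weight_gt0 w x))//.
have int := bounded_measurable_section x bg mh h2.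
rewrite (le_trans (le_normr_Rintegral _ int))//.
apply: (@le_trans _ _ (\int[nu]_z (cst (M * 2) z))).
  apply: le_Rintegral => //.
  - exact: integrable_norm.
  - by apply: (@bounded_integrable _ (M * 2)) => // z; rewrite ger0_norm.
  - by move=> z _; rewrite normrM ler_pM.
by rewrite Rintegral_cst// [X in fine X](probability_setT nu) mulr1.
Qed.

(** For a rectangle the integral operator has rank one: its values depend on [f] only through the
    integral of [f] over [B], a number of [[-1, 1]] that is rounded to give the label. *)
Lemma label_small_rectangle (A B : set E) e : measurable A -> measurable B -> 0 < e ->
  label_small (\1_(A `*` B)) e.
Proof.
move=> mA mB e0; pose dl := e / (K + 1).
have d0 : 0 < dl by rewrite divr_gt0// ltr_wpDl.
have [I [phi ph]] := interval_labels (ler01 : 0 <= 1 :> R) d0.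
exists I, (fun f => phi (\int[nu]_z (\1_B z * f z))) => f f' uf uf' ff'.
have mAB : measurable (A `*` B) by exact: measurableX.
have [mh h2] := gap_function uf uf'.
have mBf g : unit_function g -> nu.-integrable setT (EFin \o (fun z => \1_B z * g z)) /\
    `|\int[nu]_z (\1_B z * g z)| <= 1.
  move=> [mg g1].
  have bBg z : `|\1_B z * g z| <= 1.
    rewrite normrM indicE; case: (_ \in _); first by rewrite normr1 mul1r.
    by rewrite normr0 mul0r.
  have int : nu.-integrable setT (EFin \o (fun z => \1_B z * g z)).
    by apply: (@bounded_integrable _ 1) => //; apply: measurable_funM => //; exact: measurable_indic.
  split => //; rewrite (le_trans (le_normr_Rintegral _ int))//.
  apply: (@le_trans _ _ (\int[nu]_z (cst 1 z))).
    apply: le_Rintegral => //; first exact: integrable_norm.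
    by apply: (@bounded_integrable _ 1) => // z; rewrite ger0_norm.
  by rewrite Rintegral_cst// [X in fine X](probability_setT nu) mulr1.
have [if_ f1] := mBf f uf; have [if' f1'] := mBf f' uf'.
have le_d := ph _ _ f1 f1' ff'.
apply: (@le_trans _ _ (dl%:E * Psi (EFin \o w) x0)%E); last first.
  apply: (@le_trans _ _ (dl%:E * K%:E)%E).
    by rewrite lee_wpmul2l// lee_fin ltW.
  rewrite -EFinM lee_fin /dl -mulrA ler_piMr ?(ltW e0)// mulrC ler_pdivrMr ?mul1r ?lerDl//.
  by rewrite ltr_wpDl.
have nw := nonneg_measurable_weight.
rewrite -[leRHS](congr1 (fun F => F x0) (posopZ posPsi (ltW d0) nw)).
apply: (posop_le posPsi).
- by apply: nonneg_measurable_gap => //; exact: bounded_measurable_indic.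
- by apply: (nonneg_measurableZ _ _ nw) => [|_]; [exact: measurable_cst|exact: ltW].
move=> x; rewrite /kernel_gap -EFinM lee_fin [leRHS]mulrC ler_wpM2l ?(ltW (weight_gt0 w x))//.
have -> : \int[nu]_z (\1_(A `*` B) (x, z) * (f z - f' z)) =
    \1_A x * (\int[nu]_z (\1_B z * f z) - \int[nu]_z (\1_B z * f' z)).
  rewrite -RintegralB// -RintegralZl//; last first.
    by have := integrableB measurableT if_ if'.
  apply: eq_Rintegral => z _; rewrite -mulrBr mulrA; congr (_ * _).
  by rewrite !indicE in_setX; case: (_ \in _); case: (_ \in _); rewrite ?mul1r ?mul0r.
rewrite normrM; apply: le_trans le_d; rewrite ler_piMl//.
by rewrite indicE ger0_norm ?ler0n// lern1 leq_b1.
Qed.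

Lemma label_small_mono g e e' : label_small g e -> e <= e' -> label_small g e'.
Proof.
move=> [I [phi ph]] ee; exists I, phi => f f' uf uf' /(ph _ _ uf uf') H.
by rewrite (le_trans H)// lee_fin.
Qed.

Lemma label_small_scale c g : bounded_measurable g ->
  (forall e, 0 < e -> label_small g e) ->
  forall e, 0 < e -> label_small (fun z => c * g z) e.
Proof.
move=> bg sg e e0; have c1 : 0 < `|c| + 1 by rewrite ltr_wpDl.
apply: (@label_small_mono _ (`|c| * (e / (`|c| + 1)))).
  by apply: label_smallZ => //; apply: sg; rewrite divr_gt0.
by rewrite mulrA ler_pdivrMr// mulrC ler_pM2l// lerDl.
Qed.

Lemma indic_setU_disjoint (A B : set (E * E)) : A `&` B = set0 ->
  \1_(A `|` B) = (fun z => \1_A z + \1_B z) :> (E * E -> R).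
Proof.
move=> AB; apply/funext => z; rewrite !indicE in_setU -natrD.
case: (boolP (z \in A)) => [/set_mem Az|_]; last by [].
by rewrite memNset// => Bz; have : (A `&` B) z by []; rewrite AB.
Qed.

(* Countable additivity of [Psi] makes the tail of a disjoint union small. *)
Lemma label_small_bigcup (F : (set (E * E))^nat) : (forall n, measurable (F n)) ->
  trivIset setT F -> (forall n e, 0 < e -> label_small (\1_(F n)) e) ->
  forall e, 0 < e -> label_small (\1_(\bigcup_n F n)) e.
Proof.
move=> mF tF sF e e0.
pose g n x : \bar R := ((w x)%:E * \int[nu]_z (\1_(F n) (x, z))%:E)%E.
have w0 x : 0 <= w x by rewrite ltW// weight_gt0.
have mU : measurable (\bigcup_n F n) by exact: bigcupT_measurable.
have nind (S : set (E * E)) : measurable S ->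
    nonneg_measurable (fun x => \int[nu]_z (\1_S (x, z))%:E)%E.
  move=> mS; split; last by move=> x; apply: integral_ge0 => z _; rewrite lee_fin.
  apply: (measurable_fun_integral_sfinite_kernel (fun z => (\1_S z)%:E) (constant_kernel nu)).
    by move=> z; rewrite lee_fin.
  by apply/measurable_EFinP; exact: measurable_indic.
have ng n : nonneg_measurable (g n).
  by apply: nonneg_measurableZ => //; [exact: weight_measurable|exact: nind].
have msec (S : set (E * E)) x : measurable S -> measurable_fun setT (fun z => (\1_S (x, z))%:E : \bar R).
  by move=> mS; apply/measurable_EFinP; apply: (measurableT_comp (measurable_indic mS)).
have tail n (S := \bigcup_k F (k + n)%N) x :
    ((w x)%:E * \int[nu]_z (\1_S (x, z))%:E = \sum_(k <oo) g (k + n)%N x)%E.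
  have tS : trivIset setT (fun k => F (k + n)%N).
    move=> i j _ _ ij; have := tF (i + n)%N (j + n)%N Logic.I Logic.I ij.
    by move=> /eqP; rewrite eqn_add2r => /eqP.
  rewrite /g nneseriesZl; last by move=> k _; apply: integral_ge0 => z _; rewrite lee_fin.
  congr (_ * _)%E; rewrite -integral_nneseries//.
    apply: eq_integral => z _.
    transitivity (\d_(x, z) S : \bar R)%E; first by rewrite diracE indicE.
    rewrite /S measure_semi_bigcup//; last exact: bigcupT_measurable.
  by move=> k; exact: msec.
(* Disjointness bounds the sum of the [g k] by [w], so [PsiK] makes the series of the [Psi (g k) x0]
   converge. *)
have sumK : (\sum_(k <oo) Psi (g k) x0 <= K%:E)%E.
  rewrite -[leLHS](congr1 (fun G => G x0) (posop_series posPsi ng)).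
  apply: le_trans PsiK; apply: (posop_le posPsi).
  - exact: nonneg_measurable_series.
  - exact: nonneg_measurable_weight.
  move=> x; have := tail 0%N x.
  under eq_eseriesr do rewrite addn0.
  move=> <-; rewrite /= -[leRHS]mule1 lee_wpmul2l ?lee_fin//.
  apply: (@le_trans _ _ (\int[nu]_z (cst 1%:E z))%E).
    apply: ge0_le_integral => //.
    - by apply: msec; under eq_bigcupr do rewrite addn0.
    - by move=> z _; rewrite lee_fin indicE lern1 leq_b1.
  by rewrite integral_cst// [X in (_ * X)%E](probability_setT nu) mule1.
have Psig0 k : (0 <= Psi (g k) x0)%E by case: (posop_measurable posPsi (ng k)).
(* [f - f'] is bounded by 2, so a tail of mass [e / 4] contributes at most [e / 2]. *)
have [n nP] : exists n, (\sum_(n <= k <oo) Psi (g k) x0 <= (e / 4)%:E)%E.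
  have : (\sum_(N <= k <oo) Psi (g k) x0 @[N --> \oo] --> 0)%E.
    by apply: nneseries_tail_cvg => //; exact: le_lt_trans sumK (ltry _).
  move=> /(_ [set y | (y < (e / 4)%:E)%E])[|N _ NP].
    by apply: open_ereal_lt'; rewrite lte_fin divr_gt0.
  by exists N; apply/ltW/NP => /=.
pose S := \bigcup_k F (k + n)%N.
have mS : measurable S by exact: bigcupT_measurable.
have e2 : 0 < e / 2 by rewrite divr_gt0.
pose B m := \big[setU/set0]_(k < m) F k.
have BF m k : (m <= k)%N -> B m `&` F k = set0.
  by apply: (@trivIset_bigsetUI _ predT) => // i j _ _; exact: tF.
have mB m : measurable (B m) by exact: bigsetU_measurable.
have sB m e' : 0 < e' -> label_small (\1_(B m)) e'.
  elim: m e' => [|m IH] e' e'0.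
    rewrite /B big_ord0 indic0; apply: (@label_small_mono _ (0 * 2 * K)).
      by apply: label_small_trivial => [|//|z]; [split=> //; exists 0 => // z|]; rewrite normr0.
    by rewrite !mul0r ltW.
  have e'2 : 0 < e' / 2 by rewrite divr_gt0.
  rewrite /B big_ord_recr /= indic_setU_disjoint; last exact: BF.
  by rewrite (splitr e'); apply: label_smallD; [exact: bounded_measurable_indic (mB m)|
    exact: bounded_measurable_indic|exact: IH|exact: sF].
rewrite (bigcup_splitn n) (_ : \bigcup_i F (n + i)%N = S); last first.
  by apply: eq_bigcupr => k _; rewrite addnC.
rewrite indic_setU_disjoint; last first.
  rewrite setI_bigcupr bigcup0// => k _; apply: BF; exact: leq_addl.
rewrite (splitr e); apply: label_smallD; [exact: bounded_measurable_indic (mB n)|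
  exact: bounded_measurable_indic|exact: sB|].
exists unit, (fun=> tt) => f f' uf uf' _.
have [mh h2] := gap_function uf uf'.
have nS := nonneg_measurableZ (@weight_measurable _ _ _ w) w0 (nind _ mS).
apply: (@le_trans _ _ (2%:E * Psi (fun x => (w x)%:E * \int[nu]_z (\1_S (x, z))%:E) x0)%E).
  rewrite -[leRHS](congr1 (fun G => G x0) (posopZ posPsi (ler0n R 2) nS)).
  apply: (posop_le posPsi).
  - by apply: nonneg_measurable_gap => //; exact: bounded_measurable_indic.
  - apply: (nonneg_measurableZ _ _ nS) => //; exact: measurable_cst.
  move=> x; rewrite /kernel_gap EFinM muleCA lee_wpmul2l ?lee_fin//.
  have int := bounded_measurable_section x (bounded_measurable_indic mS) mh h2.
  rewrite EFin_normr_Rintegral//.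
  apply: le_trans (le_abse_integral _ _ _) _ => //; first by case/integrableP: int.
  rewrite -ge0_integralZl_EFin//.
  - apply: ge0_le_integral => //=.
    + by case/integrableP: int => /measurable_EFinP mi _; apply/measurable_EFinP/measurableT_comp.
    + apply: emeasurable_funM => //; exact: msec.
    + move=> z _; rewrite lee_fin normrM [leRHS]mulrC ger0_norm// ler_wpM2l//.
  - exact: msec.
rewrite (_ : (fun x => _) = (fun x => \sum_(k <oo) g (k + n)%N x)%E); last first.
  by apply/funext => x; rewrite -tail.
rewrite [X in (_ * X)%E](congr1 (fun G => G x0) (posop_series posPsi (fun k => ng (k + n)%N))).
apply: (@le_trans _ _ (2%:E * (e / 4)%:E)%E); last by rewrite -EFinM lee_fin; lra.
rewrite lee_wpmul2l//; move: nP.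
by rewrite -nneseries_addn.
Qed.

(** Dynkin's theorem: rectangles are stable under intersection, a complement is a difference of
    indicators, and disjoint unions are [label_small_bigcup]. *)
Lemma label_small_set (S : set (E * E)) e : measurable S -> 0 < e -> label_small (\1_S) e.
Proof.
move=> mS; move: e; have := mS.
rewrite measurable_prod_measurableType.
move: S {mS}; apply: (@dynkin_induction _ (E * E)%type
  [set A `*` B | A in measurable & B in measurable]
  (fun S => forall e, 0 < e -> label_small (\1_S) e)).
- exact: measurable_prod_measurableType.
- move=> _ _ [A1 mA1 [B1 mB1 <-]] [A2 mA2 [B2 mB2 <-]].
  exists (A1 `&` A2); first exact: measurableI.
  exists (B1 `&` B2); first exact: measurableI.
  by rewrite setXI.
- by move=> e e0; rewrite -setXTT; exact: label_small_rectangle.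
- by move=> _ [A mA [B mB <-]] e e0; exact: label_small_rectangle.
- move=> S mS sS e e0; have e2 : 0 < e / 2 by rewrite divr_gt0.
  have -> : \1_(~` S) = (fun z => \1_([set: E] `*` [set: E]) z + -1 * \1_S z) :> (E * E -> R).
    apply/funext => z; rewrite !indicE setXTT in_setT in_setC.
    by case: (z \in S); rewrite /= ?mulr1 ?subrr ?mulr0 ?addr0.
  rewrite (splitr e); apply: label_smallD.
  + by apply: bounded_measurable_indic; exact: measurableX.
  + by apply: bounded_measurableZ; exact: bounded_measurable_indic.
  + exact: label_small_rectangle.
  + by apply: label_small_scale => //; exact: bounded_measurable_indic.
- by move=> F mF tF sF e e0; exact: label_small_bigcup.
Qed.

(* Each step halves the bound by subtracting [M / 2] times the sign of [g]. *)
Lemma label_small_dyadic n (g : E * E -> R) M e : measurable_fun setT g ->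
  0 <= M -> (forall z, `|g z| <= M) -> 0 < e -> label_small g (e + M * 2 * K * (1 / 2) ^+ n).
Proof.
elim: n g M e => [|n IH] g M e mg M0 gM e0.
  apply: (@label_small_mono _ (M * 2 * K)); last by rewrite expr0 mulr1 lerDr ltW.
  by apply: label_small_trivial => //; split=> //; exists M.
pose S := [set z | 0 <= g z].
have mS : measurable S.
  have := measurable_fun_ler (@measurable_cst _ _ (E * E)%type R setT 0) mg.
  move=> /(_ measurableT [set true]) /=; rewrite setTI.
  by move=> /(_ Logic.I); congr measurable; apply/seteqP; split.
pose T : set (E * E) := [set: E] `*` [set: E].
have mT : measurable T by exact: measurableX.
have bS := bounded_measurable_indic mS; have bT := bounded_measurable_indic mT.
pose s z : R := M * \1_S z + - (M / 2) * \1_T z.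
have bs : bounded_measurable s by apply: bounded_measurableD; exact: bounded_measurableZ.
have sgM z : `|g z - s z| <= M / 2.
  have := gM z; rewrite !ler_norml /s /T !indicE setXTT in_setT => /andP[? ?].
  case: (boolP (z \in S)) => [/set_mem|/negP zS] /=.
    by rewrite /S /= => ?; apply/andP; split; lra.
  have /negP : ~ (0 <= g z) by move=> ?; apply: zS; exact/mem_set.
  by rewrite -ltNge => ?; apply/andP; split; lra.
have b1 : bounded_measurable (fun z => g z - s z).
  by split; [apply: measurable_funB => //; case: bs|exists (M / 2); rewrite // divr_ge0].
have [e2 e4] : 0 < e / 2 /\ 0 < e / 2 / 2 by rewrite !divr_gt0.
have -> : g = (fun z => (g z - s z) + s z) by apply/funext => z; rewrite subrK.
have -> : e + M * 2 * K * (1 / 2) ^+ n.+1 =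
    (e / 2 + M / 2 * 2 * K * (1 / 2) ^+ n) + (e / 2 / 2 + e / 2 / 2).
  by rewrite exprS; field.
apply: label_smallD => //; first by apply: IH => //; [case: b1|rewrite divr_ge0].
by apply: label_smallD; [exact: bounded_measurableZ|exact: bounded_measurableZ| |];
  apply: label_small_scale => // e' e'0; exact: label_small_set.
Qed.

Lemma label_small_bounded (g : E * E -> R) e : bounded_measurable g -> 0 < e -> label_small g e.
Proof.
move=> [mg [M M0 gM]] e0; have e2 : 0 < e / 2 by rewrite divr_gt0.
have h1 : 0 < 1 / 2 :> R by lra.
have h2 : 1 / 2 < 1 :> R by lra.
have K20 : 0 <= M * 2 * K by rewrite !mulr_ge0.
have [n nP] := affine_geometric_small K20 (lexx 0) h1 h2 e2.
apply: (@label_small_mono _ (e / 2 + M * 2 * K * (1 / 2) ^+ n)).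
  exact: label_small_dyadic.
by move: nP; rewrite mul0r addr0; lra.
Qed.

End function_labels.

Section compact_products.
Context {R : realType} {d : measure_display} {E : measurableType d}.
Variables (w : weight R E) (nu : probability E R) (x0 : E).

(* [Psi] carries the bounds on [Y] that survive integration against [nu]. *)
Definition dominated (Y : Bw w -> Bw w) : Prop :=
  exists Psi (c : R), [/\ positive_operator Psi, 0 <= c,
    forall x, (Psi (EFin \o w) x <= (c * w x)%:E)%E &
    forall f x, ((normc (Y f x))%:E <= Psi (fun y => (normc (f y))%:E) x)%E].

Lemma nonneg_measurable_normc (f : Bw w) : nonneg_measurable (fun y => (normc (f y))%:E).
Proof.
split; last by move=> x; rewrite lee_fin normc_ge0.
by apply/measurable_EFinP/measurable_normc/Bw_cmeasurable.
Qed.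

Lemma dominated_id : dominated id.
Proof.
by exists id, 1; split => // x; rewrite mul1r.
Qed.

Lemma dominated_comp Y1 Y2 : dominated Y1 -> dominated Y2 -> dominated (Y1 \o Y2).
Proof.
move=> [P1 [c1 [p1 c10 P1w Y1P]]] [P2 [c2 [p2 c20 P2w Y2P]]].
have nw := nonneg_measurable_weight w.
exists (P1 \o P2), (c2 * c1); split; [exact: positive_operator_comp|exact: mulr_ge0| |].
  move=> x /=; rewrite -mulrA EFinM.
  apply: (@le_trans _ _ (c2%:E * P1 (EFin \o w) x)%E); last by rewrite lee_wpmul2l ?lee_fin.
  rewrite -[leRHS](congr1 (fun F => F x) (posopZ p1 c20 nw)).
  apply: (posop_le p1); first exact: posop_measurable.
    by apply: (nonneg_measurableZ _ _ nw) => //; exact: measurable_cst.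
  by move=> y; rewrite -EFinM; exact: P2w.
move=> f x /=; apply: le_trans (Y1P _ _) _; apply: (posop_le p1).
- exact: nonneg_measurable_normc.
- exact/posop_measurable/nonneg_measurable_normc.
- by move=> y; exact: Y2P.
Qed.

Lemma dominated_iter Y n : dominated Y -> dominated (iter n Y).
Proof.
move=> dY; elim: n => [|n IH]; first exact: dominated_id.
exact: (dominated_comp dY IH).
Qed.

Lemma measurable_inv_weight : measurable_fun [set: E] (fun x => (w x)^-1).
Proof.
apply: (eq_measurable_fun (fun x => w x `^ (-1))).
  by move=> x _; rewrite powR_inv1// ltW// weight_gt0.
exact: (measurableT_comp (measurable_powR _) (@weight_measurable _ _ _ w)).
Qed.

Lemma unit_function_div (a : E -> R) (u : Bw w) : measurable_fun setT a ->
  (forall z, `|a z| <= normc (u z)) -> nrm u <= 1 -> unit_function (fun z => a z / w z).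
Proof.
move=> ma au u1; split; first by apply: measurable_funM => //; exact: measurable_inv_weight.
move=> z; rewrite normrM normfV [X in _ / X]gtr0_norm ?weight_gt0//.
rewrite ler_pdivrMr ?weight_gt0// (le_trans (au z))//.
by rewrite (le_trans (Bw_pointwise u z))// ler_wpM2r// ltW// weight_gt0.
Qed.

Lemma unit_function_Re (u : Bw w) : nrm u <= 1 ->
  unit_function (fun z => complex.Re (u z) / w z).
Proof.
by apply: unit_function_div => [|z]; [case: (Bw_cmeasurable u)|exact: ler_Re_normc].
Qed.

Lemma unit_function_Im (u : Bw w) : nrm u <= 1 ->
  unit_function (fun z => complex.Im (u z) / w z).
Proof.
by apply: unit_function_div => [|z]; [case: (Bw_cmeasurable u)|exact: ler_Im_normc].
Qed.

Definition weight_bounded (beta : E * E -> R[i]) (m : R) : Prop :=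
  forall x y, w y * normc (beta (x, y)) <= m * w x.

Lemma kernel_bound_constant beta m : cmeasurable beta -> weight_bounded beta m ->
  kernel_bound w (constant_kernel nu) beta m.
Proof.
move=> mb bm x.
apply: (@le_trans _ _ (\int[nu]_y (cst (m * w x)%:E y))%E).
  apply: ge0_le_integral => //.
  - by move=> y _; rewrite lee_fin mulr_ge0 ?normc_ge0// ltW// weight_gt0.
  - apply/measurable_EFinP/measurable_funM; first exact: weight_measurable.
    exact/measurable_normc/cmeasurable_section.
  - by move=> y _; rewrite lee_fin.
by rewrite integral_cst// [X in (_ * X)%E](probability_setT nu) mule1.
Qed.

(** Conjugating by [w] makes both the kernel and the functions bounded real ones; the four products
    of real and imaginary parts give the four gaps. *)
Lemma normc_gap_le (beta : E * E -> R[i]) m (u v : Bw w) x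
  (b1 := fun z : E * E => w z.2 * complex.Re (beta z) / w z.1)
  (b2 := fun z : E * E => w z.2 * complex.Im (beta z) / w z.1)
  (f1 := fun u : Bw w => fun z => complex.Re (u z) / w z)
  (f2 := fun u : Bw w => fun z => complex.Im (u z) / w z) :
  cmeasurable beta -> weight_bounded beta m -> nrm u <= 1 -> nrm v <= 1 ->
  bounded_measurable b1 -> bounded_measurable b2 ->
  ((normc (kernel_op_chi (constant_kernel nu) beta (u - v : Bw w)%R x))%:E <=
    (kernel_gap w nu b1 (fun z => f1 u z - f1 v z)%R x +
     kernel_gap w nu b2 (fun z => f2 u z - f2 v z)%R x) +
    (kernel_gap w nu b1 (fun z => f2 u z - f2 v z)%R x +
     kernel_gap w nu b2 (fun z => f1 u z - f1 v z)%R x))%E.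
Proof.
move=> mb bm u1 v1 bb1 bb2.
have [mh1 h1] := gap_function (unit_function_Re u1) (unit_function_Re v1).
have [mh2 h2] := gap_function (unit_function_Im u1) (unit_function_Im v1).
have wn0 y : w y != 0 by rewrite gt_eqF// weight_gt0.
have i11 := bounded_measurable_section nu x bb1 mh1 h1.
have i12 := bounded_measurable_section nu x bb1 mh2 h2.
have i21 := bounded_measurable_section nu x bb2 mh1 h1.
have i22 := bounded_measurable_section nu x bb2 mh2 h2.
rewrite -!EFinD lee_fin (le_trans (normc_le_ReIm _))// /kernel_op_chi /cintegral /=.
have w0 : 0 <= w x by rewrite ltW// weight_gt0.
have eqB (a b c p q r s t : R) : a != 0 -> b != 0 ->
    (p - q) * r - (s - t) * c = a * (b * r / a * (p / b - q / b) - b * c / a * (s / b - t / b)).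
  by move=> ? ?; field; apply/andP.
have eqD (a b c p q r s t : R) : a != 0 -> b != 0 ->
    (p - q) * c + (s - t) * r = a * (b * r / a * (s / b - t / b) + b * c / a * (p / b - q / b)).
  by move=> ? ?; field; apply/andP.
apply: lerD.
  have -> : \int[nu]_y complex.Re ((u - v : Bw w) y * beta (x, y)) =
      w x * (\int[nu]_z (b1 (x, z) * (f1 u z - f1 v z)) -
             \int[nu]_z (b2 (x, z) * (f2 u z - f2 v z))).
    rewrite -RintegralB// -RintegralZl//; last by have := integrableB measurableT i11 i22.
    apply: eq_Rintegral => y _; rewrite /b1 /b2 /f1 /f2 /=.
    rewrite -eqB//.
    rewrite [X in complex.Re (X * _)](_ : _ = u y - v y :> R[i])//.
    by case: (u y) (v y) (beta (x, y)) => [? ?] [? ?] [? ?].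
  rewrite normrM ger0_norm// -mulrDr ler_wpM2l//.
  exact: ler_normB.
have -> : \int[nu]_y complex.Im ((u - v : Bw w) y * beta (x, y)) =
    w x * (\int[nu]_z (b1 (x, z) * (f2 u z - f2 v z)) +
           \int[nu]_z (b2 (x, z) * (f1 u z - f1 v z))).
  rewrite -RintegralD// -RintegralZl//; last by have := integrableD measurableT i12 i21.
  apply: eq_Rintegral => y _; rewrite /b1 /b2 /f1 /f2 /=.
  rewrite -eqD//.
  rewrite [X in complex.Im (X * _)](_ : _ = u y - v y :> R[i])//.
  by case: (u y) (v y) (beta (x, y)) => [? ?] [? ?] [? ?].
rewrite normrM ger0_norm// -mulrDr ler_wpM2l//.
exact: ler_normD.
Qed.

(** [T1 (Y h)] is bounded at [x] by [m1 * w x] times the [nu]-average of [normc (Y h) / w]. This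
    average is a positive operator applied to [normc h] and evaluated at one point, so with
    [h = T2 (u - v)] the labels make it small. *)
Theorem compact_kernel_product (T1 T2 Y : {linear Bw w -> Bw w}) beta1 beta2 m1 m2 :
  cmeasurable beta1 -> cmeasurable beta2 -> 0 <= m1 -> 0 <= m2 ->
  weight_bounded beta1 m1 -> weight_bounded beta2 m2 ->
  (forall f x, T1 f x = kernel_op_chi (constant_kernel nu) beta1 f x) ->
  (forall f x, T2 f x = kernel_op_chi (constant_kernel nu) beta2 f x) ->
  dominated Y -> compact_map (fun u => T1 (Y (T2 u))).
Proof.
move=> mb1 mb2 m10 m20 wb1 wb2 T1E T2E [Psi [c [pos c0 Psiw YPsi]]] e e0.
pose b1 (z : E * E) := w z.2 * complex.Re (beta2 z) / w z.1.
pose b2 (z : E * E) := w z.2 * complex.Im (beta2 z) / w z.1.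
have wgt0 := weight_gt0 w.
have mw2 : measurable_fun setT (fun z : E * E => w z.2).
  by apply: (measurableT_comp (@weight_measurable _ _ _ w)).
have mw1 : measurable_fun setT (fun z : E * E => (w z.1)^-1).
  by apply: (measurableT_comp measurable_inv_weight).
have bb (a : E * E -> R) : measurable_fun setT a -> (forall z, `|a z| <= normc (beta2 z)) ->
    bounded_measurable (fun z => w z.2 * a z / w z.1).
  move=> ma ale; split; first by apply: measurable_funM => //; exact: measurable_funM.
  exists m2 => // -[x y] /=; rewrite !normrM normfV [`|w y|]gtr0_norm// [`|w x|]gtr0_norm//.
  rewrite ler_pdivrMr//; apply: le_trans (wb2 x y).
  by rewrite ler_wpM2l// ltW.
have bb1 : bounded_measurable b1 by apply: bb => [|z]; [case: mb2|exact: ler_Re_normc].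
have bb2 : bounded_measurable b2 by apply: bb => [|z]; [case: mb2|exact: ler_Im_normc].
(* [avg g] is a constant function, so evaluation at [x0] is the [nu]-average. *)
pose avg (g : E -> \bar R) (_ : E) : \bar R := (\int[constant_kernel nu x0]_y g y)%E.
have pavg : positive_operator avg.
  exact: (positive_operator_kernel (constant_kernel nu)).
have winv0 x : 0 <= (w x)^-1 by rewrite invr_ge0 ltW.
pose Phi := avg \o ((fun g x => ((w x)^-1)%:E * g x)%E \o Psi).
have pPhi : positive_operator Phi.
  apply: positive_operator_comp pavg _; apply: positive_operator_comp pos.
  by apply: positive_operator_mul => //; exact: measurable_inv_weight.
have nw := nonneg_measurable_weight w.
have PhiK : (Phi (EFin \o w) x0 <= c%:E)%E.
  have -> : c%:E = avg (cst c%:E) x0.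
    by rewrite /avg integral_cst// [X in (_ * X)%E](probability_setT nu) mule1.
  apply: (posop_le pavg).
  - apply: (nonneg_measurableZ measurable_inv_weight) => //; exact: posop_measurable.
  - by split=> //; exact: measurable_cst.
  move=> x /=; apply: (@le_trans _ _ (((w x)^-1)%:E * (c * w x)%:E)%E).
    by rewrite lee_wpmul2l ?lee_fin.
  by rewrite -EFinM lee_fin mulrCA mulVf ?mulr1// gt_eqF.
(* Four gaps of size [dl] are summed and then multiplied by [m1]. *)
pose dl := e / (4 * (m1 + 1)).
have m11 : 0 < m1 + 1 by rewrite ltr_wpDl.
have dl0 : 0 < dl by rewrite divr_gt0// mulr_gt0.
have [I [phi phiP]] := label_small_bounded nu pPhi c0 PhiK bb1 dl0.
have [J [psi psiP]] := label_small_bounded nu pPhi c0 PhiK bb2 dl0.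
pose f1 (u : Bw w) z := complex.Re (u z) / w z.
pose f2 (u : Bw w) z := complex.Im (u z) / w z.
exists (I * I * (J * J))%type, (fun u => (phi (f1 u), phi (f2 u), (psi (f1 u), psi (f2 u)))).
move=> u v u1 v1 [e1 e2 e3 e4].
have uf1 := unit_function_Re u1; have uf2 := unit_function_Im u1.
have vf1 := unit_function_Re v1; have vf2 := unit_function_Im v1.
have [mh1 _] := gap_function uf1 vf1; have [mh2 _] := gap_function uf2 vf2.
have H11 := phiP _ _ uf1 vf1 e1; have H12 := phiP _ _ uf2 vf2 e2.
have H21 := psiP _ _ uf1 vf1 e3; have H22 := psiP _ _ uf2 vf2 e4.
have n11 := nonneg_measurable_gap w nu bb1 mh1; have n12 := nonneg_measurable_gap w nu bb1 mh2.
have n21 := nonneg_measurable_gap w nu bb2 mh1; have n22 := nonneg_measurable_gap w nu bb2 mh2.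
pose h := T2 (u - v).
have Phih : (Phi (fun y => (normc (h y))%:E) x0 <= (4 * dl)%:E)%E.
  have -> : (4 * dl)%:E = ((dl%:E + dl%:E) + (dl%:E + dl%:E))%E.
    by rewrite -!EFinD; congr (_%:E); ring.
  apply: le_trans (leeD (leeD H11 H22) (leeD H12 H21)).
  rewrite -[X in (_ <= X + _)%E](congr1 (fun F => F x0) (posopD pPhi n11 n22)).
  rewrite -[X in (_ <= _ + X)%E](congr1 (fun F => F x0) (posopD pPhi n12 n21)).
  have n1 := nonneg_measurableD n11 n22; have n2 := nonneg_measurableD n12 n21.
  rewrite -[leRHS](congr1 (fun F => F x0) (posopD pPhi n1 n2)).
  apply: (posop_le pPhi); [exact: nonneg_measurable_normc|exact: nonneg_measurableD|].
  by move=> x; rewrite /h T2E; exact: normc_gap_le mb2 wb2 u1 v1 bb1 bb2.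
rewrite -!linearB -/h; apply: Bw_norm_le; first exact: ltW.
move=> x; rewrite ler_pdivrMl//.
have -> : w x * e = m1 * w x * (4 * dl) + w x * (e / (m1 + 1)).
  by rewrite /dl; field; rewrite gt_eqF.
rewrite -[leLHS]addr0 lerD//; last by rewrite mulr_ge0 ?(ltW (wgt0 x))// divr_ge0 ?ltW.
rewrite T1E -lee_fin; apply: le_trans (normc_cintegral_le _) _.
  exact: (Bw_cintegrable _ x mb1 (kernel_bound_constant mb1 wb1)).
have nYh := nonneg_measurable_normc (Y h).
have mwx0 : 0 <= m1 * w x by rewrite mulr_ge0// ltW.
apply: (@le_trans _ _ ((m1 * w x)%:E * Phi (fun y => (normc (h y))%:E) x0)%E); last first.
  by rewrite [leRHS]EFinM lee_wpmul2l ?lee_fin.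
rewrite /Phi /= -[leRHS](congr1 (fun F => F x0) (posopZ pavg mwx0 _)); last first.
  apply: (nonneg_measurableZ measurable_inv_weight) => //.
  exact/posop_measurable/nonneg_measurable_normc.
apply: (posop_le pavg).
- split; last by move=> y; rewrite lee_fin normc_ge0.
  apply/measurable_EFinP/measurable_normc/cmeasurableM; first exact: Bw_cmeasurable.
  exact: cmeasurable_section.
- apply: (@nonneg_measurableZ _ _ _ (cst (m1 * w x))) => //.
  apply: (nonneg_measurableZ measurable_inv_weight) => //.
  exact/posop_measurable/nonneg_measurable_normc.
move=> y; apply: (@le_trans _ _ ((m1 * w x)%:E * (((w y)^-1)%:E * (normc (Y h y))%:E))%E).
  rewrite -!EFinM lee_fin normcM mulrCA mulrA mulrC ler_wpM2r ?normc_ge0//.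
  by rewrite ler_pdivlMl// wb1.
by rewrite lee_wpmul2l ?lee_fin// lee_wpmul2l ?lee_fin.
Qed.

End compact_products.

(** * Daniell functionals *)

Section daniell_functionals.
Context {R : realType} {d : measure_display} {T : measurableType d}.
Local Open Scope ereal_scope.
Implicit Types (g h : T -> \bar R) (Lam : (T -> \bar R) -> \bar R).

(** Covers mixtures of integrals and integrals along the chain alike, so that [daniell_eq] extends
    identities from indicators without first building the corresponding measures. *)
Record daniell Lam : Prop := Daniell {
  daniell_ge0 : forall g, nonneg_measurable g -> 0 <= Lam g ;
  daniellD : forall g h, nonneg_measurable g -> nonneg_measurable h ->
    Lam (fun x => g x + h x) = Lam g + Lam h ;
  daniellZ : forall (c : R) g, (0 <= c)%R -> nonneg_measurable g ->
    Lam (fun x => c%:E * g x) = c%:E * Lam g ;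
  daniell_series : forall g : nat -> T -> \bar R, (forall n, nonneg_measurable (g n)) ->
    Lam (fun x => \sum_(n <oo) g n x) = \sum_(n <oo) Lam (g n) }.

Lemma daniell_integral (mu : {measure set T -> \bar R}) : daniell (fun g => \int[mu]_x g x).
Proof.
split.
- by move=> g [mg g0]; exact: integral_ge0.
- by move=> g h [mg g0] [mh h0]; rewrite ge0_integralD.
- by move=> c g c0 [mg g0]; rewrite ge0_integralZl_EFin.
- move=> g mg; rewrite integral_nneseries//.
  + by move=> n; case: (mg n).
  + by move=> n y _; case: (mg n).
Qed.

Lemma daniell_add Lam1 Lam2 : daniell Lam1 -> daniell Lam2 ->
  daniell (fun g => Lam1 g + Lam2 g).
Proof.
move=> d1 d2; split.
- by move=> g ng; rewrite adde_ge0 ?(daniell_ge0 d1) ?(daniell_ge0 d2).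
- by move=> g h ng nh; rewrite (daniellD d1)// (daniellD d2)// addeACA.
- move=> c g c0 ng; rewrite (daniellZ d1)// (daniellZ d2)// ge0_muleDr//.
    exact: (daniell_ge0 d1).
  exact: (daniell_ge0 d2).
- move=> g ng; rewrite (daniell_series d1)// (daniell_series d2)// nneseriesD//.
    by move=> n _ _; exact: (daniell_ge0 d1).
  by move=> n _ _; exact: (daniell_ge0 d2).
Qed.

Import HBNNSimple.

Lemma nonneg_measurable_indic (A : set T) : measurable A ->
  nonneg_measurable (fun x => (\1_A x : R)%:E).
Proof.
move=> mA; split; last by move=> x; rewrite lee_fin.
by apply/measurable_EFinP; exact: measurable_indic.
Qed.

Lemma nonneg_measurable_cst (c : \bar R) : 0 <= c -> nonneg_measurable (fun _ : T => c).
Proof. by move=> c0; split => //; exact: measurable_cst. Qed.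

Lemma daniell_cst0 Lam : daniell Lam -> Lam (fun=> 0) = 0.
Proof.
move=> dL; have H := daniellZ dL (lexx 0%R) (nonneg_measurable_cst (lexx 0)).
rewrite -[RHS](mul0e (Lam (fun=> 0))) -H; congr Lam.
by apply/funext => x; rewrite mul0e.
Qed.

Lemma daniell_eq Lam1 Lam2 : daniell Lam1 -> daniell Lam2 ->
  (forall A, measurable A -> Lam1 (fun x => (\1_A x)%:E) = Lam2 (fun x => (\1_A x)%:E)) ->
  forall g, nonneg_measurable g -> Lam1 g = Lam2 g.
Proof.
move=> d1 d2 L12 g [mg g0].
have simple (f : {nnsfun T >-> R}) : Lam1 (EFin \o f) = Lam2 (EFin \o f).
  have [n [r [A [r0 mA fE]]]] : exists n (r : nat -> R) (A : nat -> set T),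
     [/\ forall i, (0 <= r i)%R, forall i, measurable (A i) &
       forall x, f x = (\sum_(i < n) r i * \1_(A i) x)%R].
    pose v i := nth 0%R (finmap.enum_fset (fset_set (range f))) i.
    (* The maximum makes coefficients nonnegative by construction and changes nothing on a nonempty
       level set. *)
    eexists; exists (fun i => Num.max (v i) 0%R), (fun i => f @^-1` [set v i]); split.
    - by move=> i; rewrite le_max lexx orbT.
    - by move=> i; exact: measurable_funPTI.
    move=> x; rewrite fimfunEord; apply: eq_bigr => i _; rewrite indicE.
    case: (boolP (x \in _)) => [/set_mem /= fx|_]; last by rewrite !mulr0.
    by rewrite /v -fx max_l.
  have nt i : nonneg_measurable (fun x => (r i)%:E * (\1_(A i) x)%:E).
    by apply: (nonneg_measurableZ _ _ (nonneg_measurable_indic (mA i))).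
  have nsum m : nonneg_measurable (fun x => \sum_(i < m) (r i)%:E * (\1_(A i) x)%:E).
    elim: m => [|m IH].
      under eq_fun do rewrite big_ord0.
      exact: nonneg_measurable_cst.
    under eq_fun do rewrite big_ord_recr.
    exact: nonneg_measurableD.
  have -> : EFin \o f = fun x => \sum_(i < n) (r i)%:E * (\1_(A i) x)%:E.
    by apply/funext => x /=; rewrite fE sumEFin.
  elim: n {fE} => [|n IH].
    under eq_fun do rewrite big_ord0.
    by rewrite !daniell_cst0.
  under eq_fun do rewrite big_ord_recr.
  have ni := nonneg_measurable_indic (mA n).
  by rewrite (daniellD d1)// (daniellD d2)// (daniellZ d1)// (daniellZ d2)// L12// IH.
pose f := nnsfun_approx measurableT mg.
(* Increments of the approximating sequence turn the increasing limit into a series, the form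
   accepted by [daniell_series]. *)
pose s k x : \bar R := if k is k'.+1 then (f k x - f k' x)%:E else (f 0%N x)%:E.
have fmono k x : (f k x <= f k.+1 x)%R by exact/lefP/nd_nnsfun_approx.
have ns k : nonneg_measurable (s k).
  case: k => [|k]; split.
  - by apply/measurable_EFinP; exact: measurable_funPT.
  - by move=> x; rewrite lee_fin.
  - by apply/measurable_EFinP/measurable_funB; exact: measurable_funPT.
  - by move=> x; rewrite lee_fin subr_ge0.
have sumE n x : \sum_(0 <= k < n.+1) s k x = (f n x)%:E.
  elim: n => [|n IH]; first by rewrite big_nat1.
  by rewrite big_nat_recr//= IH -EFinD addrC subrK.
have -> : g = fun x => \sum_(k <oo) s k x.
  apply/funext => x; apply/esym/cvg_lim => //.
  rewrite -cvg_shiftS /=; under eq_fun do rewrite sumE.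
  exact: cvg_nnsfun_approx.
rewrite (daniell_series d1)// (daniell_series d2)//.
apply: (congr1 (fun u => limn u)); apply/funext => -[|n]; first by rewrite !big_nil.
have nsum m : nonneg_measurable (fun x => \sum_(0 <= k < m) s k x).
  elim: m => [|m IH].
    under eq_fun do rewrite big_nil.
    exact: nonneg_measurable_cst.
  under eq_fun do rewrite big_nat_recr//=.
  exact: nonneg_measurableD.
have LsumE Lam m : daniell Lam -> \sum_(0 <= k < m) Lam (s k) = Lam (fun x => \sum_(0 <= k < m) s k x).
  move=> dL; elim: m => [|m IH].
    rewrite big_nil; under eq_fun do rewrite big_nil.
    by rewrite daniell_cst0.
  rewrite big_nat_recr//= IH -(daniellD dL)//.
  by congr Lam; apply/funext => x; rewrite big_nat_recr.
rewrite !LsumE//.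
have -> : (fun x => \sum_(0 <= k < n.+1) s k x) = EFin \o f n.
  by apply/funext => x; rewrite sumE.
exact: simple.
Qed.

End daniell_functionals.

Section densities.
Context {R : realType} {d : measure_display} {T : measurableType d}.
Local Open Scope ereal_scope.

Lemma daniell_mul (a : T -> R) Lam : measurable_fun [set: T] a -> (forall x, 0 <= a x)%R ->
  daniell Lam -> daniell (fun g : T -> \bar R => Lam (fun x => (a x)%:E * g x)).
Proof.
move=> ma a0 dL; have na g : nonneg_measurable g -> nonneg_measurable (fun x => (a x)%:E * g x).
  exact: nonneg_measurableZ.
split.
- by move=> g ng; apply: (daniell_ge0 dL); exact: na.
- move=> g h ng nh; rewrite -(daniellD dL); [|exact: na|exact: na].
  by congr Lam; apply/funext => x; rewrite ge0_muleDr//; [case: ng|case: nh].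
- move=> c g c0 ng; rewrite -(daniellZ dL)//; last exact: na.
  by congr Lam; apply/funext => x; rewrite muleCA.
- move=> g ng; rewrite -(daniell_series dL); last by move=> n; exact: na.
  by congr Lam; apply/funext => x; rewrite nneseriesZl// => n _; case: (ng n).
Qed.

Lemma integral_density (mu nu : {measure set T -> \bar R}) (a : T -> R) :
  measurable_fun [set: T] a -> (forall x, 0 <= a x)%R ->
  (forall A, measurable A -> mu A = \int[nu]_(x in A) (a x)%:E) ->
  forall g, nonneg_measurable g -> \int[mu]_x g x = \int[nu]_x ((a x)%:E * g x).
Proof.
move=> ma a0 muE; apply: daniell_eq.
- exact: daniell_integral.
- by apply: daniell_mul => //; exact: daniell_integral.
move=> A mA; rewrite integral_indic// setIT muE// integral_mkcond.
by apply: eq_integral => x _; rewrite epatch_indic.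
Qed.

End densities.

(** * Truncation of uniformly integrable densities *)

Section uniformly_integrable_kernels.
Context {R : realType} {d : measure_display} {E : measurableType d}.
Variables (w : weight R E) (nu : probability E R) (alpha : E * E -> R).
Hypothesis halpha : Hclass w nu alpha.
Variables (theta : E * E -> R[i]) (X : R).
Hypotheses (mtheta : cmeasurable theta) (X0 : 0 <= X) (thetaX : forall z, normc (theta z) <= X).

Let wgt0 := weight_gt0 w.

Definition density_kernel (z : E * E) : R[i] := theta z * (alpha z)%:C.

Definition tail_set (m : R) : set (E * E) := [set z | m <= conj_weight w alpha z.1 z.2].

Definition tail_kernel m (z : E * E) : R[i] := density_kernel z * (\1_(tail_set m) z)%:C.

Definition truncated_kernel m (z : E * E) : R[i] := density_kernel z * (\1_(~` tail_set m) z)%:C.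

Lemma measurable_conj_weight : measurable_fun setT (fun z : E * E => conj_weight w alpha z.1 z.2).
Proof.
have [ma _ _] := halpha.
apply: measurable_funM; last by apply: (measurableT_comp (@weight_measurable _ _ _ w)).
apply: measurable_funM.
  by apply: (measurableT_comp (measurable_inv_weight w)).
by apply: (eq_measurable_fun alpha) => // -[].
Qed.

Lemma measurable_tail_set m : measurable (tail_set m).
Proof.
have := measurable_fun_ler (@measurable_cst _ _ (E * E)%type R setT m) measurable_conj_weight.
move=> /(_ measurableT [set true]) /=; rewrite setTI.
by move=> /(_ Logic.I); congr measurable; apply/seteqP; split.
Qed.

Lemma cmeasurable_density : cmeasurable density_kernel.
Proof. by apply: cmeasurableM => //; apply: cmeasurable_real; case: halpha. Qed.

Lemma cmeasurable_tail m : cmeasurable (tail_kernel m).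
Proof.
apply: cmeasurableM; first exact: cmeasurable_density.
by apply: cmeasurable_real; apply: measurable_indic; exact: measurable_tail_set.
Qed.

Lemma cmeasurable_truncated m : cmeasurable (truncated_kernel m).
Proof.
apply: cmeasurableM; first exact: cmeasurable_density.
by apply: cmeasurable_real; apply: measurable_indic; apply: measurableC; exact: measurable_tail_set.
Qed.

Lemma truncated_tail m z : density_kernel z = truncated_kernel m z + tail_kernel m z.
Proof.
rewrite /truncated_kernel /tail_kernel -mulrDr -rmorphD /= !indicE in_setC.
by case: (z \in _); rewrite /= ?add0r ?addr0 mulr1.
Qed.

Lemma normc_density z : normc (density_kernel z) <= X * alpha z.
Proof.
have [_ a0 _] := halpha.
by rewrite /density_kernel normcM normc_real// ler_wpM2r.
Qed.

Lemma weight_alpha x y : w y * alpha (x, y) = w x * conj_weight w alpha x y.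
Proof. by rewrite /conj_weight !mulrA divff ?mul1r ?gt_eqF// mulrC. Qed.

Lemma conj_weight_ge0 x y : 0 <= conj_weight w alpha x y.
Proof.
have [_ a0 _] := halpha.
by rewrite /conj_weight mulr_ge0 ?(ltW (wgt0 y))// mulr_ge0// invr_ge0 ltW.
Qed.

Lemma weight_bounded_truncated m : 0 <= m -> weight_bounded w (truncated_kernel m) (X * m).
Proof.
move=> m0 x y; rewrite /truncated_kernel normcM normc_real; last by rewrite indicE ler0n.
rewrite indicE; case: (boolP ((x, y) \in _)) => [|_]; last first.
  by rewrite mulr0 mulr0 mulr_ge0 ?(ltW (wgt0 x))// mulr_ge0.
rewrite mulr1 => /set_mem /negP; rewrite -ltNge /= => am.
apply: (@le_trans _ _ (w y * (X * alpha (x, y)))).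
  by rewrite ler_wpM2l ?(ltW (wgt0 y))// normc_density.
rewrite mulrCA weight_alpha -mulrA ler_wpM2l// mulrC ler_wpM2r ?(ltW (wgt0 x))//.
exact: ltW.
Qed.

(** Uniform integrability in operator form: above the level [m] the conjugated density has mass at
    most [e / (X + 1)] for every [x], and the multiplier costs a factor [X]. *)
Lemma tail_small e : 0 < e -> exists2 m : R, 0 <= m &
  kernel_bound w (constant_kernel nu) (tail_kernel m) e.
Proof.
move=> e0; have [ma a0 tail0] := halpha.
have X1 : 0 < X + 1 by rewrite ltr_wpDl.
have [m [m0 mP]] : exists m, 0 <= m /\ (tail_mass w nu alpha m < (e / (X + 1))%:E)%E.
  have /tail0 [M [_ MP]] : nbhs 0%E [set y : \bar R | (y < (e / (X + 1))%:E)%E].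
    by apply: open_ereal_lt'; rewrite lte_fin divr_gt0.
  exists (`|M| + 1); split; first by rewrite addr_ge0.
  by apply: MP; rewrite ltr_pwDr// ler_norm.
exists m => // x.
have nonneg : nonneg_measurable (fun y => (conj_weight w alpha x y * \1_(tail_set m) (x, y))%:E).
  split; last first.
    by move=> y; rewrite lee_fin mulr_ge0 ?conj_weight_ge0.
  apply/measurable_EFinP/measurable_funM.
    by apply: (measurableT_comp measurable_conj_weight (pair1_measurable x)).
  by apply: (measurableT_comp (measurable_indic (measurable_tail_set m)) (pair1_measurable x)).
apply: (@le_trans _ _ ((X * w x)%:E * \int[nu]_y (conj_weight w alpha x y * \1_(tail_set m) (x, y))%:E)%E).
  have Xw : 0 <= X * w x by rewrite mulr_ge0// ltW.
  rewrite -ge0_integralZl_EFin//; [|by case: nonneg|by case: nonneg].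
  apply: ge0_le_integral => //.
  - by move=> y _; rewrite lee_fin mulr_ge0 ?normc_ge0// ltW.
  - apply/measurable_EFinP/measurable_funM; first exact: weight_measurable.
    by apply/measurable_normc/cmeasurable_section; exact: cmeasurable_tail.
  - by apply: emeasurable_funM => //; case: nonneg.
  move=> y _; rewrite -EFinM lee_fin /tail_kernel normcM normc_real; last by rewrite indicE ler0n.
  rewrite [leRHS]mulrA mulrA ler_wpM2r//.
  apply: (@le_trans _ _ (w y * (X * alpha (x, y)))).
    by rewrite ler_wpM2l ?(ltW (wgt0 y))// normc_density.
  by rewrite mulrCA weight_alpha mulrA.
apply: (@le_trans _ _ ((X * w x)%:E * (e / (X + 1))%:E)%E).
  rewrite lee_wpmul2l ?lee_fin ?mulr_ge0 ?(ltW (wgt0 x))//.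
  apply: le_trans (ltW mP); apply: le_trans (ereal_sup_ubound _); last by exists x.
  rewrite [leRHS]integral_mkcond; rewrite le_eqVlt; apply/orP; left; apply/eqP.
  apply: eq_integral => y _; rewrite patchE indicE.
  rewrite (_ : ((x, y) \in tail_set m) = (y \in [set y | m <= conj_weight w alpha x y])); last first.
    by apply/idP/idP => /set_mem H; apply/mem_set.
  by case: (_ \in _); rewrite ?mulr1 ?mulr0.
rewrite -EFinM lee_fin.
have -> : X * w x * (e / (X + 1)) = e * (X / (X + 1)) * w x by ring.
rewrite ler_wpM2r ?(ltW (wgt0 x))// ler_piMr ?(ltW e0)//.
by rewrite ler_pdivrMr// mul1r lerDl.
Qed.

Lemma kernel_bound_density : exists2 c : R, 0 <= c &
  kernel_bound w (constant_kernel nu) density_kernel c.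
Proof.
have [m m0 mP] := tail_small ltr01.
exists (X * m + 1); first by rewrite addr_ge0// mulr_ge0.
move=> x; have Xm := kernel_bound_constant nu (cmeasurable_truncated m) (weight_bounded_truncated m0) x.
have nn (beta : E * E -> R[i]) : cmeasurable beta ->
    nonneg_measurable (fun y => (w y * normc (beta (x, y)))%:E).
  move=> mb; split; last by move=> y; rewrite lee_fin mulr_ge0 ?normc_ge0// ltW.
  apply/measurable_EFinP/measurable_funM; first exact: weight_measurable.
  exact/measurable_normc/cmeasurable_section.
have [m1 n1] := nn _ (cmeasurable_truncated m).
have [m2 n2] := nn _ (cmeasurable_tail m).
rewrite mulrDl EFinD; apply: le_trans (leeD Xm (mP x)).
rewrite -ge0_integralD//; apply: ge0_le_integral => //.
- by case: (nn _ cmeasurable_density).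
- by case: (nn _ cmeasurable_density).
- exact: emeasurable_funD.
- move=> y _; rewrite -EFinD lee_fin -mulrDr ler_wpM2l ?(ltW (wgt0 y))//.
  by rewrite (truncated_tail m); exact: normcD.
Qed.

(** Truncated products are compact and compactness survives norm limits. With [T = Tm + Td], the
    error is [Td Y T + Tm Y Td]. *)
Lemma compact_density_product (x0 : E) (T Y : {linear Bw w -> Bw w}) :
  (forall f x, T f x = kernel_op_chi (constant_kernel nu) density_kernel f x) ->
  bounded_map Y -> dominated Y -> compact_map (fun u => T (Y (T u))).
Proof.
move=> TE [y y0 Yy] dY.
have mb := cmeasurable_density.
have [c c0 cP] := kernel_bound_density.
have Tc u : nrm (T u) <= c * nrm u.
  have [T' [T'E T'c]] := kernel_op_exists mb c0 cP.
  rewrite (_ : T u = T' u)//; apply: val_inj; apply/funext => x /=.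
  by rewrite TE T'E.
apply: compact_map_approx => e e0.
pose K := y * c + (c + 1) * y + 1.
have K0 : 0 < K by rewrite ltr_wpDl// addr_ge0 ?mulr_ge0 ?addr_ge0.
(* The cap 1 bounds [Tm] by [c + 1] whatever the level [m]; [K] collects the factors of the two
   error terms. *)
pose e1 := Num.min 1 (e / K).
have e10 : 0 < e1 by rewrite lt_min ltr01 divr_gt0.
have [m m0 mP] := tail_small e10.
have mt := cmeasurable_truncated m.
have Xm0 : 0 <= X * m by rewrite mulr_ge0.
have wb := weight_bounded_truncated m0.
have [Tm [TmE Tmb]] := kernel_op_exists mt Xm0 (kernel_bound_constant nu mt wb).
have [Td [TdE Tdb]] := kernel_op_exists (cmeasurable_tail m) (ltW e10) mP.
have TmTd u : T u - Tm u = Td u.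
  apply: val_inj; apply/funext => x.
  have : T u x = Tm u x + Td u x.
    rewrite TE TmE TdE /kernel_op_chi -[X in _ = X + _]mul1r -cintegral_linear.
    - by congr cintegral; apply/funext => z; rewrite mul1r (truncated_tail m) mulrDr.
    - exact: (Bw_cintegrable u x mt (kernel_bound_constant nu mt wb)).
    - exact: (Bw_cintegrable u x (cmeasurable_tail m) mP).
  move=> TmTd; have -> : val (T u - Tm u) x = T u x - Tm u x by [].
  by rewrite TmTd addrC addKr.
exists (fun u => Tm (Y (Tm u))); split; first exact: (compact_kernel_product x0 mt mt Xm0 Xm0 wb wb TmE TmE dY).
move=> u.
have -> : T (Y (T u)) - Tm (Y (Tm u)) = Td (Y (T u)) + Tm (Y (Td u)).
  by rewrite -!TmTd !linearB addrA subrK.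
have n0 := nrm_ge0 u.
have e11 : e1 <= 1 by rewrite ge_min lexx.
have e1e : e1 * K <= e by rewrite -ler_pdivlMr// ge_min lexx orbT.
have Tmc v : nrm (Tm v) <= (c + 1) * nrm v.
  have -> : Tm v = T v - Td v by rewrite -TmTd opprB addrC subrK.
  rewrite (le_trans (nrmD _ _))// nrmN mulrDl lerD// (le_trans (Tdb v))//.
  by rewrite ler_wpM2r ?nrm_ge0.
apply: (@le_trans _ _ (e1 * (y * (c * nrm u)) + (c + 1) * (y * (e1 * nrm u)))).
  rewrite (le_trans (nrmD _ _))// lerD//.
    rewrite (le_trans (Tdb _))// ler_wpM2l ?(ltW e10)// (le_trans (Yy _))// ler_wpM2l//.
  rewrite (le_trans (Tmc _))// ler_wpM2l ?addr_ge0// (le_trans (Yy _))// ler_wpM2l//.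
have -> : e1 * (y * (c * nrm u)) + (c + 1) * (y * (e1 * nrm u)) =
  e1 * (y * c + (c + 1) * y) * nrm u by ring.
rewrite ler_wpM2r// (le_trans _ e1e)// ler_wpM2l ?(ltW e10)//.
by rewrite /K lerDl.
Qed.

End uniformly_integrable_kernels.

(** * The residual kernel and the drift condition *)

Section residual_kernel.
Context {R : realType} {d : measure_display} {E : measurableType d}.
Local Open Scope ereal_scope.

Lemma measure_exists (f : set E -> \bar R) : f set0 = 0 ->
  (forall A, measurable A -> 0 <= f A) ->
  (forall F : (set E)^nat, (forall n, measurable (F n)) -> trivIset setT F ->
    (fun n => \sum_(0 <= i < n) f (F i)) @ \oo --> f (\bigcup_n F n)) ->
  exists mu : {measure set E -> \bar R}, forall A, measurable A -> mu A = f A.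
Proof.
(* A measure must be nonnegative on all sets, while [f] is controlled on measurable ones; it is set
   to 0 elsewhere. *)
move=> f0 fge0 fsig; pose g A := if `[< measurable A >] then f A else 0.
have gE A : measurable A -> g A = f A by move=> mA; rewrite /g asboolT.
have g0 : g set0 = 0 by rewrite gE.
have gge0 A : 0 <= g A by rewrite /g; case: asboolP => // mA; exact: fge0.
have gsig : semi_sigma_additive g.
  move=> F mF tF mU; rewrite gE//; apply: cvg_trans (fsig F mF tF).
  by apply: near_eq_cvg; apply: nearW => n; apply: eq_bigr => i _; rewrite gE.
pose mu : {measure set E -> \bar R} := HB.pack g (isMeasure.Build _ _ _ g g0 gge0 gsig).
by exists mu.
Qed.

Lemma probability_kernel_exists (m : E -> {measure set E -> \bar R}) :
  (forall A, measurable A -> measurable_fun [set: E] (fun x => m x A)) ->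
  (forall x, m x [set: E] = 1) ->
  exists Q : R.-pker E ~> E, forall x A, Q x A = m x A.
Proof.
move=> mm m1.
pose k : R.-ker E ~> E := HB.pack m (isKernel.Build _ _ _ _ _ m mm).
pose Q : R.-pker E ~> E := HB.pack m (isKernel.Build _ _ _ _ _ m mm)
  (Kernel_isProbability.Build _ _ _ _ _ k m1).
by exists Q.
Qed.

Lemma difference_measure_exists (mu kap : {measure set E -> \bar R}) (c : R) :
  (0 <= c < 1)%R -> mu setT = 1 -> kap setT = 1 ->
  (forall A, measurable A -> c%:E * kap A <= mu A) ->
  exists m : {measure set E -> \bar R}, forall A, measurable A ->
    m A = ((1 - c)^-1)%:E * (mu A - c%:E * kap A).
Proof.
move=> /andP[c0 c1] mu1 kap1 le_c.
have fin (p : {measure set E -> \bar R}) A : p setT = 1 -> measurable A -> p A \is a fin_num.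
  move=> p1 mA; rewrite ge0_fin_numE// (@le_lt_trans _ _ 1) ?ltry//.
  by rewrite -p1 le_measure ?inE.
have c10 : (0 <= (1 - c)^-1)%R by rewrite invr_ge0 subr_ge0 ltW.
apply: measure_exists.
- by rewrite !measure0 mule0 sube0 mule0.
- move=> A mA; rewrite mule_ge0 ?lee_fin// sube_ge0 ?le_c//.
  by rewrite fin_numM// fin.
move=> F mF tF.
have mU : measurable (\bigcup_n F n) by exact: bigcupT_measurable.
have -> : (fun n => \sum_(0 <= i < n) ((1 - c)^-1)%:E * (mu (F i) - c%:E * kap (F i))) =
  (fun n => ((1 - c)^-1)%:E * (\sum_(0 <= i < n) mu (F i) - c%:E * \sum_(0 <= i < n) kap (F i))).
  apply/funext => n; elim: n => [|n IH].
    by rewrite !big_nil mule0 sube0 mule0.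
  rewrite !big_nat_recr//= IH.
  have fm : mu (F n) \is a fin_num by exact: fin.
  have fk : kap (F n) \is a fin_num by exact: fin.
  have fsm : \sum_(0 <= i < n) mu (F i) \is a fin_num by apply/sum_fin_numP => i _ _; exact: fin.
  have fsk : \sum_(0 <= i < n) kap (F i) \is a fin_num by apply/sum_fin_numP => i _ _; exact: fin.
  move: fm fk fsm fsk.
  move: (mu (F n)) (kap (F n)) (\sum_(0 <= i < n) mu (F i)) (\sum_(0 <= i < n) kap (F i)).
  move=> [p||] [q||] [s||] [t||] //= _ _ _ _.
  by rewrite -!(EFinD, EFinB, EFinM); congr (_%:E); ring.
apply: cvgeZl => //.
apply: cvgeB; first by rewrite fin_num_adde_defr// fin.
  exact: measure_semi_sigma_additive.
by apply: cvgeZl => //; exact: measure_semi_sigma_additive.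
Qed.

Variables (P K : R.-pker E ~> E) (C : set E) (b : R).
Hypotheses (mC : measurable C) (hb : (0 < b <= 1)%R).
Hypothesis minor : forall x A, measurable A -> (b * \1_C x)%:E * K x A <= P x A.

Lemma residual_exists : exists P0 : R.-pker E ~> E, represents P0 (residual P b C (fun x A => K x A)).
Proof.
case/andP: hb => b0 b1.
have Cb x : (b < 1)%R \/ ~ C x -> (0 <= b * \1_C x < 1)%R.
  rewrite indicE; case: (boolP (x \in C)) => [/set_mem Cx [b1'|//]|_ _].
    by rewrite mulr1 ltW.
  by rewrite mulr0 lexx ltr01.
have /choice[m mP] : forall x, exists m : {measure set E -> \bar R}, forall A, measurable A ->
    m A = residual P b C (fun x A => K x A) x A.
  move=> x; have [h|h] := pselect ((b < 1)%R \/ ~ C x).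
    have [m mE] := difference_measure_exists (Cb x h) (prob_kernel x) (prob_kernel x) (minor x).
    by exists m => A mA; rewrite mE// /residual asboolT.
  by exists (\d_x) => A mA; rewrite /residual asboolF// diracE indicE.
have mm A : measurable A -> measurable_fun [set: E] (fun x => m x A).
  move=> mA; apply: (eq_measurable_fun (fun x =>
    if x \in C then (if (b < 1)%R then ((1 - b)^-1)%:E * (P x A - b%:E * K x A) else (\1_A x)%:E)
    else P x A)).
    move=> x _; rewrite mP// /residual [\1_C x]indicE.
    case: (boolP (x \in C)) => [/set_mem Cx|/negP nCx].
      case: (boolP (b < 1)%R) => [b1'|nb].
        by rewrite asboolT; [rewrite mulr1|left].
      by rewrite asboolF// => -[//|]; exact.
    rewrite asboolT; last by right => Cx; apply: nCx; exact/mem_set.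
    by rewrite mulr0 subr0 invr1 mul1e mul0e sube0.
  apply: measurable_fun_ifT.
  - apply: (@measurable_fun_bool _ _ _ _ true); rewrite setTI.
    by rewrite (_ : _ @^-1` _ = C)//; apply/seteqP; split=> x /= => [/set_mem|/mem_set].
  - case: (boolP (b < 1)%R) => _; last by apply/measurable_EFinP; exact: measurable_indic.
    apply: emeasurable_funM => //; apply: emeasurable_funB; first exact: measurable_kernel.
    by apply: emeasurable_funM => //; exact: measurable_kernel.
  - exact: measurable_kernel.
have [Q QE] : exists Q : R.-pker E ~> E, forall x A, Q x A = m x A.
  apply: probability_kernel_exists => // x; rewrite mP// /residual.
  case: asboolP => [h|_]; last by rewrite indicT.
  have /andP[h0 h1] := Cb x h.
  rewrite !prob_kernel mule1 -EFinB -EFinM mulVf// subr_eq0 eq_sym.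
  by rewrite lt_eqF.
by exists Q => x A mA; rewrite QE mP.
Qed.

End residual_kernel.

(** * Generating function of the hitting time *)

Section hitting_generating_function.
Context {R : realType} {d : measure_display} {E : measurableType d}.
Variables (P : R.-pker E ~> E) (C : set E).
Hypothesis mC : measurable C.
Local Open Scope ereal_scope.

Definition killed (g : E -> \bar R) (x : E) : \bar R := (\1_(~` C) x)%:E * \int[P x]_y g y.

(* [hit n x] is the probability that the chain started at [x] hits [C] first at time [n]. *)
Definition hit (n : nat) : E -> \bar R := iter n killed (fun x => (\1_C x)%:E).

(** Plays the part of the expectation of [r ^ sigma_C] from [x] before any chain is available;
    [expectation_expe] identifies the two for [r > 1]. *)
Definition hit_gf (r : R) (x : E) : \bar R := \sum_(n <oo) (r ^+ n)%:E * hit n x.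

Lemma positive_operator_killed : positive_operator killed.
Proof.
apply: (positive_operator_comp (Psi1 := fun g x => (\1_(~` C) x)%:E * g x)
  (Psi2 := fun g x => \int[P x]_y g y)); last exact: positive_operator_kernel.
by apply: positive_operator_mul => //; apply: measurable_indic; exact: measurableC.
Qed.

Lemma nonneg_measurable_hit n : nonneg_measurable (hit n).
Proof.
apply: posop_measurable; last exact: nonneg_measurable_indic.
exact/positive_operator_iter/positive_operator_killed.
Qed.

Lemma nonneg_measurable_hit_term r n : (0 <= r)%R ->
  nonneg_measurable (fun x => (r ^+ n)%:E * hit n x).
Proof.
move=> r0; apply: (nonneg_measurableZ _ _ (nonneg_measurable_hit n)); first exact: measurable_cst.
by move=> _; rewrite exprn_ge0.
Qed.

Lemma nonneg_measurable_hit_gf r : (0 <= r)%R -> nonneg_measurable (hit_gf r).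
Proof. by move=> r0; apply: nonneg_measurable_series => n; exact: nonneg_measurable_hit_term. Qed.

Lemma hit_gf_eq r x : (0 <= r)%R ->
  hit_gf r x = (\1_C x)%:E + r%:E * killed (hit_gf r) x.
Proof.
move=> r0; have nt := nonneg_measurable_hit_term _ r0.
have pk := positive_operator_killed.
rewrite {1}/hit_gf (nneseries_split 0 1)/=; last by move=> n _; case: (nt n).
rewrite add0n big_nat1 expr0 mul1e; congr (_ + _).
rewrite -[X in _ * X]/((killed (hit_gf r)) x) /hit_gf.
rewrite (posop_series pk); last by move=> n; exact: nt.
rewrite -nneseriesZl; last by move=> n _; case: (posop_measurable pk (nt n)).
rewrite -nneseries_addn; last by move=> n; case: (nt n).
apply: eq_eseriesr => n _; rewrite addn1 (posopZ pk)//; last exact: nonneg_measurable_hit.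
  by rewrite exprS EFinM -muleA.
exact: exprn_ge0.
Qed.

(** [hit_gf r] is the least nonnegative solution of the first-step equation [hit_gf_eq]: its partial
    sums are the iterates starting from 0, and stay below any supersolution [W]. *)
Lemma hit_gf_le r (W : E -> \bar R) : (0 <= r)%R -> nonneg_measurable W ->
  (forall x, (\1_C x)%:E + r%:E * killed W x <= W x) -> forall x, hit_gf r x <= W x.
Proof.
move=> r0 nW WW x; have nt := nonneg_measurable_hit_term _ r0.
have pk := positive_operator_killed.
pose S n x := \sum_(0 <= k < n) (r ^+ k)%:E * hit k x.
have nS n : nonneg_measurable (S n).
  elim: n => [|n IH]; rewrite /S.
    by under eq_fun do rewrite big_nil; exact: nonneg_measurable_cst.
  under eq_fun do rewrite big_nat_recr//=.
  exact: nonneg_measurableD.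
have SE n y : S n.+1 y = (\1_C y)%:E + r%:E * killed (S n) y.
  elim: n => [|n IH].
    rewrite /S big_nat1 expr0 mul1e (_ : killed _ y = 0) ?mule0 ?adde0//.
    rewrite /killed (eq_integral (cst 0)) ?integral0 ?mule0//.
    by move=> z _; rewrite big_nil.
  rewrite {1}/S big_nat_recr//= -[X in X + _]/(S n.+1 y) IH -addeA; congr (_ + _).
  have -> : S n.+1 = fun x => S n x + (r ^+ n)%:E * hit n x.
    by apply/funext => z; rewrite /S big_nat_recr.
  rewrite (posopD pk)// ge0_muleDr; last 2 first.
  - by case: (posop_measurable pk (nS n)).
  - by case: (posop_measurable pk (nt n)).
  congr (_ + _); rewrite (posopZ pk) ?exprn_ge0//; last exact: nonneg_measurable_hit.
  by rewrite exprS EFinM -muleA.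
have SW n y : S n y <= W y.
  elim: n y => [|n IH] y; first by rewrite /S big_nil; case: nW.
  rewrite SE; apply: le_trans (WW y); rewrite leeD2l// lee_wpmul2l ?lee_fin//.
  exact: (posop_le pk).
apply: lime_le; first by apply: is_cvg_nneseries => n _ _; case: (nt n).
by apply: nearW => n; exact: SW.
Qed.

Lemma hit_gf1_le x : hit_gf 1 x <= 1.
Proof.
have n1 : nonneg_measurable (cst 1 : E -> \bar R) by split => //; exact: measurable_cst.
apply: (hit_gf_le ler01 n1 _ x) => y; rewrite mul1e /killed integral_cst// prob_kernel mule1 mule1 -EFinD.
by rewrite !indicE in_setC; case: (_ \in _); rewrite /= ?addr0 ?add0r.
Qed.

(* Convexity of [r |-> r ^ n] on [1, r1]. *)
Lemma hit_gf_convex (t r1 : R) x : (0 <= t <= 1)%R -> (1 <= r1)%R ->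
  hit_gf (1 - t + t * r1) x <= (1 - t)%:E * hit_gf 1 x + t%:E * hit_gf r1 x.
Proof.
move=> /andP[t0 t1] r11; have t1' : (0 <= 1 - t)%R by rewrite subr_ge0.
have r10 : (0 <= r1)%R by rewrite (le_trans ler01).
have h0 n : 0 <= hit n x by case: (nonneg_measurable_hit n).
rewrite /hit_gf -!nneseriesZl; last 2 first.
- by move=> n _; rewrite mule_ge0// lee_fin exprn_ge0.
- by move=> n _; rewrite mule_ge0// lee_fin exprn_ge0.
rewrite -nneseriesD; last 2 first.
- by move=> n _ _; rewrite !mule_ge0// ?lee_fin ?exprn_ge0.
- by move=> n _ _; rewrite !mule_ge0// ?lee_fin ?exprn_ge0.
apply: lee_nneseries.
- by move=> n _ _; rewrite mule_ge0// lee_fin exprn_ge0// addr_ge0// mulr_ge0.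
move=> n _; rewrite !muleA -!EFinM -ge0_muleDl ?lee_fin ?mulr_ge0 ?exprn_ge0//.
rewrite -EFinD lee_wpmul2r// lee_fin expr1n mulr1.
elim: n => [|n IH]; first by rewrite !expr0; lra.
have rn : (1 <= r1 ^+ n)%R by rewrite exprn_ege1.
rewrite !exprS; apply: (@le_trans _ _ ((1 - t + t * r1) * (1 - t + t * r1 ^+ n))%R).
  by rewrite ler_wpM2l// addr_ge0// mulr_ge0.
have : (0 <= t * (1 - t) * ((r1 - 1) * (r1 ^+ n - 1)))%R.
  by rewrite !mulr_ge0// subr_ge0.
by set q := (r1 ^+ n)%R in rn *; nra.
Qed.

End hitting_generating_function.

Section bounded_kernel_operators.
Context {R : realType} {d : measure_display} {E : measurableType d}.
Variable w : weight R E.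
Implicit Types (Q : R.-pker E ~> E).

Lemma kernel_bound_weight Q (theta : E * E -> R[i]) (k X : R) : 0 <= k -> 0 <= X ->
  (forall x, (\int[Q x]_y (w y)%:E <= (k * w x)%:E)%E) ->
  cmeasurable theta -> (forall z, normc (theta z) <= X) ->
  kernel_bound w Q theta (X * k).
Proof.
move=> k0 X0 wk mtheta thetaX x; have [mw w0] := nonneg_measurable_weight w.
apply: (@le_trans _ _ (X%:E * \int[Q x]_y (w y)%:E)%E); last first.
  by rewrite -mulrA [leRHS]EFinM lee_wpmul2l ?lee_fin.
rewrite -ge0_integralZl_EFin//; last by move=> y _; exact: w0.
apply: ge0_le_integral => //.
- by move=> y _; rewrite lee_fin mulr_ge0 ?normc_ge0// ltW// weight_gt0.
- apply/measurable_EFinP/measurable_funM; first exact: weight_measurable.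
  exact: (measurable_normc (cmeasurable_section x mtheta)).
- by apply: emeasurable_funM => //; exact: measurable_cst.
by move=> y _; rewrite -EFinM lee_fin mulrC ler_wpM2r// ltW// weight_gt0.
Qed.

Lemma dominated_kernel_op Q (theta : E * E -> R[i]) (k X : R) (S : Bw w -> Bw w) :
  0 <= k -> 0 <= X -> (forall x, (\int[Q x]_y (w y)%:E <= (k * w x)%:E)%E) ->
  cmeasurable theta -> (forall z, normc (theta z) <= X) ->
  (forall f x, S f x = kernel_op_chi Q theta f x) -> dominated S.
Proof.
move=> k0 X0 wk mtheta thetaX SE; have bth := kernel_bound_weight k0 X0 wk mtheta thetaX.
exists ((fun g x => (cst X x)%:E * g x)%E \o (fun g x => \int[Q x]_y g y)%E), (X * k); split.
- by apply: positive_operator_comp (positive_operator_kernel Q); exact: positive_operator_mul.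
- exact: mulr_ge0.
- by move=> x; rewrite -mulrA EFinM lee_wpmul2l ?lee_fin//; exact: wk.
move=> f x; rewrite SE; apply: le_trans (normc_cintegral_le (Bw_cintegrable f x mtheta bth)) _.
have [mf f0] := nonneg_measurable_normc f.
rewrite /= -ge0_integralZl_EFin//.
apply: ge0_le_integral => //.
- by move=> y _; rewrite lee_fin normc_ge0.
- apply/measurable_EFinP/measurable_normc/cmeasurableM; first exact: Bw_cmeasurable.
  exact: cmeasurable_section.
- by apply: emeasurable_funM => //; exact: measurable_cst.
by move=> y _; rewrite -EFinM lee_fin normcM mulrC ler_wpM2r ?normc_ge0.
Qed.

Lemma bounded_actionI (K : (E -> R[i]) -> E -> R[i]) (T : {linear Bw w -> Bw w}) c :
  (forall f x, T f x = K f x) -> (forall f, nrm (T f) <= c * nrm f) -> bounded_action K T.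
Proof.
move=> TE Tc; split => //; apply/linear_boundedP.
exists c%:C; split; first by apply/complex_realP; exists c.
move=> r cr f; rewrite -!nrmE; apply: (@le_trans _ _ (c%:C * (nrm f)%:C)).
  by rewrite -rmorphM lecR.
by apply: ler_wpM2r; [rewrite (lecR 0) nrm_ge0|exact: ltW].
Qed.

End bounded_kernel_operators.

(** * The decomposition of [P] and its estimates *)

Section minorized_kernel.
Context {R : realType} {d : measure_display} {E : measurableType d}.
Variables (P P0 K : R.-pker E ~> E) (C : set E) (b : R) (nu : probability E R) (alpha : E * E -> R).
Hypotheses (mC : measurable C) (hb : 0 < b <= 1).
Hypotheses (malpha : measurable_fun setT alpha) (alpha0 : forall z, 0 <= alpha z).
Hypothesis KE : forall x A, measurable A -> K x A = Tker nu alpha x A.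
Hypothesis minor : forall x A, measurable A -> ((b * \1_C x)%:E * K x A <= P x A)%E.
Hypothesis P0E : represents P0 (residual P b C (fun x A => K x A)).

Let c x := b * \1_C x.

Lemma minor_coef_itv x : 0 <= c x <= 1.
Proof.
case/andP: hb => b0 b1; rewrite /c indicE; case: (_ \in _).
  by rewrite mulr1 (ltW b0).
by rewrite mulr0 lexx ler01.
Qed.

Lemma pker_fin_num (Q : R.-pker E ~> E) x A : measurable A -> Q x A \is a fin_num.
Proof.
move=> mA; rewrite ge0_fin_numE// (@le_lt_trans _ _ 1%E) ?ltry//.
by rewrite -(@prob_kernel _ _ _ _ _ Q x) le_measure ?inE.
Qed.

(* When [b = 1] the minorization of the probability [P x] by the probability
   [K x] on [C] is an equality. *)
Lemma mixture_measure x A : measurable A ->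
  P x A = ((1 - c x)%:E * P0 x A + (c x)%:E * K x A)%E.
Proof.
move=> mA; rewrite P0E// /residual -/(c x).
have /andP[c0 c1] := minor_coef_itv x.
have fP := pker_fin_num P x mA; have fK := pker_fin_num K x mA.
case: asboolP => [h|/not_orP[/negP nb /contrapT Cx]].
  have cx1 : 1 - c x != 0.
    rewrite /c indicE; case/andP: hb => b0 b1; case: (boolP (x \in C)) => [/set_mem Cx|_].
      by rewrite mulr1 subr_eq0 eq_sym lt_eqF//; case: h.
    by rewrite mulr0 subr0 oner_eq0.
  move: (P x A) (K x A) fP fK => [p||] [k||] //= _ _.
  by rewrite -!(EFinB, EFinM, EFinD); congr (_%:E); field.
have b1 : b = 1 by apply/eqP; case/andP: hb => _; rewrite eq_le => ->; rewrite leNgt.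
have -> : c x = 1 by rewrite /c b1 indicE mem_set// mulr1.
rewrite subrr mul0e add0e mul1e; apply/eqP; rewrite eq_le; apply/andP; split; last first.
  by have := minor x mA; rewrite b1 indicE mem_set// mul1r mul1e.
have mAC : measurable (~` A) by exact: measurableC.
have := minor x mAC; rewrite b1 indicE mem_set// mul1r mul1e.
have cpl (Q : R.-pker E ~> E) : Q x (~` A) = (1 - Q x A)%E.
  have := @prob_kernel _ _ _ _ _ Q x; rewrite -(setvU A) measureU//; last by rewrite setICl.
  move=> <-; rewrite addeK//; exact: pker_fin_num.
rewrite !cpl; move: (P x A) (K x A) fP fK => [p||] [k||] //= _ _.
by rewrite -!EFinB !lee_fin; lra.
Qed.

(** Both sides are Daniell functionals of [g] that agree on indicators by [mixture_measure]. *)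
Lemma mixture_integral x g : nonneg_measurable g ->
  (\int[P x]_y g y = (1 - c x)%:E * \int[P0 x]_y g y +
    (c x)%:E * \int[nu]_y ((alpha (x, y))%:E * g y))%E.
Proof.
move=> ng; have /andP[c0 c1] := minor_coef_itv x.
have ma : measurable_fun setT (fun y => alpha (x, y)).
  by apply: (measurableT_comp malpha (pair1_measurable x)).
have KI : (\int[nu]_y ((alpha (x, y))%:E * g y) = \int[K x]_y g y)%E.
  by rewrite (integral_density (mu := K x) (nu := nu) ma)// => A mA; rewrite KE.
have c1' : 0 <= 1 - c x by rewrite subr_ge0.
rewrite KI -ge0_integralZl_EFin//; [|by case: ng|by case: ng].
rewrite -ge0_integralZl_EFin//; [|by case: ng|by case: ng].
apply: (@daniell_eq _ _ _ (fun g => \int[P x]_y g y)%E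
  (fun g => \int[P0 x]_y ((1 - c x)%:E * g y) + \int[K x]_y ((c x)%:E * g y))%E _ _ _ _ ng).
- exact: daniell_integral.
- apply: daniell_add.
    by apply: (daniell_mul (a := cst (1 - c x))) => //; exact: daniell_integral.
  by apply: (daniell_mul (a := cst (c x))) => //; exact: daniell_integral.
move=> A mA; have [mi i0] := @nonneg_measurable_indic R _ _ A mA.
rewrite ge0_integralZl_EFin// ge0_integralZl_EFin// !integral_indic// !setIT.
exact: mixture_measure.
Qed.

Lemma mixture_Rintegral x (g : E -> R) :
  (P x).-integrable setT (EFin \o g) -> (P0 x).-integrable setT (EFin \o g) ->
  nu.-integrable setT (EFin \o (fun y => alpha (x, y) * g y)) ->
  \int[P x]_y g y = (1 - c x) * \int[P0 x]_y g y + c x * \int[nu]_y (alpha (x, y) * g y).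
Proof.
move=> iP iP0; set ag := EFin \o _ => inu; have mg : measurable_fun setT (EFin \o g).
  by case/integrableP: iP.
have agp y : ((alpha (x, y))%:E * (EFin \o g)^\+ y = ag^\+ y)%E.
  by rewrite !funeposE maxe_pMr ?lee_fin// mule0 -EFinM.
have agm y : ((alpha (x, y))%:E * (EFin \o g)^\- y = ag^\- y)%E.
  by rewrite !funenegE maxe_pMr ?lee_fin// mule0 muleN -EFinM.
rewrite /Rintegral [X in fine X = _]integralE [X in _ * fine X + _]integralE
  [X in _ + _ * fine X]integralE.
rewrite !mixture_integral; [|by split; [exact: measurable_funeneg|]|by split; [exact: measurable_funepos|]].
under [X in (_ + _ * X - _)%E]eq_integral do rewrite agp.
under [X in (_ - (_ + _ * X))%E]eq_integral do rewrite agm.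
have := integrable_pos_fin_num measurableT iP0; have := integrable_neg_fin_num measurableT iP0.
have := integrable_pos_fin_num measurableT inu; have := integrable_neg_fin_num measurableT inu.
move=> /fineK <- /fineK <- /fineK <- /fineK <-.
by rewrite /=; ring.
Qed.

Lemma mixture_kernel_op (w : weight R E) (chi : E * E -> R[i]) (cP c0 cnu : R) (f : Bw w) x :
  cmeasurable chi ->
  kernel_bound w P chi cP -> kernel_bound w P0 chi c0 ->
  kernel_bound w (constant_kernel nu) (density_kernel alpha chi) cnu ->
  kernel_op_chi P chi f x =
    kernel_op_chi P0 (fun z => (1 - c z.1)%:C * chi z) f x +
    kernel_op_chi (constant_kernel nu) (density_kernel alpha (fun z => (c z.1)%:C * chi z)) f x.
Proof.
move=> mchi bP b0 bnu.
have iP := Bw_cintegrable f x mchi bP; have i0 := Bw_cintegrable f x mchi b0.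
have mdens : cmeasurable (density_kernel alpha chi).
  by apply: cmeasurableM => //; exact: cmeasurable_real.
have inu := Bw_cintegrable f x mdens bnu.
have zero_int (mu : {measure set E -> \bar R}) : cintegrable mu (fun _ : E => 0 : R[i]).
  split; first exact: cmeasurable_cst.
  by under eq_integral do rewrite normc0; rewrite integral0 ltry.
have cZ (mu : {measure set E -> \bar R}) (a : R[i]) (g : E -> R[i]) : cintegrable mu g ->
    cintegral mu (fun y => a * g y) = a * cintegral mu g.
  move=> ig; have := cintegral_linear a ig (zero_int mu).
  rewrite (_ : cintegral mu (fun=> 0) = 0) ?addr0; last first.
    rewrite /cintegral; under eq_Rintegral do [].
    by rewrite /Rintegral /= !integral0.
  by under eq_fun do rewrite addr0.
rewrite /kernel_op_chi.
rewrite (_ : (fun y => f y * ((1 - c (x, y).1)%:C * chi (x, y))) =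
  (fun y => (1 - c x)%:C * (f y * chi (x, y)))); last first.
  by apply/funext => y /=; rewrite mulrCA.
rewrite (_ : (fun y => f y * density_kernel alpha (fun z => (c z.1)%:C * chi z) (x, y)) =
  (fun y => (c x)%:C * (f y * density_kernel alpha chi (x, y)))); last first.
  by apply/funext => y; rewrite /density_kernel /= -mulrA mulrCA.
rewrite !cZ//.
have Re_dens y : complex.Re (f y * density_kernel alpha chi (x, y)) =
    alpha (x, y) * complex.Re (f y * chi (x, y)).
  rewrite /density_kernel mulrA; case: (f y * chi (x, y)) => p q /=.
  by rewrite mulr0 subr0 mulrC.
have Im_dens y : complex.Im (f y * density_kernel alpha chi (x, y)) =
    alpha (x, y) * complex.Im (f y * chi (x, y)).
  rewrite /density_kernel mulrA; case: (f y * chi (x, y)) => p q /=.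
  by rewrite mulr0 add0r mulrC.
have inuR := cintegrable_Re inu; have inuI := cintegrable_Im inu.
rewrite /cintegral (mixture_Rintegral (cintegrable_Re iP) (cintegrable_Re i0)); last first.
  by move: inuR; under eq_fun do rewrite Re_dens.
rewrite (mixture_Rintegral (cintegrable_Im iP) (cintegrable_Im i0)); last first.
  by move: inuI; under eq_fun do rewrite Im_dens.
have -> : \int[constant_kernel nu x]_y complex.Re (f y * density_kernel alpha chi (x, y)) =
    \int[nu]_y (alpha (x, y) * complex.Re (f y * chi (x, y))).
  by apply: eq_Rintegral => y _; rewrite Re_dens.
have -> : \int[constant_kernel nu x]_y complex.Im (f y * density_kernel alpha chi (x, y)) =
    \int[nu]_y (alpha (x, y) * complex.Im (f y * chi (x, y))).
  by apply: eq_Rintegral => y _; rewrite Im_dens.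
by apply/eqP; rewrite eq_complex /= !mul0r !subr0 !addr0 !eqxx.
Qed.

Variables (w : weight R E) (r1 eta : R).
Hypotheses (hr1 : 1 < r1) (heta : 0 <= eta).
Hypothesis drift : forall x, (\int[P x]_y (w y)%:E <=
  (r1^-1 * (w x * \1_(~` C) x + eta * \1_C x))%:E)%E.

Let wgt0 := weight_gt0 w.
Let nw := nonneg_measurable_weight w.

Let r1_gt0 : 0 < r1.
Proof. exact: lt_trans hr1. Qed.

Lemma indicC_cases x : (C x /\ \1_C x = 1 :> R /\ \1_(~` C) x = 0 :> R) \/
  (~ C x /\ \1_C x = 0 :> R /\ \1_(~` C) x = 1 :> R).
Proof.
rewrite !indicE in_setC; case: (boolP (x \in C)) => [/set_mem Cx|/negP nCx]; first by left.
by right; split => // Cx; apply: nCx; exact/mem_set.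
Qed.

Lemma drift_weight x : (\int[P x]_y (w y)%:E <= ((1 + eta) * w x)%:E)%E.
Proof.
apply: le_trans (drift x) _; rewrite lee_fin.
have w1 := weight_ge1 w x.
apply: (@le_trans _ _ (w x * \1_(~` C) x + eta * \1_C x)).
  rewrite ler_piMl//; last by rewrite invf_le1// ltW.
  by rewrite addr_ge0// mulr_ge0// ltW.
have [[_ [-> ->]]|[_ [-> ->]]] := indicC_cases x.
  rewrite mulr0 add0r mulr1 mulrDl mul1r; apply: (@le_trans _ _ (eta * w x)).
    by rewrite ler_peMr.
  by rewrite lerDr ltW.
by rewrite mulr0 addr0 mulr1 mulrDl mul1r lerDl mulr_ge0// ltW.
Qed.

(** The drift condition says that [w] is a supersolution of the first-step equation for all
    [r <= r1]. *)
Lemma hit_gf_le_weight r x : 0 <= r <= r1 -> (hit_gf P C r x <= (w x)%:E)%E.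
Proof.
move=> /andP[r0 rr1]; apply: (hit_gf_le mC (W := EFin \o w) r0 nw _ x) => {}x /=.
rewrite /killed; have := drift x; have [[_ [-> ->]]|[_ [-> ->]]] := indicC_cases x.
  by rewrite mul0e mule0 adde0 lee_fin weight_ge1.
rewrite mulr1 mulr0 addr0 add0e mul1e => Pw.
apply: (@le_trans _ _ (r%:E * (r1^-1 * w x)%:E)%E); first by rewrite lee_wpmul2l ?lee_fin.
rewrite -EFinM lee_fin mulrA ler_piMl ?(ltW (wgt0 x))//.
by rewrite ler_pdivrMr// mul1r.
Qed.

Lemma residual_dirac x g : b = 1 -> C x -> nonneg_measurable g -> (\int[P0 x]_y g y = g x)%E.
Proof.
move=> b1 Cx [mg g0]; rewrite (eq_measure_integral (\d_x)).
  by rewrite integral_dirac// diracT mul1e.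
move=> A mA _; transitivity (residual P b C (fun x A => K x A) x A); first exact: P0E.
have h : ~ (b < 1 \/ ~ C x) by move=> [|//]; rewrite b1 ltxx.
by rewrite /residual asboolF// diracE indicE.
Qed.

Lemma residual_le x g : nonneg_measurable g ->
  ((1 - c x)%:E * \int[P0 x]_y g y <= \int[P x]_y g y)%E.
Proof.
move=> ng; rewrite (mixture_integral x ng) leeDl// mule_ge0//.
  by rewrite lee_fin; case/andP: (minor_coef_itv x).
by apply: integral_ge0 => y _; rewrite mule_ge0 ?lee_fin//; case: ng.
Qed.

Lemma residual_outside x g : ~ C x -> nonneg_measurable g ->
  (\int[P0 x]_y g y = \int[P x]_y g y)%E.
Proof.
move=> nCx ng; rewrite (mixture_integral x ng) /c indicE memNset//.
by rewrite !mulr0 subr0 mul1e mul0e adde0.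
Qed.

Lemma residual_inside x : b < 1 -> C x ->
  (\int[P0 x]_y (w y)%:E <= ((1 - b)^-1 * eta)%:E)%E.
Proof.
move=> b1 Cx; have b10 : 0 < 1 - b by rewrite subr_gt0.
have := residual_le x nw; rewrite /c indicE mem_set// mulr1 => H.
have H2 : ((1 - b)%:E * \int[P0 x]_y (w y)%:E <= eta%:E)%E.
  apply: le_trans H (le_trans (drift x) _); rewrite lee_fin.
  have [[_ [-> ->]]|[//]] := indicC_cases x.
  by rewrite mulr0 add0r mulr1 ler_piMl// invf_le1// ltW.
by rewrite EFinM lee_pdivlMl.
Qed.

Lemma residual_weight : exists2 k : R, 0 <= k &
  forall x, (\int[P0 x]_y (w y)%:E <= (k * w x)%:E)%E.
Proof.
have big_k k x : (1 <= k) -> (1 + eta <= k) -> ((1 - b)^-1 * eta <= k \/ b = 1) ->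
    (\int[P0 x]_y (w y)%:E <= (k * w x)%:E)%E.
  move=> k1 ke kb; have [Cx|nCx] := pselect (C x); last first.
    rewrite (residual_outside nCx nw); apply: le_trans (drift_weight x) _.
    by rewrite lee_fin ler_wpM2r// ltW.
  have [b1|b1] := eqVneq b 1.
    rewrite (residual_dirac b1 Cx nw) lee_fin ler_peMl// ltW//.
  have b1' : b < 1 by rewrite lt_neqAle b1; case/andP: hb.
  apply: le_trans (residual_inside b1' Cx) _; rewrite lee_fin.
  have kb' : (1 - b)^-1 * eta <= k by case: kb => // b1''; rewrite b1'' eqxx in b1.
  apply: le_trans kb' _; rewrite ler_peMr ?weight_ge1//; exact: le_trans k1.
(* The terms come from the three cases: 1 from the Dirac mass on [C] when [b = 1], [1 + eta] from
   outside [C], the last from [C] when [b < 1]. *)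
exists (1 + eta + `|(1 - b)^-1 * eta|); first by rewrite !addr_ge0.
move=> x; apply: big_k.
- by rewrite -addrA lerDl addr_ge0.
- by rewrite lerDl.
- left; apply: le_trans (ler_norm _) _; rewrite lerDr addr_ge0//.
Qed.

(** The function [h] of the theorem in analytic form, independent of any chain. *)
Definition residual_gf r : \bar R :=
  ereal_sup [set (\int[P0 x]_y (r%:E * hit_gf P C r y))%E | x in C].

Lemma hit_gf_inside r x : 0 <= r -> C x -> hit_gf P C r x = 1%E.
Proof.
move=> r0 Cx; rewrite hit_gf_eq// /killed; have [[_ [-> ->]]|[//]] := indicC_cases x.
by rewrite mul0e mule0 adde0.
Qed.

Lemma residual_gf_bound : exists2 k : R, 0 <= k &
  forall x, C x -> (\int[P0 x]_y hit_gf P C r1 y <= k%:E)%E.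
Proof.
have r10 := ltW r1_gt0; have nh := nonneg_measurable_hit_gf P mC r10.
have [b1|b1] := eqVneq b 1.
  exists 1 => // x Cx; rewrite (residual_dirac b1 Cx nh) hit_gf_inside//.
have b1' : b < 1 by rewrite lt_neqAle b1; case/andP: hb.
exists ((1 - b)^-1 * eta); first by rewrite mulr_ge0// invr_ge0 subr_ge0 ltW.
move=> x Cx; apply: le_trans (residual_inside b1' Cx).
apply: ge0_le_integral => //; [by case: nh|by case: nh|by case: nw|].
by move=> y _; apply: hit_gf_le_weight; rewrite r10 lexx.
Qed.

Lemma residual_gf_lty : (residual_gf r1 < +oo)%E.
Proof.
have [k k0 kP] := residual_gf_bound; have r10 := ltW r1_gt0.
have [mh h0] := nonneg_measurable_hit_gf P mC r10.
apply: le_lt_trans (ltry (r1 * k)); apply: ge_ereal_sup => _ [x Cx <-].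
by rewrite ge0_integralZl_EFin// EFinM lee_wpmul2l ?lee_fin// kP.
Qed.

(** At [r = 1] the generating function is at most 1, below [1 / (1 - b)]; convexity bounds its
    growth along the segment to [r1], where it has a finite integral under [P0]. For [b = 1]
    finiteness at [r1] suffices. *)
Lemma residual_gf_small : exists r, 1 < r <= r1 /\ (residual_gf r < inv_1subb b)%E.
Proof.
rewrite /inv_1subb; have [b1|b1] := eqVneq b 1.
  by exists r1; rewrite hr1 lexx; split => //; exact: residual_gf_lty.
have b1' : b < 1 by rewrite lt_neqAle b1; case/andP: hb.
have b0 : 0 < b by case/andP: hb.
have [k k0 kP] := residual_gf_bound; have r10 := ltW r1_gt0.
pose B := r1 + k; have B0 : 0 < B by rewrite ltr_wpDr.
(* This gives [t * B < b / 4]. Both factors of [r * (1 - t + t * k)] are at most [1 + t * B], and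
   [(1 + b / 4) ^ 2 * (1 - b) < 1]. *)
pose t := b / (4 * (B + 1)).
have B1 : 0 < 4 * (B + 1) by rewrite mulr_gt0// addr_gt0.
have t0 : 0 < t by rewrite divr_gt0.
have tB : t * B < b / 4.
  have -> : t * B = b / 4 * (B / (B + 1)) by rewrite /t; field; rewrite gt_eqF// addr_gt0.
  have B10 : 0 < B + 1 by rewrite addr_gt0.
  have BB : B / (B + 1) < 1 by rewrite ltr_pdivrMr//; lra.
  by rewrite gtr_pMr ?divr_gt0.
have t1 : t <= 1.
  rewrite /t ler_pdivrMr// mul1r; lra.
exists (1 - t + t * r1); split.
  have h1 : 0 < t * (r1 - 1) by rewrite mulr_gt0// subr_gt0.
  have h2 : 0 <= (1 - t) * (r1 - 1) by rewrite mulr_ge0 ?subr_ge0// ltW.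
  by apply/andP; split; lra.
set r := 1 - t + t * r1.
have r_ge0 : 0 <= r by rewrite addr_ge0 ?subr_ge0// mulr_ge0// ltW.
have [mh h0] := nonneg_measurable_hit_gf P mC r_ge0.
have [m1 g0] := nonneg_measurable_hit_gf P mC r10.
have t1' : 0 <= 1 - t by rewrite subr_ge0.
apply: (@le_lt_trans _ _ (r * (1 - t + t * k))%:E).
  apply: ge_ereal_sup => _ [x Cx <-].
  rewrite ge0_integralZl_EFin// [leRHS]EFinM lee_wpmul2l ?lee_fin//.
  apply: (@le_trans _ _ (\int[P0 x]_y ((1 - t)%:E + t%:E * hit_gf P C r1 y))%E).
    apply: ge0_le_integral => //.
    - by apply: emeasurable_funD => //; exact: emeasurable_funM.
    move=> y _; apply: le_trans (hit_gf_convex P mC y _ (ltW hr1)) _.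
      by rewrite (ltW t0).
    by rewrite leeD2r// -[leRHS]mule1 lee_wpmul2l ?lee_fin// hit_gf1_le.
  rewrite ge0_integralD//; last 2 first.
  - by move=> y _; rewrite mule_ge0// lee_fin ltW.
  - exact: emeasurable_funM.
  rewrite integral_cst// prob_kernel mule1 [leRHS]EFinD leeD2l//.
  rewrite ge0_integralZl_EFin//; last exact: ltW.
  by rewrite [leRHS]EFinM lee_wpmul2l ?lee_fin ?(ltW t0)// kP.
have b10 : 0 < 1 - b by rewrite subr_gt0.
rewrite lte_fin -[ltRHS]mul1r ltr_pdivlMr//.
have tr1 : t * r1 <= t * B by rewrite ler_pM2l// lerDl.
have tk : t * k <= t * B by rewrite ler_pM2l// lerDr ltW.
have le1 : r * (1 - t + t * k) <= (1 + t * B) * (1 + t * B).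
  apply: ler_pM => //; first by rewrite addr_ge0// mulr_ge0// ltW.
    by rewrite /r; lra.
  by lra.
apply: (@le_lt_trans _ _ ((1 + t * B) * (1 + t * B) * (1 - b))).
  by rewrite ler_pM2r.
have tB0 : 0 < t * B by rewrite mulr_gt0.
set s := t * B in tB tB0 *; nra.
Qed.

(* With [u = hit_gf r], [V = w + A u]: off [C], [P u = u / r]; on [C], [u = 1] and the gap in
   [residual_gf r < 1 / (1 - b)] absorbs [eta] once [A] is large. *)
Lemma lyapunov_function r : 1 < r <= r1 -> (residual_gf r < inv_1subb b)%E ->
  exists (V : E -> R) (M : R), [/\ measurable_fun setT V, 0 <= M,
    forall x, w x <= V x <= M * w x &
    forall x, ((1 - c x)%:E * \int[P0 x]_y (V y)%:E <= (r^-1 * V x)%:E)%E].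
Proof.
move=> /andP[r_gt1 rr1] hr.
have r0 : 0 < r by exact: lt_trans r_gt1.
have r00 := ltW r0.
have rint : 0 <= r <= r1 by rewrite r00.
have nh := nonneg_measurable_hit_gf P mC r00; have [mh h0] := nh.
have hfin x : hit_gf P C r x \is a fin_num.
  by rewrite ge0_fin_numE// (le_lt_trans (hit_gf_le_weight x rint)) ?ltry.
pose u x := fine (hit_gf P C r x).
have uE x : (u x)%:E = hit_gf P C r x by rewrite fineK.
have mu : measurable_fun setT u by exact: measurableT_comp.
have u0 x : 0 <= u x by rewrite fine_ge0.
have uw x : u x <= w x by rewrite -lee_fin uE; exact: hit_gf_le_weight.
have nu_ : nonneg_measurable (EFin \o u) by split; [exact/measurable_EFinP|move=> x; rewrite lee_fin].
(* [dl] measures the gap in [residual_gf r < 1 / (1 - b)]; for [b = 1] the left side vanishes and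
   the margin is 1. *)
have [dl [dl0 dl1 dlP]] : exists dl : R, [/\ 0 < dl, dl <= 1 &
    forall x, C x -> ((1 - b)%:E * \int[P0 x]_y (u y)%:E <= (r^-1 * (1 - dl))%:E)%E].
  move: hr; rewrite /inv_1subb; have [b1 _|b1 hr] := eqVneq b 1.
    exists 1; split => // x Cx; rewrite b1 !subrr mulr0 mul0e.
    by [].
  have b1' : 0 < 1 - b by rewrite subr_gt0 lt_neqAle b1; case/andP: hb.
  (* The value [-oo] belongs to an empty supremum, contradicted by any [x] in [C]. *)
  have [hrN|hrN] := eqVneq (residual_gf r) -oo%E.
    exists 1; split => // x Cx.
    have : (\int[P0 x]_y (r%:E * hit_gf P C r y) <= residual_gf r)%E.
      by apply: ereal_sup_ubound; exists x.
    rewrite hrN leeNy_eq => /eqP eqN.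
    have : (0 <= \int[P0 x]_y (r%:E * hit_gf P C r y))%E.
      by apply: integral_ge0 => y _; rewrite mule_ge0// lee_fin.
    by rewrite eqN.
  have hfin' : residual_gf r \is a fin_num.
    by rewrite fin_numE hrN/= lt_eqF// (lt_trans hr)// ltry.
  pose s := fine (residual_gf r).
  have sE : s%:E = residual_gf r by rewrite fineK.
  have sb : s * (1 - b) < 1 by rewrite -ltr_pdivlMr// mul1r -lte_fin sE.
  exists (Num.min 1 (1 - s * (1 - b))); split.
  - by rewrite lt_min ltr01 subr_gt0.
  - by rewrite ge_min lexx.
  move=> x Cx; have le_s : (r%:E * \int[P0 x]_y (u y)%:E <= s%:E)%E.
    rewrite sE; apply: ereal_sup_ubound; exists x => //.
    rewrite ge0_integralZl_EFin//; congr (_ * _)%E.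
    by apply: eq_integral => y _; rewrite uE.
  have le_s' : (\int[P0 x]_y (u y)%:E <= (r^-1 * s)%:E)%E.
    by rewrite EFinM lee_pdivlMl.
  apply: (@le_trans _ _ ((1 - b)%:E * (r^-1 * s)%:E)%E).
    by rewrite lee_wpmul2l// lee_fin ltW.
  rewrite -EFinM lee_fin mulrCA ler_pM2l ?invr_gt0// mulrC.
  have : Num.min 1 (1 - s * (1 - b)) <= 1 - s * (1 - b) by rewrite ge_min lexx orbT.
  by lra.
(* The solution of [eta + A * (r^-1 * (1 - dl)) = r^-1 * A]. *)
pose A := r * eta / dl.
have A0 : 0 <= A by rewrite divr_ge0 ?(ltW dl0)// mulr_ge0.
pose V x := w x + A * u x.
have mV : measurable_fun setT V.
  apply: measurable_funD; first exact: weight_measurable.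
  by apply: measurable_funM => //; exact: measurable_cst.
exists V, (1 + A); split => //.
- by rewrite addr_ge0.
- move=> x; apply/andP; split; first by rewrite lerDl mulr_ge0.
  by rewrite mulrDl mul1r lerD2l ler_wpM2l.
have intV (Q : R.-pker E ~> E) x : (\int[Q x]_y (V y)%:E =
    \int[Q x]_y (w y)%:E + A%:E * \int[Q x]_y (u y)%:E)%E.
  have [mu' _] := nu_; have [mw' _] := nw.
  rewrite -ge0_integralZl_EFin//; last by move=> y _; rewrite lee_fin.
  rewrite -ge0_integralD//.
  - by move=> y _; rewrite lee_fin ltW.
  - by move=> y _; rewrite -EFinM lee_fin mulr_ge0.
  - by apply: emeasurable_funM => //; exact: measurable_cst.
move=> x; have rr : r1^-1 <= r^-1 by rewrite lef_pV2.
have [[Cx [C1 C2]]|[nCx [C1 C2]]] := indicC_cases x; last first.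
  rewrite /c C1 mulr0 subr0 mul1e intV (residual_outside nCx nw) (residual_outside nCx nu_).
  rewrite /V mulrDr EFinD; apply: leeD.
    apply: le_trans (drift x) _; rewrite C1 C2 mulr0 addr0 mulr1 lee_fin.
    by rewrite ler_wpM2r// ltW.
  have := hit_gf_eq P mC x r00; rewrite /killed C1 C2 add0e mul1e.
  have -> : (\int[P x]_y hit_gf P C r y = \int[P x]_y (u y)%:E)%E.
    by apply: eq_integral => y _; rewrite uE.
  rewrite -(uE x) => ux; have -> : r^-1 * (A * u x) = A * (r^-1 * u x) by ring.
  rewrite [leRHS]EFinM; apply: lee_wpmul2l; first by rewrite lee_fin.
  by rewrite EFinM ux muleA -EFinM mulVf ?mul1e// gt_eqF.
rewrite /c C1 mulr1 intV.
have b10 : 0 <= 1 - b by rewrite subr_ge0; case/andP: hb.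
rewrite ge0_muleDr; last 2 first.
- by apply: integral_ge0 => y _; rewrite lee_fin ltW.
- by rewrite mule_ge0 ?lee_fin//; apply: integral_ge0 => y _; rewrite lee_fin.
apply: (@le_trans _ _ (eta%:E + A%:E * (r^-1 * (1 - dl))%:E)%E).
  apply: leeD.
    have := residual_le x nw; rewrite /c C1 mulr1 => /le_trans; apply.
    apply: le_trans (drift x) _; rewrite C1 C2 mulr0 add0r mulr1 lee_fin.
    by rewrite ler_piMl// invf_le1// ltW.
  by rewrite muleCA lee_wpmul2l ?lee_fin// dlP.
rewrite -EFinM -EFinD lee_fin /V.
have ux1 : u x = 1 by rewrite /u hit_gf_inside.
rewrite ux1 mulr1.
have -> : eta + A * (r^-1 * (1 - dl)) = r^-1 * A.
  by rewrite /A; field; apply/andP; split; rewrite gt_eqF.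
by rewrite ler_pM2l ?invr_gt0// lerDr ltW.
Qed.

(** The induction is run with [V], which the kernel of [S] contracts by [X / r] at each step;
    returning to [w] costs the factor [M] only once. *)
Lemma residual_iterates (X r : R) (chi : E * E -> R[i]) (k : R) (S : {linear Bw w -> Bw w}) :
  1 < r <= r1 -> (residual_gf r < inv_1subb b)%E ->
  cmeasurable chi -> 0 <= X -> (forall z, normc (chi z) <= X) ->
  (forall f x, S f x = kernel_op_chi P0 (fun z => (1 - c z.1)%:C * chi z) f x) ->
  cmeasurable (fun z => (1 - c z.1)%:C * chi z) ->
  kernel_bound w P0 (fun z => (1 - c z.1)%:C * chi z) k ->
  exists2 M : R, 0 <= M & forall n f, nrm (iter n S f) <= M * (X / r) ^+ n * nrm f.
Proof.
move=> hr hr' mchi X0 chiX SE mth bth.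
have r0 : 0 < r by case/andP: hr => r_gt1 _; exact: lt_trans r_gt1.
have [V [M [mV M0 wV PV]]] := lyapunov_function hr hr'.
have V0 x : 0 <= V x by have /andP[wv _] := wV x; exact: le_trans (ltW (wgt0 x)) wv.
exists M => //.
have c1 x : 0 <= 1 - c x by rewrite subr_ge0; case/andP: (minor_coef_itv x).
have Xr : 0 <= X / r by rewrite divr_ge0// ltW.
have step n f x : normc (iter n S f x) <= nrm f * (X / r) ^+ n * V x.
  elim: n x => [|n IH] x /=.
    rewrite expr0 mulr1 (le_trans (Bw_pointwise f x))// ler_wpM2l ?Bw_norm_ge0//.
    by case/andP: (wV x).
  rewrite SE.
  have -> : nrm f * (X / r) ^+ n.+1 * V x = nrm f * (X / r) ^+ n * (X * (r^-1 * V x)).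
    by rewrite exprS; ring.
  apply: (normc_kernel_op_le mth bth mV _ IH); first by rewrite mulr_ge0 ?nrm_ge0// exprn_ge0.
  have mVE : measurable_fun setT (fun y => (V y)%:E) by exact/measurable_EFinP.
  apply: (@le_trans _ _ (X%:E * ((1 - c x)%:E * \int[P0 x]_y (V y)%:E))%E); last first.
    by rewrite [leRHS]EFinM lee_wpmul2l ?lee_fin.
  rewrite muleA -EFinM -ge0_integralZl_EFin//; last 2 first.
  - by move=> y _; rewrite lee_fin.
  - by rewrite mulr_ge0.
  apply: ge0_le_integral => //.
  - by move=> y _; rewrite lee_fin mulr_ge0 ?normc_ge0.
  - apply/measurable_EFinP/measurable_funM => //.
    exact: (measurable_normc (cmeasurable_section x mth)).
  - by apply: emeasurable_funM => //; exact: measurable_cst.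
  move=> y _; rewrite -EFinM lee_fin normcM normc_real//= mulrC ler_wpM2r//.
  by rewrite mulrC ler_wpM2r.
move=> n f; apply: Bw_norm_le.
  by rewrite mulr_ge0 ?nrm_ge0// mulr_ge0// exprn_ge0.
move=> x; rewrite ler_pdivrMl//; apply: le_trans (step n f x) _.
have /andP[_ VM] := wV x.
apply: (@le_trans _ _ (nrm f * (X / r) ^+ n * (M * w x))).
  by rewrite ler_wpM2l// mulr_ge0 ?nrm_ge0// exprn_ge0.
by rewrite le_eqVlt; apply/orP; left; apply/eqP; ring.
Qed.

Variable x0 : E.
Hypothesis halpha : Hclass w nu alpha.

Lemma cmeasurable_minor_coef (g : R -> R) : measurable_fun setT g ->
  cmeasurable (fun z : E * E => (g (c z.1))%:C).
Proof.
move=> mg; apply: cmeasurable_real.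
apply: (measurableT_comp mg); apply: measurable_funM; first exact: measurable_cst.
exact: (measurableT_comp (measurable_indic mC) measurable_fst).
Qed.

Section one_multiplier.
Variables (chi : E * E -> R[i]) (X : R).
Hypotheses (mchi : cmeasurable chi) (X0 : 0 <= X) (chiX : forall z, normc (chi z) <= X).

(** [L] is chosen before [r]: one operator must be covered at the rate of every admissible [r],
    since [rb] is a supremum that may not be attained. *)
Lemma covered_iterates : exists L : {linear Bw w -> Bw w},
  [/\ forall f x, L f x = kernel_op_chi P chi f x,
      forall f, nrm (L f) <= X * (1 + eta) * nrm f &
      forall r, 1 < r <= r1 -> (residual_gf r < inv_1subb b)%E ->
      forall B, X / r < B -> exists2 rho, 0 < rho < B &
        forall e : R, 0 < e -> exists n, finitely_covered (iter n L) (e * rho ^+ n)].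
Proof.
have eta1 : 0 <= 1 + eta by rewrite addr_ge0.
have wP := drift_weight.
have [k k0 wP0] := residual_weight.
have cx x := minor_coef_itv x.
pose s z : R[i] := (1 - c z.1)%:C * chi z.
pose t z : R[i] := (c z.1)%:C * chi z.
have ms : cmeasurable s.
  apply: cmeasurableM => //; apply: (@cmeasurable_minor_coef (fun u => 1 - u)).
  exact: measurable_funB.
have mt : cmeasurable t.
  by apply: cmeasurableM => //; exact: (@cmeasurable_minor_coef id).
have sX z : normc (s z) <= X.
  have /andP[c0 c1] := cx z.1; rewrite normcM normc_real ?subr_ge0//.
  by rewrite (le_trans _ (chiX z))// ler_piMl ?normc_ge0// gerBl.
have tX z : normc (t z) <= X.
  have /andP[c0 c1] := cx z.1; rewrite normcM normc_real//.
  by rewrite (le_trans _ (chiX z))// ler_piMl ?normc_ge0.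
have bP := kernel_bound_weight eta1 X0 wP mchi chiX.
have bs := kernel_bound_weight k0 X0 wP0 ms sX.
have b0 := kernel_bound_weight k0 X0 wP0 mchi chiX.
have [cn _ bn] := kernel_bound_density halpha mchi X0 chiX.
have [ct ct0 bt] := kernel_bound_density halpha mt X0 tX.
have [L [LE Lc]] := kernel_op_exists mchi (mulr_ge0 X0 eta1) bP.
have [S [SE Sc]] := kernel_op_exists ms (mulr_ge0 X0 k0) bs.
have [T [TE Tc]] := kernel_op_exists (cmeasurable_density halpha mt) ct0 bt.
exists L; split => // r hr hr' B XB.
have [M M0 Sn] := residual_iterates hr hr' mchi X0 chiX SE ms bs.
have r0 : 0 < r by case/andP: hr => r_gt1 _; exact: lt_trans r_gt1.
have bS : bounded_map S by exists (X * k); [exact: mulr_ge0|].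
have dS := dominated_kernel_op k0 X0 wP0 ms sX SE.
apply: (ess_spectral_radius_perturbation (@Bw_complete _ _ _ w) (linearP S) (linearP T) bS
  ct0 Tc _ M0 _ Sn) => //.
- move=> f; apply: val_inj; apply/funext => x.
  transitivity (S f x + T f x) => //.
  rewrite SE TE; apply: etrans (LE f x) _.
  exact: (mixture_kernel_op f x mchi bP b0 bn).
- by rewrite divr_ge0// ltW.
move=> j.
pose Sj : {linear Bw w -> Bw w} :=
  HB.pack (iter j S) (GRing.isLinear.Build _ _ _ _ (iter j S) (linear_iter j (linearP S))).
exact: (@compact_density_product _ _ _ w nu alpha halpha t X mt X0 tX x0 T Sj TE
  (bounded_iter j bS) (dominated_iter j dS)).
Qed.

End one_multiplier.

(** [h] and [residual_gf] are compared above 1, the range where the expectation over a chain is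
    known to be the generating function. *)
Lemma rb_gt1 (h : R -> \bar R) : (forall r, 1 < r -> h r = residual_gf r) ->
  1 < rb h r1 b.
Proof.
move=> hE; have [r [/andP[r_gt1 rr1] rP]] := residual_gf_small.
apply: (lt_le_trans r_gt1); apply: ub_le_sup; first by exists r1 => s [/andP[]].
by split; [rewrite rr1 ltW// (lt_trans ltr01)|rewrite hE].
Qed.

Lemma ess_spectral_radius_le_rb (h : R -> \bar R) (L : {linear Bw w -> Bw w}) (X M : R) :
  (forall r, 1 < r -> h r = residual_gf r) -> 0 <= X -> 0 <= M ->
  (forall f, nrm (L f) <= M * nrm f) ->
  (forall r, 1 < r <= r1 -> (residual_gf r < inv_1subb b)%E ->
    forall B, X / r < B -> exists2 rho, 0 < rho < B &
      forall e : R, 0 < e -> exists n, finitely_covered (iter n L) (e * rho ^+ n)) ->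
  ess_spectral_radius L <= X * (rb h r1 b)^-1.
Proof.
move=> hE X0 M0 LM cov; have r_b1 := rb_gt1 hE.
have rb0 : 0 < rb h r1 b by exact: lt_trans r_b1.
have Xr : 0 <= X * (rb h r1 b)^-1 by rewrite mulr_ge0// invr_ge0 ltW.
apply: (ess_spectral_radius_covered (@Bw_complete _ _ _ w) (linearP L)) => //; first by exists M.
move=> B XB; have B0 : 0 < B by exact: le_lt_trans XB.
(* Beyond [X / B] one has [X / r < B], and beyond 1 the comparison [hE] applies. *)
have mr : Num.max 1 (X / B) < rb h r1 b.
  by rewrite gt_max r_b1 ltr_pdivrMr// mulrC -ltr_pdivrMr.
have [|r [/andP[r0 rr1] rP] mrr] := sup_gt _ mr.
  by apply: contrapT => /set0P/negP/negPn/eqP A0; move: rb0; rewrite /rb A0 sup0 ltxx.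
move: mrr; rewrite gt_max => /andP[r_gt1 XBr].
apply: (cov r); [by rewrite r_gt1|by rewrite -hE|].
by rewrite ltr_pdivrMr ?(lt_trans ltr01)// mulrC -ltr_pdivrMr.
Qed.

(** * The spectral radius of [P] *)

Section spectral_radius_one.
Variable L : {linear Bw w -> Bw w}.
Hypothesis LE : forall f x, L f x = kernel_op_chi P (cst 1) f x.

(** One step maps the bound [a * w + m] to [(a / r1) * w + (a * eta / r1 + m)]. The increments of
    the constant form a geometric series of sum [a * eta / (r1 - 1)], so the iterates are
    bounded. *)
Lemma kernel_iterates_bound n (a m : R) (f : Bw w) : 0 <= a -> 0 <= m ->
  (forall x, normc (f x) <= a * w x + m) ->
  forall x, normc (iter n L f x) <= a * w x + (m + a * (eta / (r1 - 1))).
Proof.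
have r0 : 0 < r1 by exact: lt_trans hr1.
have r10 : 0 < r1 - 1 by rewrite subr_gt0.
have k0 : 0 <= eta / (r1 - 1) by rewrite divr_ge0// ltW.
have q0 : 0 <= r1^-1 by rewrite invr_ge0 ltW.
have bP : kernel_bound w P (cst 1) (1 * (1 + eta)).
  apply: kernel_bound_weight => //; first exact: addr_ge0.
    exact: drift_weight.
  by move=> z; rewrite normc1.
elim: n a m f => [|n IH] a m f a0 m0 fam x.
  by rewrite (le_trans (fam x))// lerD2l lerDl mulr_ge0.
rewrite iterSr; have := IH (a * r1^-1) (a * (r1^-1 * eta) + m) (L f).
have step y : normc (L f y) <= a * r1^-1 * w y + (a * (r1^-1 * eta) + m).
  rewrite LE; apply: (le_trans (normc_kernel_op_le (V := fun y => a * w y + m) (t := 1)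
    (k := a * (r1^-1 * w y) + (a * (r1^-1 * eta) + m)) _ bP _ _ _ _)) => //.
  - apply: measurable_funD => //; apply: measurable_funM => //; exact: weight_measurable.
  - by move=> z; rewrite mul1r.
  - under eq_integral do rewrite normc1 mulr1 EFinD EFinM.
    have [mw w0] := nonneg_measurable_weight w.
    rewrite ge0_integralD//; last 2 first.
    + by move=> z _; rewrite mule_ge0//; exact: w0.
    + by apply: emeasurable_funM => //; exact: measurable_cst.
    rewrite ge0_integralZl_EFin//; last by move=> z _; exact: w0.
    rewrite integral_cst// (@prob_kernel _ _ _ _ _ P y) mule1.
    apply: (@le_trans _ _ (a%:E * (r1^-1 * (w y * \1_(~` C) y + eta * \1_C y))%:E + m%:E)%E).
      by rewrite leeD2r// lee_wpmul2l ?lee_fin.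
    rewrite -EFinM -EFinD lee_fin addrA lerD2r -mulrDr ler_wpM2l// -mulrDr ler_wpM2l//.
    have wy := ltW (weight_gt0 w y).
    rewrite !indicE lerD// ler_piMr//; by case: (_ \in _).
  by rewrite mul1r mulrA.
move=> /(_ _ _ step x) /le_trans; apply; rewrite ?mulr_ge0 ?addr_ge0 ?mulr_ge0//.
have q1 : r1^-1 <= 1 by rewrite invf_le1// ltW.
have -> : a * w x + (m + a * (eta / (r1 - 1))) = a * w x + (a * (r1^-1 * eta) + m +
    a * r1^-1 * (eta / (r1 - 1))).
  by field; rewrite !gt_eqF.
by rewrite lerD2r ler_wpM2r ?(ltW (weight_gt0 w x))// ler_piMr.
Qed.

(** Along an eigenvector the iterates grow like [normc l ^+ n], against their boundedness at each
    point. *)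
Lemma eigenvalue_le1 l (u : Bw w) : 1 < normc l -> L u = l *: u -> u = 0.
Proof.
move=> l1 lu; apply: val_inj; apply/funext => x; apply: contrapT => ux.
have iu n : iter n L u x = l ^+ n * u x.
  elim: n => [|n IH]; first by rewrite expr0 mul1r.
  have -> : iter n.+1 L u = l *: iter n L u.
    by rewrite iterSr lu; elim: n {IH} => //= n ->; rewrite linearZ.
  by transitivity (l * iter n L u x) => //; rewrite IH exprS mulrA.
have ux0 : 0 < normc (u x) by apply: normc_gt0; apply/eqP.
pose D := Bw_norm u * w x + (0 + Bw_norm u * (eta / (r1 - 1))).
have uD n : normc l ^+ n * normc (u x) <= D.
  rewrite -normc_natX -normcM -iu; apply: kernel_iterates_bound => //; first exact: Bw_norm_ge0.
  by move=> y; rewrite addr0; exact: Bw_pointwise.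
have D0 : 0 <= D.
  by apply: le_trans (uD 0%N); rewrite expr0 mul1r normc_ge0.
have l0 : 0 < normc l by exact: lt_trans l1.
have q0 : 0 < (normc l)^-1 by rewrite invr_gt0.
have q1 : (normc l)^-1 < 1 by rewrite invf_lt1.
have [n] := affine_geometric_small D0 (lexx 0) q0 q1 (divr_gt0 ux0 (ltr0Sn _ 1)).
rewrite mul0r addr0 exprVn ler_pdivrMr ?exprn_gt0// => /(le_trans (uD n)).
rewrite mulrC ler_pM2r ?exprn_gt0// => ?; lra.
Qed.

(** The constant function 1 is an eigenvector; a resolvent at 1 would send 0 to it. *)
Lemma one_in_spectrum : spectrum_on L setT 1.
Proof.
have one_in : (cst 1 : E -> R[i]) \in Bw_pred w.
  rewrite inE; split; first exact: cmeasurable_cst.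
  exists 1 => x; rewrite normc1 mulr1 invf_le1//; exact: weight_ge1.
pose u : Bw w := MkBw one_in.
have Lu : L u = u.
  apply: val_inj; apply/funext => x; apply: etrans (LE u x) _.
  rewrite /kernel_op_chi /cintegral /= !mulr0 mul0r addr0 subr0 mulr1.
  by rewrite !Rintegral_cst// mul0r mul1r (@prob_kernel _ _ _ _ _ P x).
move=> [S [[_ Slin _]]] /(_ u Logic.I) [Su _].
have S0 : S 0 = 0.
  have := Slin 1 0 0 Logic.I Logic.I; rewrite scaler0 addr0 scale1r => /eqP.
  by rewrite -subr_eq0 opprD addNKr oppr_eq0 => /eqP.
move: Su; rewrite Lu scale1r subrr S0 => /(congr1 (fun v : Bw w => v x0)) /= /eqP.
by rewrite eq_sym oner_eq0.
Qed.

(** Spectral values of modulus above [rho] are eigenvalues, so the bound on eigenvalues bounds the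
    whole spectrum. *)
Lemma spectral_radius_kernel_op rho : bounded_map L -> 0 < rho < 1 ->
  (forall e : R, 0 < e -> exists n, finitely_covered (iter n L) (e * rho ^+ n)) ->
  spectral_radius L = 1.
Proof.
move=> bL /andP[rho0 rho1] cov.
have ub1 : ubound [set normc l | l in spectrum_on L setT] 1.
  move=> _ [l ll <-]; rewrite leNgt; apply/negP => l1; apply: ll.
  apply: (resolvent_on_injective (linearP L) bL rho0 cov (@Bw_complete _ _ _ w)) => //.
  - by rewrite ltW// (lt_trans rho1).
  - by move=> u _; exact: eigenvalue_le1.
have mem1 : [set normc l | l in spectrum_on L setT] 1.
  by exists 1; [exact: one_in_spectrum|rewrite normc1].
apply/eqP; rewrite eq_le; apply/andP; split.
  by apply: ge_sup => //; exists 1.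
by apply: ub_le_sup => //; exists 1.
Qed.

End spectral_radius_one.

End minorized_kernel.

(** * Hitting times of the Markov chain *)

Section markov_chain_hitting.
Context {R : realType} {d d' : measure_display}.
Context {E : measurableType d} {Omega : measurableType d'}.
Variables (P : R.-pker E ~> E) (C : set E) (X : nat -> Omega -> E) (Pr : E -> probability Omega R).
Hypotheses (mC : measurable C) (chain : markov_chain P X Pr).
Local Open Scope ereal_scope.

(** The inequality is strict, so [avoids n.+1] belongs to the history up to time [n], on which the
    Markov property conditions. *)
Definition avoids n : set Omega := [set o | forall k, (k < n)%N -> ~ C (X k o)].

Lemma avoidsS n : avoids n.+1 = avoids n `&` X n @^-1` (~` C).
Proof.
apply/seteqP; split=> o.
  by move=> av; split=> [k kn|]; apply: av => //; exact: ltnW.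
move=> [av nC] k; rewrite ltnS leq_eqVlt => /orP[/eqP ->//|]; exact: av.
Qed.

Lemma measurable_chain n (A : set E) : measurable A -> measurable (X n @^-1` A).
Proof. by move=> mA; have [mX _ _] := chain; rewrite -(setTI (_ @^-1` _)); exact: mX. Qed.

Lemma measurable_avoids n : measurable (avoids n).
Proof.
elim: n => [|n IH].
  by rewrite (_ : avoids 0 = setT)//; apply/seteqP; split.
by rewrite avoidsS; apply: measurableI => //; apply: measurable_chain; exact: measurableC.
Qed.

Lemma history_avoids n m : (m <= n)%N -> history X n (avoids m.+1).
Proof.
elim: m => [|m IH] mn.
  rewrite avoidsS (_ : avoids 0 = setT); last by apply/seteqP; split.
  rewrite setTI; apply: sub_sigma_algebra; exists 0%N => //.
  by exists (~` C); [exact: measurableC|rewrite setTI].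
rewrite avoidsS.
have hm : history X n (avoids m.+1) by apply: IH; exact: ltnW.
apply: (@measurableI _ (g_sigma_algebraType (\bigcup_(k in [set k | (k <= n)%N])
  preimage_set_system [set: Omega] (X k) measurable))); first exact: hm.
apply: sub_sigma_algebra; exists m.+1 => //.
by exists (~` C); [exact: measurableC|rewrite setTI].
Qed.

Lemma daniell_comp_chain (mu : {measure set Omega -> \bar R}) (B : set Omega) n : measurable B ->
  daniell (fun g : E -> \bar R => \int[mu]_(o in B) g (X n o)).
Proof.
move=> mB; have [mX _ _] := chain.
have mg g : nonneg_measurable g -> measurable_fun B (fun o => g (X n o)).
  by move=> [mg _]; apply: measurable_funTS; apply: (measurableT_comp mg).
split.
- by move=> g [_ g0]; apply: integral_ge0.
- move=> g h ng nh; rewrite ge0_integralD//; [by move=> o _; case: ng|exact: mg| |exact: mg].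
  by move=> o _; case: nh.
- move=> c g c0 ng; rewrite ge0_integralZl_EFin//; [by move=> o _; case: ng|exact: mg].
- move=> g ng; rewrite integral_nneseries//; [by move=> k; exact: mg|].
  by move=> k o _; case: (ng k).
Qed.

Lemma daniell_posop (Lam : (E -> \bar R) -> \bar R) Psi : daniell Lam -> positive_operator Psi ->
  daniell (fun g => Lam (Psi g)).
Proof.
move=> dL pP; split.
- by move=> g ng; apply: (daniell_ge0 dL); exact: posop_measurable.
- by move=> g h ng nh; rewrite (posopD pP)// (daniellD dL)//; exact: posop_measurable.
- by move=> c g c0 ng; rewrite (posopZ pP)// (daniellZ dL)//; exact: posop_measurable.
- by move=> g ng; rewrite (posop_series pP)// (daniell_series dL)// => n; exact: posop_measurable.
Qed.

Lemma daniell_eval (y : E) : daniell (fun g : E -> \bar R => g y).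
Proof. by split => // g [_]. Qed.

Lemma integral_indic_chain (mu : {measure set Omega -> \bar R}) (B : set Omega) n (A : set E) :
  measurable B -> measurable A ->
  \int[mu]_(o in B) (\1_A (X n o) : R)%:E = mu (B `&` X n @^-1` A).
Proof.
move=> mB mA; transitivity (\int[mu]_(o in B) (\1_(X n @^-1` A) o : R)%:E) => //.
by rewrite integral_indic 1?setIC//; exact: measurable_chain.
Qed.

(** One Markov step conditions on [avoids n.+1]; [daniell_eq] extends it from events to functions,
    and the constraint at time [n] becomes the indicator in [killed]. *)
Lemma killed_chain y n (f : E -> \bar R) : nonneg_measurable f ->
  \int[Pr y]_(o in avoids n) f (X n o) = iter n (killed P C) f y.
Proof.
have [mX X0 markov] := chain.
elim: n f => [|n IH] f nf.
  rewrite /= (_ : avoids 0 = setT); last by apply/seteqP; split.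
  apply: (daniell_eq (daniell_comp_chain (Pr y) 0 measurableT) (daniell_eval y)) => // A mA.
  rewrite (integral_indic_chain (Pr y) 0 measurableT mA) setTI.
  by apply: etrans (X0 y A mA) _; rewrite diracE indicE.
have mB := measurable_avoids n.+1.
pose PP (g : E -> \bar R) x := \int[P x]_z g z.
have pPP : positive_operator PP by exact: positive_operator_kernel.
rewrite (daniell_eq (daniell_comp_chain (Pr y) n.+1 mB)
  (daniell_posop (daniell_comp_chain (Pr y) n mB) pPP) _ nf); last first.
  move=> A mA; rewrite (integral_indic_chain (Pr y) n.+1 mB mA).
  apply: etrans (markov y n A _ mA (history_avoids (leqnn n))) _.
  by apply: eq_integral => o _; rewrite /PP integral_indic// setIT.
rewrite iterSr -IH; last exact: (posop_measurable (positive_operator_killed P mC)).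
rewrite avoidsS [LHS]integral_mkcond [RHS]integral_mkcond; apply: eq_integral => o _.
rewrite !patchE in_setI; case: (o \in avoids n) => //=.
rewrite /killed indicE; rewrite (_ : (o \in X n @^-1` (~` C)) = (X n o \in ~` C)).
  by case: (_ \in _); rewrite ?mul1e ?mul0e.
by apply/idP/idP => /set_mem H; apply/mem_set.
Qed.

Lemma hit_probability y n : Pr y (avoids n `&` X n @^-1` C) = hit P C n y.
Proof.
rewrite -(integral_indic_chain (Pr y) n (measurable_avoids n) mC).
exact: (killed_chain y n (@nonneg_measurable_indic R _ _ C mC)).
Qed.

Variables (w : weight R E) (r1 : R).
Hypothesis hr1 : (1 < r1)%R.
Hypothesis killed_weight : forall x, killed P C (EFin \o w) x <= (r1^-1 * w x)%:E.

Definition never_hits : set Omega := \bigcap_n avoids n.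

(** Since [w >= 1], the probability of avoiding [C] before time [n] is at most [iter n] of [killed]
    on [w], hence at most [w y / r1 ^ n]. *)
Lemma never_hits_null y : Pr y never_hits = 0.
Proof.
have pk := positive_operator_killed P mC; have nw := nonneg_measurable_weight w.
have r0 : (0 < r1)%R by exact: lt_trans hr1.
have ri0 : (0 <= r1^-1)%R by rewrite invr_ge0 ltW.
have iterw n x : iter n (killed P C) (EFin \o w) x <= (r1^-1 ^+ n * w x)%:E.
  elim: n x => [|n IH] x; first by rewrite expr0 mul1r.
  rewrite iterS; apply: (@le_trans _ _ (killed P C (fun x => (r1^-1 ^+ n)%:E * (w x)%:E) x)).
    apply: (posop_le pk).
    - exact: (posop_measurable (positive_operator_iter n pk)).
    - apply: (nonneg_measurableZ _ _ nw); first exact: measurable_cst.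
      by move=> _; rewrite exprn_ge0.
    - by move=> z; rewrite -EFinM; exact: IH.
  rewrite (posopZ pk)//; last exact: exprn_ge0.
  rewrite exprSr -mulrA [leRHS]EFinM lee_wpmul2l ?lee_fin ?exprn_ge0//.
have le_n n : Pr y never_hits <= (r1^-1 ^+ n * w y)%:E.
  have n1 : nonneg_measurable (cst 1 : E -> \bar R) by split => //; exact: measurable_cst.
  apply: le_trans (iterw n y); apply: (@le_trans _ _ (iter n (killed P C) (cst 1) y)).
    rewrite -(killed_chain y n n1) integral_cst ?mul1e; last exact: measurable_avoids.
    apply: le_measure; rewrite ?inE.
    - by apply: bigcapT_measurable => k; exact: measurable_avoids.
    - exact: measurable_avoids.
    - by move=> o; apply.
  apply: (posop_le (positive_operator_iter n pk)) => // z.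
  by rewrite lee_fin weight_ge1.
apply/eqP; rewrite eq_le measure_ge0 andbT; apply/lee_addgt0Pr => e e0.
rewrite add0e.
have wy0 : (0 <= w y)%R by rewrite ltW// weight_gt0.
have q0 : (0 < r1^-1)%R by rewrite invr_gt0.
have q1 : (r1^-1 < 1)%R by rewrite invf_lt1.
have [n nP] := affine_geometric_small wy0 (lexx 0%R) q0 q1 e0.
by apply: le_trans (le_n n) _; rewrite lee_fin mulrC; move: nP; rewrite mul0r addr0.
Qed.

(** For [r > 1] the value at an infinite time is [+oo]; the last term records it, with [+oo * 0 = 0]
    elsewhere. At most one term of the series is nonzero. *)
Lemma expe_hitting_time (r : R) (o : Omega) : (1 < r)%R ->
  Defs.expe r (hitting_time X C o) =
  \sum_(n <oo) (r ^+ n)%:E * (\1_(avoids n `&` X n @^-1` C) o)%:E + +oo * (\1_never_hits o)%:E.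
Proof.
move=> r_gt1; rewrite /hitting_time.
have [[n0 Cn0]|nC] := pselect (exists n, C (X n o)); last first.
  have no : never_hits o by move=> n _ k _ Ck; apply: nC; exists k.
  rewrite indicE mem_set// mule1 (_ : [set _ | n in _] = set0); last first.
    by rewrite -subset0 => z [n Cn _]; apply: nC; exists n.
  rewrite ereal_inf0 /Defs.expe ltNge (ltW r_gt1) /= gt_eqF// addey//.
  rewrite gt_eqF// (@lt_le_trans _ _ 0)//; apply: nneseries_ge0 => n _ _.
  by rewrite mule_ge0// lee_fin// exprn_ge0// ltW// (lt_trans ltr01).
have ex : exists n, `[< C (X n o) >] by exists n0; apply/asboolP.
pose n := ex_minn ex.
have [Cn nmin] : C (X n o) /\ forall k, C (X k o) -> (n <= k)%N.
  rewrite /n; case: ex_minnP => m /asboolP Cm mmin; split => // k Ck.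
  by apply: mmin; apply/asboolP.
have avn : avoids n o by move=> k kn Ck; have := nmin k Ck; rewrite leqNgt kn.
have -> : ereal_inf [set k%:R%:E | k in [set k : nat | C (X k o)]] = n%:R%:E :> \bar R.
  apply/eqP; rewrite eq_le; apply/andP; split; first by apply: ereal_inf_lbound; exists n.
  by apply: le_ereal_inf_tmp => _ [k /= Ck <-]; rewrite lee_fin ler_nat nmin.
rewrite /Defs.expe powR_mulrn; last by rewrite ltW// (lt_trans ltr01).
have -> : \1_never_hits o = 0%R :> R.
  by rewrite indicE memNset// => /(_ n.+1 Logic.I n (ltnSn n)).
rewrite mule0 adde0 (nneseriesD1 (n := n))//; last first.
  by move=> k _; rewrite mule_ge0// lee_fin// exprn_ge0// ltW// (lt_trans ltr01).
rewrite indicE mem_set// mule1 eseries0 ?adde0// => k _ /= kn.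
rewrite indicE memNset ?mule0// => -[avk Ck].
have nk := nmin k Ck; have : (n < k)%N by rewrite ltn_neqAle eq_sym kn.
by move=> /avk; exact.
Qed.

Lemma expectation_expe (r : R) y : (1 < r)%R ->
  \int[Pr y]_o Defs.expe r (hitting_time X C o) = hit_gf P C r y.
Proof.
move=> r_gt1; have r0 : (0 <= r)%R by rewrite ltW// (lt_trans ltr01).
under eq_integral do rewrite expe_hitting_time//.
have mD n : measurable (avoids n `&` X n @^-1` C).
  by apply: measurableI; [exact: measurable_avoids|exact: measurable_chain].
have mN : measurable never_hits by apply: bigcapT_measurable => k; exact: measurable_avoids.
have nt n : nonneg_measurable (fun o => (r ^+ n)%:E * (\1_(avoids n `&` X n @^-1` C) o : R)%:E).
  apply: (@nonneg_measurableZ _ _ _ (cst (r ^+ n)%R)) => //; last exact: nonneg_measurable_indic.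
  by move=> o; exact: exprn_ge0.
have [mN' N0] := @nonneg_measurable_indic R _ _ _ mN.
rewrite ge0_integralD//; last 3 first.
- by move=> o _; apply: nneseries_ge0 => n _ _; case: (nt n).
- by case: (nonneg_measurable_series nt).
- by apply: emeasurable_funM => //; exact: measurable_cst.
have -> : \int[Pr y]_o (+oo * (\1_never_hits o : R)%:E) = 0.
  rewrite ge0_integralZl// integral_indic// setIT.
  by apply: etrans (congr1 _ (never_hits_null y)) _; rewrite mule0.
rewrite adde0.
rewrite integral_nneseries//; last 2 first.
- by move=> n; case: (nt n).
- by move=> n o _; case: (nt n).
apply: eq_eseriesr => n _.
have [mi i0] := @nonneg_measurable_indic R _ _ _ (mD n).
rewrite ge0_integralZl_EFin//; last exact: exprn_ge0.
by rewrite integral_indic// setIT; congr (_ * _); exact: hit_probability.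
Qed.

End markov_chain_hitting.

Lemma killed_drift (R : realType) (d : measure_display) (E : measurableType d)
    (P : R.-pker E ~> E) (C : set E) (w : weight R E) (r1 eta : R) :
  1 < r1 ->
  (forall x, (\int[P x]_y (w y)%:E <=
    (r1^-1 * (w x * \1_(~` C) x + eta * \1_C x))%:E)%E) ->
  forall x, (killed P C (EFin \o w) x <= (r1^-1 * w x)%:E)%E.
Proof.
move=> hr1 drift x; have wx := ltW (weight_gt0 w x).
have r0 : 0 <= r1^-1 by rewrite invr_ge0 ltW// (lt_trans ltr01).
rewrite /killed; case: (indicC_cases (R := R) C x) => -[Cx [i1 i2]]; rewrite i2.
  by rewrite mul0e lee_fin mulr_ge0.
by rewrite mul1e; have := drift x; rewrite i1 i2 mulr1 mulr0 addr0.
Qed.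

Theorem mainTheorem5 (R : realType) (d : measure_display)
  (E : measurableType d) (P : R.-pker E ~> E)
  (C : set E) (mC : measurable C) (C0 : C !=set0)
  (w : weight R E) (r1 eta : R) (hr1 : 1 < r1) (heta : 0 <= eta)
  (drift : forall x, (\int[P x]_y (w y)%:E <=
     (r1^-1 * (w x * \1_(~` C) x + eta * \1_C x))%:E)%E)
  (b : R) (hb : 0 < b <= 1) (nu : probability E R) (alpha : E * E -> R)
  (halpha : alpha \in Hclass w nu) (hT : is_markov (Tker nu alpha))
  (minor : forall x A, measurable A ->
     ((b * \1_C x)%:E * Tker nu alpha x A <= P x A)%E) :
  exists PB : {linear Bw w -> Bw w},
    [/\ bounded_action (kernel_op P) PB,
        quasi_compact PB & spectral_radius PB = 1] /\
  exists P0 : R.-pker E ~> E, represents P0 (residual P b C (Tker nu alpha)) /\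
  forall (d' : measure_display) (Omega : measurableType d')
    (X : nat -> Omega -> E) (Pr : E -> probability Omega R),
    markov_chain P X Pr ->
    let h := hfun P0 X Pr C in
    let r_b := rb h r1 b in
    [/\ (h r1 < +oo)%E /\ 1 < r_b,
        ess_spectral_radius PB <= r_b^-1 &
        forall chi : E * E -> R[i], chi \in bounded_cmeasurable ->
          exists Pchi : {linear Bw w -> Bw w},
            bounded_action (kernel_op_chi P chi) Pchi /\
            (supnorm chi * r_b^-1 < spectral_radius Pchi ->
             quasi_compact Pchi /\
             ess_spectral_radius Pchi <= supnorm chi * r_b^-1)].
Proof.
have [x0 _] := C0; have [K KE] := hT; rewrite inE in halpha.
have [malpha alpha0 _] := halpha.
have minorK x A : measurable A -> ((b * \1_C x)%:E * K x A <= P x A)%E.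
  by move=> mA; rewrite KE//; exact: minor.
have [P0 P0E] := residual_exists mC hb minorK.
have eta1 : 0 <= 1 + eta by rewrite addr_ge0.
have cov chi X mchi X0 chiX := @covered_iterates R d E P P0 K C b nu alpha
  mC hb malpha alpha0 KE minorK P0E w r1 eta hr1 heta drift x0 halpha chi X mchi X0 chiX.
have one_le (z : E * E) : normc (cst (1 : R[i]) z) <= 1 by rewrite normc1.
have [PB [PBE PBb PBcov]] := cov _ 1 (cmeasurable_cst 1) ler01 one_le.
have bPB : bounded_map PB by exists (1 * (1 + eta)); [rewrite mul1r|exact: PBb].
(* An admissible [r > 1] obtained without a chain: quasi-compactness and the spectral radius come
   before the chain is introduced. *)
have [r [hr rP]] := residual_gf_small mC hb malpha alpha0 KE minorK P0E hr1 heta drift.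
have r_gt1 : 1 < r by case/andP: hr.
have r0 : 0 < r by exact: lt_trans r_gt1.
have radPB : spectral_radius PB = 1.
  have [|rho rho01 rhoP] := PBcov r hr rP 1; first by rewrite ltr_pdivrMr// mul1r.
  exact: (spectral_radius_kernel_op hr1 heta drift x0 PBE bPB rho01 rhoP).
exists PB; split; first split => //.
- apply: (bounded_actionI (c := 1 * (1 + eta))) => // f x; rewrite PBE.
  by congr cintegral; apply/funext => y; rewrite mulr1.
- rewrite /quasi_compact radPB; apply: (@le_lt_trans _ _ (1 / r)).
    apply: (ess_spectral_radius_covered (@Bw_complete _ _ _ w) (linearP PB)) => //.
      by rewrite divr_ge0// ltW.
    exact: PBcov.
  by rewrite ltr_pdivrMr// mul1r.
exists P0; split.
  move=> x A mA; rewrite P0E// /residual; case: ifP => // _.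
  by rewrite KE.
move=> d' Omega X Pr chain h r_b.
(* The drift makes never hitting [C] a null event, so the infinite value of [expe] does not
   contribute. *)
have hE s : 1 < s -> h s = residual_gf P P0 C s.
  move=> s1; congr ereal_sup; apply/seteqP; split => _ [x Cx <-]; exists x => //;
    apply: eq_integral => y _; congr (_ * _)%E;
    by rewrite (expectation_expe mC chain hr1 (killed_drift hr1 drift)).
have le_rb := ess_spectral_radius_le_rb mC hb malpha alpha0 KE minorK P0E hr1 heta drift hE.
split.
- split; last exact: (rb_gt1 mC hb malpha alpha0 KE minorK P0E hr1 heta drift hE).
  by rewrite hE//; exact: (residual_gf_lty mC hb malpha alpha0 KE minorK P0E hr1 heta drift).
(* [P] is the case of the multiplier 1, bounded by [X = 1]. *)
- rewrite -[leRHS]mul1r; apply: (le_rb PB 1 (1 * (1 + eta))) => //; by rewrite mul1r.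
move=> chi; rewrite inE => -[mchi [M chiM]].
have chiX z : normc (chi z) <= supnorm chi.
  by apply: ub_le_sup; [exists M => _ [z' _ <-]|exists z].
have X0 : 0 <= supnorm chi by apply: le_trans (chiX (x0, x0)); exact: normc_ge0.
have [Pchi [PE Pb Pcov]] := cov _ _ mchi X0 chiX.
have := le_rb Pchi _ _ X0 (mulr_ge0 X0 eta1) Pb Pcov.
exists Pchi; split; first exact: bounded_actionI Pb.
by move=> lt; split => //; exact: le_lt_trans lt.
Qed.
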